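(* Let $m,n\in\mathbb{N}$. Let $\varphi=(\varphi_1,\dots,\varphi_n):\mathbb{N}\to\mathbb{R}_+^n$ be an $n$-tuple of non-increasing positive functions with $\lim_{q\to\infty}\varphi_j(q)=0$ for $1\le j\le n$, and let $\Phi=(\Phi_1,\dots,\Phi_m):\mathbb{N}\to\mathbb{R}_+^m$ be an $m$-tuple of non-decreasing positive functions with $\lim_{q\to\infty}\Phi_k(q)=\infty$ for $1\le k\le m$. Suppose there are constants $N_0,M\in\mathbb{N}$ with $M\ge2$ and $c_1,c_2>1$ such that for every integer $j\ge N_0$ $$c_1\Phi_k(M^j)\le\Phi_k(M^{j+1})\le c_2\Phi_k(M^j)\qquad(k=1,\dots,m).$$ Then $$\mu^{\mathbb{C}}_{m\times n}\left(W^{\mathbb{C}}_{n,m}(\varphi,\Phi)\right)=\begin{cases}0&\text{if }\sum_{q=1}^\infty\frac1q\left(\prod_{j=1}^n\varphi_j(q)\prod_{k=1}^m\Phi_k(q)\right)^2<\infty,\\ 1&\text{if }\sum_{q=1}^\infty\frac1q\left(\prod_{j=1}^n\varphi_j(q)\prod_{k=1}^m\Phi_k(q)\right)^2=\infty.\end{cases}$$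
   Context: For $z\in\mathbb{C}$, $\llbracket z\rrbracket=\min\{|z-p|:p\in\mathbb{Z}[i]\}$, where $|\cdot|$ is the Euclidean norm on $\mathbb{C}$. $I_{\mathbb{C}}=\{z\in\mathbb{C}:-\frac12\le\Re(z)\le\frac12,\ -\frac12\le\Im(z)\le\frac12\}$, and $I_{\mathbb{C}}^{m\times n}$ is the set of $m\times n$ matrices with entries in $I_{\mathbb{C}}$; $A_j$ is the $j$-th column of $A$. $W^{\mathbb{C}}_{n,m}(\varphi,\Phi)\subseteq I_{\mathbb{C}}^{m\times n}$ is the set of matrices $A$ such that for infinitely many integers $u\ge1$ there is a non-zero row vector $\mathbf q=(q_1,\dots,q_m)\in\mathbb{Z}[i]^{1\times m}$ with $\llbracket\mathbf qA_j\rrbracket<\varphi_j(u)$ for $1\le j\le n$ and $|q_k|\le\Phi_k(u)$ for $1\le k\le m$. $\mu^{\mathbb{C}}_{m\times n}$ is Lebesgue measure on $\mathbb{C}^{m\times n}$. *)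

(* Defs.v *)
From HB Require Import structures.
From mathcomp Require Import all_boot all_order all_algebra.
From mathcomp Require Import all_classical all_reals all_analysis.
From mathcomp Require Import complex.
From mathcomp Require Import ring lra.
Set Implicit Arguments.
Unset Strict Implicit.
Unset Printing Implicit Defensive.
Import Order.TTheory GRing.Theory Num.Theory.
Import numFieldNormedType.Exports.
Local Open Scope classical_set_scope.
Local Open Scope ring_scope.

Section sigma_finite_measure_of.
Context d (T : measurableType d) (R : realType).
Variables (m : {measure set T -> \bar R}) (sf : sigma_finite setT m).

Definition sigma_finite_measure_of of sigma_finite setT m : set T -> \bar R := m.

HB.instance Definition _ := Measure.copy (sigma_finite_measure_of sf) m.
HB.instance Definition _ :=
  Measure_isSigmaFinite.Build _ _ _ (sigma_finite_measure_of sf) sf.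

Lemma sigma_finite_measureE :
  exists nu : {sigma_finite_measure set T -> \bar R}, m = nu :> (set T -> \bar R).
Proof. by exists [the sigma_finite_measure _ _ of sigma_finite_measure_of sf]. Qed.

End sigma_finite_measure_of.

(* The canonical sigma-finite instance on [\x] only covers subprobabilities, so
   [m1 \x m2] is not inferred to be sigma-finite in general. *)
Lemma product_sigma_finite d1 d2 (T1 : measurableType d1)
    (T2 : measurableType d2) (R : realType)
    (m1 : {sigma_finite_measure set T1 -> \bar R})
    (m2 : {sigma_finite_measure set T2 -> \bar R}) :
  exists nu : {sigma_finite_measure set (T1 * T2)%type -> \bar R},
    (m1 \x m2)%E = nu.
Proof.
apply: (@sigma_finite_measureE _ _ _ [the {measure set (T1 * T2)%type -> \bar R} of (m1 \x m2)%E]).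
have [] := lebesgue_integral_fubini.measure_function_Measure_isSigmaFinite__to__measure_function_isSigmaFinite m1 m2.
by [].
Qed.

Lemma pushforward_sigma_finite d1 d2 (T1 : measurableType d1)
    (T2 : measurableType d2) (R : realType)
    (m : {sigma_finite_measure set T1 -> \bar R}) (f : T1 -> T2) (g : T2 -> T1) :
  measurable_fun setT f -> measurable_fun setT g -> cancel f g ->
  exists nu : {sigma_finite_measure set T2 -> \bar R}, pushforward m f = nu.
Proof.
move=> mf mg fK.
have sf : sigma_finite setT (pushforward m f).
  have [F TF Foo] := sigma_finiteT m.
  exists (fun k => g @^-1` F k); first by rewrite -preimage_bigcup -TF preimage_setT.
  move=> k; have [mF Fk] := Foo k; split.
    by rewrite -[X in measurable X]setTI; exact: mg.
  rewrite /pushforward -comp_preimage (_ : _ \o _ = id) ?preimage_id//.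
  by apply/funext => p /=; rewrite fK.
have [P PE] : exists P : {measure set T2 -> \bar R}, pushforward m f = P.
  by exists (measure_function_pushforward__canonical__measure_function_Measure m mf).
rewrite PE in sf *; exact: sigma_finite_measureE.
Qed.

(* The n-th power of a measure [mu], as the iterated product
   mu \x (mu \x (... \x mu)) transported to [n.-tuple T] by [cons]. *)
Section power_measure.
Context d (T : measurableType d) (R : realType).

Fixpoint power_measure (mu : set T -> \bar R) (n : nat) :
    set (n.-tuple T) -> \bar R :=
  match n with
  | 0 => dirac [tuple]
  | n'.+1 => pushforward (mu \x @power_measure mu n')%E
               (fun p : T * n'.-tuple T => [the n'.+1.-tuple T of p.1 :: p.2])
  end.

Arguments power_measure : clear implicits.

Variable mu : {sigma_finite_measure set T -> \bar R}.

Let consT n (p : T * n.-tuple T) := [the n.+1.-tuple T of p.1 :: p.2].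
Let unconsT n (t : n.+1.-tuple T) : T * n.-tuple T :=
  (thead t, [tuple of behead t]).

Let measurable_consT n : measurable_fun [set: T * n.-tuple T] (@consT n).
Proof. exact: measurable_cons. Qed.

Let measurable_unconsT n : measurable_fun [set: n.+1.-tuple T] (@unconsT n).
Proof.
apply/measurable_fun_pairP; split; first exact: measurable_tnth.
exact: measurable_behead.
Qed.

Let unconsTK n : cancel (@consT n) (@unconsT n).
Proof. by case=> x t; rewrite /consT /unconsT; congr pair; apply/val_inj. Qed.

Lemma power_measure_sigma_finite n :
  exists nu : {sigma_finite_measure set (n.-tuple T) -> \bar R},
    power_measure mu n = nu.
Proof.
elim: n => [|n [nu nuE]] /=.
  have sf : sigma_finite setT (@dirac _ (0.-tuple T) [tuple] R).
    by apply: fin_num_fun_sigma_finite => //; rewrite measure0.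
  pose S := Measure_isSigmaFinite.Build _ _ _ (@dirac _ (0.-tuple T) [tuple] R) sf.
  pose D : {sigma_finite_measure set (0.-tuple T) -> \bar R} :=
    HB.pack (@dirac _ (0.-tuple T) [tuple] R) S.
  by exists D.
rewrite nuE; have [N ->] := product_sigma_finite mu nu.
exact: pushforward_sigma_finite (@measurable_consT n) (@measurable_unconsT n)
  (@unconsTK n).
Qed.

Lemma power_measure_box n (X : 'I_n -> set T) : (forall i, measurable (X i)) ->
  power_measure mu n [set t | forall i, X i (tnth t i)] =
  (\prod_(i < n) mu (X i))%E.
Proof.
elim: n X => [|n IHn] X mX /=.
  by rewrite big_ord0 diracE mem_set//= => -[].
rewrite big_ord_recl -(IHn (fun i => X (lift ord0 i)))// /pushforward.
have [nu nuE] := power_measure_sigma_finite n; rewrite nuE.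
rewrite -product_measure1E//; last first.
  rewrite (_ : mkset _ = \bigcap_(i in [set: 'I_n])
      ((fun t => tnth t i) @^-1` X (lift ord0 i))); last first.
    by apply/seteqP; split => t /= Xt i; [move=> _|]; exact: Xt.
  apply: fin_bigcap_measurable; first exact: finite_finset.
  by move=> i _; rewrite -[X in measurable X]setTI; exact: measurable_tnth.
congr product_measure1; apply/seteqP; split => -[x t] /=.
  move=> Xt; split; first exact: (Xt ord0).
  by move=> i; have := Xt (lift ord0 i); rewrite tnthS.
move=> [Xx Xt] i; have [j ->|->] := unliftP ord0 i; last exact: Xx.
by rewrite tnthS.
Qed.

End power_measure.
Arguments power_measure {d T R} mu n _.

Section complex_lebesgue_measure.
Variable R : realType.

Definition lebesgue_C :
    set (measurableTypeR R * measurableTypeR R) -> \bar R :=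
  (lebesgue_measure \x lebesgue_measure)%E.

Definition mx_of_tuple (m n : nat)
    (t : (m * n).-tuple (measurableTypeR R * measurableTypeR R)) :
    'M[R[i]]_(m, n) :=
  \matrix_(k < m, j < n)
    let xy := tnth t (mxvec_index k j) in Complex (xy.1 : R) (xy.2 : R).

(* Lebesgue measure on complex m x n matrices, identified with R^(2mn) through
   the real and imaginary parts of the entries.  Only its values on Borel sets
   are meaningful: the iterated products are measures on the Borel sigma-algebra
   and are not completed. *)
Definition lebesgue_Cmx (m n : nat) (A : set 'M[R[i]]_(m, n)) : \bar R :=
  power_measure lebesgue_C (m * n) (@mx_of_tuple m n @^-1` A).

Lemma lebesgue_Cmx_box m n (X Y : 'I_m -> 'I_n -> set (measurableTypeR R)) :
  (forall k j, measurable (X k j)) -> (forall k j, measurable (Y k j)) ->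
  lebesgue_Cmx [set A : 'M[R[i]]_(m, n) | forall k j,
      X k j (complex.Re (A k j)) /\ Y k j (complex.Im (A k j))] =
  (\prod_(k < m) \prod_(j < n)
     (lebesgue_measure (X k j) * lebesgue_measure (Y k j)))%E.
Proof.
move=> mX mY; rewrite /lebesgue_Cmx.
have [L LE] : exists L : {sigma_finite_measure set
    (measurableTypeR R * measurableTypeR R)%type -> \bar R}, lebesgue_C = L.
  exact: product_sigma_finite.
pose Z (i : 'I_(m * n)) : set (measurableTypeR R * measurableTypeR R) :=
  let kj := enum_val (cast_ord (esym (mxvec_cast m n)) i) in
  X kj.1 kj.2 `*` Y kj.1 kj.2.
have ZE k j : Z (mxvec_index k j) = X k j `*` Y k j.
  by rewrite /Z /mxvec_index cast_ordK enum_rankK.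
rewrite (_ : _ @^-1` _ = [set t | forall i, Z i (tnth t i)]); last first.
  apply/seteqP; split => t /= Zt.
    by case/mxvec_indexP => k j; rewrite ZE; have := Zt k j; rewrite !mxE.
  by move=> k j; rewrite !mxE; have := Zt (mxvec_index k j); rewrite ZE.
rewrite LE power_measure_box; last by move=> i; exact: measurableX.
rewrite (reindex _ (curry_mxvec_bij _ _)) pair_bigA/=.
by apply: eq_bigr => -[k j] _ /=; rewrite ZE -LE; exact: product_measure1E.
Qed.

End complex_lebesgue_measure.

Section gaussian_approximation.
Variable R : realType.

Definition gaussian_int (z : R[i]) : Prop :=
  complex.Re z \is a Num.int /\ complex.Im z \is a Num.int.

(* The distance to the nearest Gaussian integer; the infimum is a minimum, see [gaussian_dist_min]. *)
Definition gaussian_dist (z : R[i]) : R :=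
  inf [set Normc.normc (z - p) | p in gaussian_int].

Lemma nearest_int (x : R) :
  exists2 r : R, r \is a Num.int & forall k, k \is a Num.int -> `|x - r| <= `|x - k|.
Proof.
exists (Num.floor (x + 2^-1))%:~R; first exact: intr_int.
move=> _ /intrP[k ->]; set r := Num.floor _.
have rx : r%:~R <= x + 2^-1 by exact: floor_le.
have xr : x + 2^-1 < (r + 1)%:~R by exact: floorD1_gt.
rewrite intrD in xr.
have [->//|kr] := eqVneq k r.
apply: (@le_trans _ _ 2^-1); first by rewrite ler_norml; apply/andP; split; lra.
rewrite ler_normr; apply/orP; have [rk|] := ltP r k.
  have : (r + 1)%:~R <= k%:~R :> R by rewrite ler_int lezD1.
  by rewrite intrD => ?; right; lra.
rewrite le_eqVlt (negbTE kr)/= => {}kr.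
have : (k + 1)%:~R <= r%:~R :> R by rewrite ler_int lezD1.
by rewrite intrD => ?; left; lra.
Qed.

Lemma gaussian_dist_min (z : R[i]) :
  (exists2 p, gaussian_int p & gaussian_dist z = Normc.normc (z - p)) /\
  (forall p, gaussian_int p -> gaussian_dist z <= Normc.normc (z - p)).
Proof.
case: z => x y.
have [a aZ amin] := nearest_int x; have [b bZ bmin] := nearest_int y.
set S := [set Normc.normc (Complex x y - p) | p in gaussian_int].
have Smin : lbound S (Normc.normc (Complex x y - Complex a b)).
  move=> _ [[c e] [/= cZ eZ] <-] /=; apply: ler_wsqrtr.
  by apply: lerD; rewrite -real_normK ?num_real// -[leRHS]real_normK ?num_real//
    lerXn2r ?nnegrE//; [exact: amin|exact: bmin].
have Sab : S (Normc.normc (Complex x y - Complex a b)) by exists (Complex a b).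
have SE : gaussian_dist (Complex x y) = Normc.normc (Complex x y - Complex a b).
  apply/eqP; rewrite eq_le; apply/andP; split.
    by apply: ge_inf => //; eexists; exact: Smin.
  by apply: lb_le_inf => //; eexists; exact: Sab.
by split=> [|p pZ]; [exists (Complex a b)|rewrite SE; apply: Smin; exists p].
Qed.

Definition I_C : set R[i] :=
  [set z | - 2^-1 <= complex.Re z <= 2^-1 /\ - 2^-1 <= complex.Im z <= 2^-1].

Definition I_Cmx (m n : nat) : set 'M[R[i]]_(m, n) :=
  [set A | forall k j, I_C (A k j)].

Definition W_C (m n : nat) (phi : 'I_n -> nat -> R) (Phi : 'I_m -> nat -> R) :
    set 'M[R[i]]_(m, n) :=
  [set A | I_Cmx A /\
    infinite_set [set u : nat | (1 <= u)%N /\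
      exists q : 'rV[R[i]]_m,
        [/\ q != 0,
            forall k, gaussian_int (q 0 k),
            forall j, gaussian_dist ((q *m col j A) 0 0) < phi j u
          & forall k, Normc.normc (q 0 k) <= Phi k u]]].

End gaussian_approximation.

(* Main.v *)
From HB Require Import structures.
Require Import Defs.
From mathcomp Require Import all_boot all_order all_algebra.
From mathcomp Require Import all_classical all_reals all_analysis.
From mathcomp Require Import measurable_realfun complex.
From mathcomp Require Import ring lra.
Set Implicit Arguments.
Unset Strict Implicit.
Unset Printing Implicit Defensive.
Import Order.TTheory GRing.Theory Num.Theory.
Import numFieldNormedType.Exports.
Local Open Scope classical_set_scope.
Local Open Scope ring_scope.

(** The set of approximable matrices is, inside the unit cube, the upper limit
    over [u] of the events [solvable (phi u) (Phi u)]: some nonzero Gaussian row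
    [q] with [|q_k| <= Phi_k u] puts every entry of [q A] within [phi_j u] of a
    Gaussian integer ([lebesgue_Cmx_W_C]). Lebesgue measure on the cube is a
    probability [cmx_prob] which is uniform modulo Gaussian matrices
    ([cmx_prob_uniform]), and whose only dyadically invariant events are null or
    full ([cmx_prob_ergodic]). For fixed [q] the row [q A] is then uniform
    modulo the Gaussian integers, so that one [q] contributes about
    [prod_j phi_j ^ 2] and an index [u] about [prod_j phi_j ^ 2 prod_k Phi_k ^ 2],
    the quantity [volume u] ([pr_solvable_le]). The hypotheses make [volume]
    almost constant on each block [M ^ t <= u < M ^ t.+1], where the weights
    [1 / u] add up to a constant, so the series of the theorem has the same
    behaviour as the sum over [t] of [volume (M ^ t)].

    When it converges, one event per block covers the upper limit, and the
    Borel-Cantelli lemma applies ([limsup_null]).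

    When it diverges, the second moment method bounds the probability of a union
    of the events [solvable] from below ([solvable_union_ge]), provided that
    different solutions are nearly independent in pairs. If [q] and [q'] are not
    proportional, then [q A] and [q' A] are independent
    ([pr_near_form_independent]). Proportional rows are strongly correlated,
    because a solution with [q] often yields one with [2 q]; to avoid this, only
    solutions [q A_j ~ p_j] with [(p_j, q)] unimodular are counted
    ([primitive_form]). Then parallel pairs reduce to the question how often a
    number is close to two different reduced fractions, and this is as rare as
    for independent events ([pr_near_reduced_meet]). The price is a lower bound
    for the probability of a primitive solution: it is enough that one
    coordinate [q_k0] has a positive proportion [unit_density] of coprime
    residues. By Dirichlet's theorem every [z] has a reduced fraction [p / q] with
    [|q| <= X] and [|q z - p|] at most about [1 / X], which forces this
    proportion to be bounded below for a positive proportion of the denominators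
    ([unit_density_annulus]).

    Hence the upper limit has probability at least some constant depending only
    on [n] ([solvable_limsup_ge]). The same bound holds when the solutions are
    required to be multiples of [2 ^ r], since this only divides [Phi] by
    [2 ^ r]. The matrices which are approximable in this way for every [r] form a
    dyadically invariant event of positive probability, and ergodicity makes it
    full ([solvable_limsup_full]). *)

(** * Lebesgue measure on the unit interval *)

Section unit_interval.
Variable R : realType.
Notation leb := (@lebesgue_measure R).

Lemma measurable_translate (b : R) :
  measurable_fun [set: measurableTypeR R]
    ((fun x => x + b) : measurableTypeR R -> measurableTypeR R).
Proof. exact: measurable_funD. Qed.

Lemma measurable_preimage d d' (T : measurableType d) (T' : measurableType d')
    (f : T -> T') (A : set T') :
  measurable_fun setT f -> measurable A -> measurable (f @^-1` A).
Proof. by move=> mf mA; rewrite -[X in measurable X]setTI; exact: mf. Qed.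

Lemma lebesgue_measure_translate (b : R) (A : set (measurableTypeR R)) :
  measurable A -> leb ((fun x => x + b) @^-1` A) = leb A.
Proof.
move=> mA; pose f : measurableTypeR R -> measurableTypeR R := fun x => x + b.
rewrite -[LHS]/(pushforward leb f A).
have [P PE] : exists P : {measure set (measurableTypeR R) -> \bar R},
    forall X, pushforward leb f X = P X.
  by exists (measure_function_pushforward__canonical__measure_function_Measure leb (measurable_translate b)).
rewrite PE; apply/esym/lebesgue_measure_unique => //= _ [[x y]] _ <-.
rewrite -PE /f /pushforward.
rewrite (_ : _ @^-1` _ = `]x - b, y - b]%classic); last first.
  by apply/seteqP; split => z /=; rewrite !in_itv/= lerBrDr ltrBlDr.
rewrite !lebesgue_measure_itv/= !lte_fin ltrD2r; case: ifPn => // _.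
by rewrite -!EFinD; congr EFin; ring.
Qed.

Definition invariant_by (T : Type) (f : T -> T) (S : set T) := f @^-1` S = S.

Lemma invariant_byP T (f : T -> T) (S : set T) x :
  invariant_by f S -> S (f x) <-> S x.
Proof. by move=> fS; rewrite -[in X in _ <-> X]fS. Qed.

(** Moving the first interval by a multiple of [p], one may assume that it
    contains [b]; the two intervals then differ by two pieces which are
    translates of each other by [p]. *)
Lemma lebesgue_periodic_itv (p : R) (S : set (measurableTypeR R)) (a b : R) :
  0 < p -> measurable S -> (forall k, k \is a Num.int ->
    invariant_by (fun x => x + k * p) S) ->
  leb (S `&` `[a, a + p[) = leb (S `&` `[b, b + p[).
Proof.
move=> p0 mS Sp.
have mSI u v : measurable (S `&` `[u, v[) by apply: measurableI.
have shift k u v : k \is a Num.int ->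
    leb (S `&` `[u + k * p, v + k * p[) = leb (S `&` `[u, v[).
  move=> kZ; rewrite -(lebesgue_measure_translate (k * p)) //.
  congr (leb _); rewrite preimage_setI Sp//; congr (_ `&` _).
  by apply/seteqP; split => z /=; rewrite !in_itv/= lerD2r ltrD2r.
wlog ab : a b / a <= b => [H|].
  by have [/H//|/ltW/H] := leP a b.
pose k : R := (Num.floor ((b - a) / p))%:~R.
have kZ : k \is a Num.int by exact: intr_int.
have k1 : k <= (b - a) / p by exact: floor_le.
have k2 : (b - a) / p < k + 1 by rewrite /k -[1]/(1%:~R) -intrD floorD1_gt.
rewrite ler_pdivlMr// in k1; rewrite ltr_pdivrMr// in k2.
rewrite -(shift k a)//.
set a' := a + k * p; have -> : a + p + k * p = a' + p by rewrite /a'; ring.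
have a'b : a' <= b by rewrite /a'; lra.
have ba' : b < a' + p by rewrite /a'; lra.
rewrite (_ : `[a', a' + p[%classic = `[a', b[%classic `|` `[b, a' + p[%classic);
  last by rewrite -itv_bndbnd_setU// bnd_simp ltW.
rewrite (_ : `[b, b + p[%classic = `[b, a' + p[%classic `|` `[a' + p, b + p[%classic);
  last by rewrite -itv_bndbnd_setU// bnd_simp; lra.
rewrite !setIUr !measureU//; last 2 first.
- apply/seteqP; split => // z [[_ /= +] [_ /=]]; rewrite !in_itv/=; lra.
- apply/seteqP; split => // z [[_ /= +] [_ /=]]; rewrite !in_itv/=; lra.
rewrite addrC; congr (_ + _).
by have := @shift 1 a' b; rewrite mul1r => /(_ (@rpred1 _ _)) /esym.
Qed.

Lemma lebesgue_add_point (A B : set (measurableTypeR R)) (x : R) :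
  measurable A -> measurable B -> A `<=` B -> B `<=` A `|` [set x] ->
  leb A = leb B.
Proof.
move=> mA mB AB BA; apply/eqP; rewrite eq_le; apply/andP; split.
  by apply: le_measure; rewrite ?inE.
apply: (@le_trans _ _ (leb (A `|` [set x]))).
  by apply: le_measure; rewrite ?inE//; exact: measurableU.
apply: (le_trans (measureU2 _ _ _)) => //.
by rewrite [X in (_ + X)%E](lebesgue_measure_set1 x) adde0.
Qed.

(** The interval is closed because [I_C] is; translations are easier to follow
    on a half-open interval, and [unifE] passes from one to the other. *)
Let half_itv : set (measurableTypeR R) := `[(- 2^-1)%R, 2^-1].

Let measurable_half_itv : measurable half_itv.
Proof. exact: measurable_itv. Qed.

Definition unif : set (measurableTypeR R) -> \bar R :=
  mrestr leb measurable_half_itv.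

HB.instance Definition _ := Measure.on unif.

Let unif_setT : unif setT = 1%E.
Proof.
rewrite /unif /mrestr setTI lebesgue_measure_itv/= lte_fin.
rewrite ifT; last by lra.
by rewrite -EFinD; congr EFin; lra.
Qed.

HB.instance Definition _ := Measure_isProbability.Build _ _ _ unif unif_setT.

Lemma unif_closed S : unif S = leb (S `&` `[- 2^-1, 2^-1]).
Proof. by []. Qed.

Lemma unifE S : measurable S -> unif S = leb (S `&` `[- 2^-1, - 2^-1 + 1[).
Proof.
move=> mS; rewrite unif_closed; have -> : - 2^-1 + 1 = 2^-1 :> R by lra.
apply/esym/(@lebesgue_add_point _ _ 2^-1); try exact: measurableI.
  by apply: setIS => z /=; rewrite !in_itv/= => /andP[-> /ltW].
move=> z [Sz]; rewrite /= in_itv/= => /andP[z1]; rewrite le_eqVlt => /orP[/eqP|z2].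
  by right.
by left; split=> //=; rewrite in_itv/= z1.
Qed.

End unit_interval.

(** * Translations of products of probability spaces *)

Section periodic_sets.
Context d (T : measurableType d) (R : realType).

(** A family [act] of translations of the probability space [P] is uniform
    when it preserves the measure of the sets that are periodic with respect to
    the lattice [L]; it stands for the Haar measure of a torus. *)
Definition uniform_mod (B : Type) (P : probability T R) (act : B -> T -> T)
    (L : set B) :=
  forall S, measurable S -> (forall b, L b -> invariant_by (act b) S) ->
  forall b, P (act b @^-1` S) = P S.

(** Here [D] plays the role of a dense group of translations. *)
Definition ergodic_under (B : Type) (P : probability T R) (act : B -> T -> T)
    (D : set B) :=
  forall S, measurable S -> (forall b, D b -> invariant_by (act b) S) ->
  P S = 0%E \/ P S = 1%E.

End periodic_sets.

Section unit_interval_torus.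
Variable R : realType.
Notation leb := (@lebesgue_measure R).
Notation rT := (measurableTypeR R).

Definition translate (b : rT) : rT -> rT := fun x => x + b.
Definition int_set : set rT := [set b | b \is a Num.int].
Definition dyadic_set : set rT :=
  [set b | exists r : nat, 2 ^+ r * b \is a Num.int].

Lemma unif_uniform : uniform_mod (@unif R) translate int_set.
Proof.
move=> S mS Sper b; have mb := measurable_translate b.
rewrite [LHS]unifE; last exact: (measurable_preimage mb).
rewrite [RHS]unifE//.
have := @lebesgue_periodic_itv R 1 S (- 2^-1) (- 2^-1 + b) ltr01 mS.
move=> -> //; last by move=> k kZ; rewrite mulr1; exact: Sper.
rewrite -[RHS](lebesgue_measure_translate b); last exact: measurableI.
rewrite preimage_setI; congr (leb (_ `&` _)); apply/seteqP; split => z /=;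
  rewrite !in_itv/=; lra.
Qed.

(** Intervals of length [2 ^ - r] are moved onto each other by dyadic
    translations up to periodicity, so [S] occupies the same proportion of each. *)
Lemma unif_dyadic_block (S : set rT) (r : nat) : measurable S ->
  (forall b, dyadic_set b -> invariant_by (translate b) S) ->
  forall a : R, (unif S = (2 ^+ r)%:E * leb (S `&` `[a, (a + (2 ^+ r)^-1)%R[))%E.
Proof.
move=> mS Sper; have mSI u v : measurable (S `&` `[u, v[) by apply: measurableI.
have per (s : nat) u v : leb (S `&` `[u, u + (2 ^+ s)^-1[) =
    leb (S `&` `[v, v + (2 ^+ s)^-1[).
  apply: lebesgue_periodic_itv => // k kZ; apply: Sper.
  by exists s; rewrite mulrCA divff ?mulr1// expf_neq0.
elim: r => [|r IH] a.
  by rewrite expr0 mul1e unifE//; have := per 0 (- 2^-1) a; rewrite expr0 invr1.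
rewrite (IH a) exprS EFinM -muleA muleCA; congr (_ * _)%E.
set p := (2 * 2 ^+ r)^-1; have p0 : 0 < p by rewrite invr_gt0 mulr_gt0 ?exprn_gt0.
have -> : (2 ^+ r)^-1 = p + p by rewrite /p invfM; lra.
rewrite (_ : `[a, _[%classic = `[a, a + p[%classic `|` `[a + p, a + p + p[%classic); last first.
  by rewrite addrA -itv_bndbnd_setU// bnd_simp; lra.
rewrite setIUr measureU//; last first.
  apply/seteqP; split => // z [[_ /= +] [_ /=]]; rewrite !in_itv/=; lra.
rewrite -[LHS]/(leb _ + leb _)%E; have := per r.+1 (a + p) a; rewrite exprS -/p => ->.
by rewrite -mule2n mule_natl.
Qed.

(** By [unif_dyadic_block] the proportion of [S] in an interval of length
    [2 ^ - r] around any point is exactly [unif S], while Lebesgue's density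
    theorem says that it tends to 0 or 1 around almost every point. *)
Lemma unif_ergodic : ergodic_under (@unif R) translate dyadic_set.
Proof.
move=> S mS Sper.
have mSI (i : interval R) : measurable (S `&` [set` i]) by apply: measurableI => //; exact: measurable_itv.
have [N [mN N0 SN]] := lebesgue_density mS.
have [x Nx] : exists x, ~ N x.
  apply/not_existsP => NT; have : leb [set: rT] = 0%E.
    by rewrite -N0; congr (leb _); apply/seteqP; split => // x _; apply: contrapT; exact: NT.
  by rewrite -set_itvNyy lebesgue_measure_itv.
have {N mN N0 SN Nx} lim_S : (leb (S `&` ball x r) / leb (ball x r))%E
    @[r --> 0^'+] --> (\1_S x)%:E by apply: contrapT => /SN.
pose u (r : nat) : R := (2 ^+ r)^-1 / 2.
have u_gt0 r : 0 < u r by rewrite /u divr_gt0// invr_gt0 exprn_gt0.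
have u_cvg : u n @[n --> \oo] --> 0.
  rewrite (_ : u = geometric 2^-1 2^-1); last first.
    by apply/funext => n; rewrite /u/= exprVn mulrC.
  by apply: cvg_geometric; rewrite ger0_norm ?invr_ge0// invf_lt1// ltr1n.
have ratio n : (leb (S `&` ball x (u n)) / leb (ball x (u n)))%E = unif S.
  have -> : leb (S `&` ball x (u n)) = leb (S `&` `[x - u n, x - u n + (2 ^+ n)^-1[).
    apply: (@lebesgue_add_point _ _ _ (x - u n)).
    - by apply: measurableI => //; exact: measurable_ball.
    - exact: mSI.
    - by rewrite ball_itv; apply: setIS => z /=; rewrite !in_itv/= /u; lra.
    - move=> z [Sz] /=; rewrite in_itv/= le_eqVlt => /andP[/orP[/eqP<-|z1 z2]].
        by right.
      by left; split=> //; rewrite ball_itv/= in_itv/= z1/=; move: z2; rewrite /u; lra.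
  rewrite lebesgue_measure_ball; last exact: ltW.
  rewrite (unif_dyadic_block n mS Sper (x - u n)).
  have -> : u n *+ 2 = (2 ^+ n)^-1 by rewrite /u mulr2n; lra.
  rewrite inver ifF; last by rewrite invr_eq0 expf_eq0 /= pnatr_eq0 andbF.
  by rewrite invrK muleC.
have {}lim_S := (cvge_at_rightP _ _ _).1 lim_S u (conj u_gt0 u_cvg).
have : (\1_S x)%:E = unif S.
  apply: (@cvg_unique _ (@ereal_hausdorff R) _ _ _ _ lim_S).
  by rewrite (_ : (fun n => _) = cst (unif S)); [exact: cvg_cst|exact/funext].
by rewrite /indic; case: (x \in S) => /esym; [right|left].
Qed.

End unit_interval_torus.

Section product_torus.
Context d1 d2 (T1 : measurableType d1) (T2 : measurableType d2) (R : realType).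
Variables (P1 : probability T1 R) (P2 : probability T2 R).
Variables (B1 B2 : Type) (act1 : B1 -> T1 -> T1) (act2 : B2 -> T2 -> T2).
Variables (e1 : B1) (e2 : B2).
Hypotheses (act1e : act1 e1 = id) (act2e : act2 e2 = id).
Hypothesis measurable_act1 : forall b, measurable_fun setT (act1 b).
Hypothesis measurable_act2 : forall b, measurable_fun setT (act2 b).

Definition prod_act (b : B1 * B2) (z : T1 * T2) := (act1 b.1 z.1, act2 b.2 z.2).

Lemma measurable_prod_act b : measurable_fun setT (prod_act b).
Proof.
by apply/measurable_fun_pairP; split;
  [exact: measurableT_comp (measurable_act1 _) _|
   exact: measurableT_comp (measurable_act2 _) _].
Qed.

Lemma product_measure_swap (S : set (T1 * T2)) : measurable S ->
  (P1 \x P2)%E S = (\int[P2]_y P1 (ysection S y))%E.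
Proof.
move=> mS; have := @product_measure_unique _ _ _ _ _ P1 P2
  [the {measure set (T1 * T2) -> \bar R} of (P1 \x^ P2)%E] _ S mS.
by apply => A B mA mB /=; rewrite product_measure2E.
Qed.

(** One coordinate is translated at a time: the sections of a periodic set are
    periodic, and both orders of integration compute the product measure. *)
Lemma uniform_prod L1 L2 : L1 e1 -> L2 e2 ->
  uniform_mod P1 act1 L1 -> uniform_mod P2 act2 L2 ->
  uniform_mod (P1 \x P2)%E prod_act (L1 `*` L2).
Proof.
move=> L1e L2e U1 U2 S mS Sper [b1 b2].
pose S' := prod_act (b1, e2) @^-1` S.
have mS' : measurable S' by exact: measurable_preimage (measurable_prod_act _) mS.
have -> : prod_act (b1, b2) @^-1` S = prod_act (e1, b2) @^-1` S'.
  by rewrite /S' -comp_preimage; congr (_ @^-1` S); apply/funext => -[x y];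
    rewrite /prod_act/= act1e act2e.
transitivity ((P1 \x P2)%E S').
  apply: eq_integral => x _ /=.
  have -> : xsection (prod_act (e1, b2) @^-1` S') x =
      act2 b2 @^-1` xsection S' x.
    by apply/seteqP; split=> y; rewrite /xsection /prod_act/= !inE/= act1e.
  apply: U2; first exact: measurable_xsection.
  move=> b Lb; apply/seteqP; split=> y;
  rewrite /xsection /prod_act/= !inE /S'/prod_act/= act2e/=;
  have := invariant_byP (act1 b1 x, y) (Sper (e1, b) (conj L1e Lb));
  by rewrite /prod_act/= act1e => ->.
rewrite [LHS]product_measure_swap// [RHS]product_measure_swap//; apply: eq_integral => y _ /=.
have -> : ysection S' y = act1 b1 @^-1` ysection S y.
  by apply/seteqP; split=> x; rewrite /ysection /S' /prod_act/= !inE/= act2e.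
apply: U1; first exact: measurable_ysection.
move=> b Lb; apply/seteqP; split=> x;
rewrite /ysection /prod_act/= !inE /=;
have := invariant_byP (x, y) (Sper (b, e2) (conj Lb L2e));
by rewrite /prod_act/= act2e => ->.
Qed.

(** The sections of an invariant set are invariant, hence null or full, and the
    set of those that are full is invariant under the second action. *)
Lemma ergodic_prod D1 D2 : D1 e1 -> D2 e2 ->
  ergodic_under P1 act1 D1 -> ergodic_under P2 act2 D2 ->
  ergodic_under (P1 \x P2)%E prod_act (D1 `*` D2).
Proof.
move=> D1e D2e E1 E2 S mS Sinv.
pose F := [set x | P2 (xsection S x) = 1%E].
have mF : measurable F.
  have := measurable_fun_xsection P2 mS measurableT (emeasurable_set1 1%E).
  by rewrite setTI.
have SF : (P1 \x P2)%E S = P1 F.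
  rewrite -[F]setIT -integral_indic//; apply: eq_integral => x _ /=.
  rewrite indicE; have [/set_mem->//|/negP xF] := boolP (x \in F).
  have Sx b : D2 b -> invariant_by (act2 b) (xsection S x).
    move=> Db; apply/seteqP; split=> y; rewrite /xsection/= !inE;
    have := invariant_byP (x, y) (Sinv (e1, b) (conj D1e Db));
    by rewrite /prod_act/= act1e => ->.
  have [//|F1] := E2 (xsection S x) (measurable_xsection _ mS) Sx.
  by exfalso; apply: xF; rewrite inE.
suff : P1 F = 0%E \/ P1 F = 1%E by rewrite -SF.
apply: E1 => // b Db; apply/seteqP; split => x; rewrite /F/=;
  rewrite (_ : xsection S (act1 b x) = xsection S x) //;
  apply/seteqP; split=> y; rewrite /xsection/= !inE;
  have := invariant_byP (x, y) (Sinv (b, e2) (conj Db D2e));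
  by rewrite /prod_act/= act2e => ->.
Qed.

End product_torus.

(** Transport along a map that intertwines the translations. *)
Section image_torus.
Context d1 d2 (T1 : measurableType d1) (T2 : measurableType d2) (R : realType).
Variables (P : probability T1 R) (f : {mfun T1 >-> T2}).
Variables (B1 B2 : Type) (act1 : B1 -> T1 -> T1) (act2 : B2 -> T2 -> T2).
Variables (h : B2 -> B1) (L1 : set B1) (L2 : set B2).
Hypothesis act2f : forall b t, act2 b (f t) = f (act1 (h b) t).
Hypothesis L12 : forall b, L1 b -> exists2 b', L2 b' & h b' = b.

Let invariant_preimage S : (forall b, L2 b -> invariant_by (act2 b) S) ->
  forall b, L1 b -> invariant_by (act1 b) (f @^-1` S).
Proof.
move=> Sinv _ /L12[b Lb <-]; apply/seteqP; split => t /=; rewrite -act2f;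
by rewrite (invariant_byP _ (Sinv b Lb)).
Qed.

Lemma uniform_image : uniform_mod P act1 L1 ->
  uniform_mod (distribution P f) act2 L2.
Proof.
move=> U S mS Sinv b; rewrite -[LHS]/(P (f @^-1` (act2 b @^-1` S))).
rewrite (_ : f @^-1` (act2 b @^-1` S) = act1 (h b) @^-1` (f @^-1` S)); last first.
  by apply/seteqP; split=> t /=; rewrite act2f.
apply: U; last exact: invariant_preimage.
exact: measurable_preimage.
Qed.

Lemma ergodic_image : ergodic_under P act1 L1 ->
  ergodic_under (distribution P f) act2 L2.
Proof.
move=> E S mS Sinv; rewrite /distribution /pushforward.
by apply: E; [exact: measurable_preimage|exact: invariant_preimage].
Qed.

End image_torus.

Section tuple_torus.
Context d (T : measurableType d) (R : realType).
Variable P : probability T R.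
Variables (B : Type) (act : B -> T -> T) (e : B).
Hypothesis act_e : act e = id.
Hypothesis measurable_act : forall b, measurable_fun setT (act b).

Definition cons_pair n (p : T * n.-tuple T) : n.+1.-tuple T :=
  [the n.+1.-tuple T of p.1 :: p.2].

Let measurable_cons_pair n : measurable_fun setT (@cons_pair n).
Proof. exact: measurable_cons. Qed.

HB.instance Definition _ n :=
  isMeasurableFun.Build _ _ _ _ (@cons_pair n) (@measurable_cons_pair n).

Fixpoint tuple_prob n : probability (n.-tuple T) R :=
  match n with
  | 0 => [the probability _ R of @dirac _ (0.-tuple T) [tuple] R]
  | n'.+1 => [the probability _ R of
      distribution (P \x tuple_prob n')%E (@cons_pair n')]
  end.

Lemma power_measureE n : power_measure P n = tuple_prob n.
Proof. by elim: n => //= n ->. Qed.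

Definition tuple_act n (b : n.-tuple B) (t : n.-tuple T) : n.-tuple T :=
  [tuple act (tnth b i) (tnth t i) | i < n].

Lemma measurable_tuple_act n (b : n.-tuple B) :
  measurable_fun setT (tuple_act b).
Proof.
apply/measurable_fun_tnthP => i; rewrite (_ : _ \o _ =
  act (tnth b i) \o (fun t => tnth t i)); last first.
  by apply/funext => t /=; rewrite tnth_mktuple.
by apply: measurableT_comp => //; exact: measurable_tnth.
Qed.

Let uncons_tuple n (b : n.+1.-tuple B) := (thead b, [tuple of behead b]).

Let tuple_act_cons n (b : n.+1.-tuple B) (t : T * n.-tuple T) :
  tuple_act b (cons_pair t) =
  cons_pair (prod_act act (@tuple_act n) (uncons_tuple b) t).
Proof.
case: t => x t; apply: eq_from_tnth => i; rewrite tnth_mktuple.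
have [j ->|->] := unliftP ord0 i; last by [].
rewrite /cons_pair/= !tnthS tnth_mktuple; congr (act _ _).
by rewrite [in LHS](tuple_eta b) tnthS.
Qed.

Let all_cons (L : set B) n (b : B * n.-tuple B) :
  (L `*` [set b : n.-tuple B | forall i, L (tnth b i)]) b ->
  exists2 b', (forall i, L (tnth b' i)) & @uncons_tuple n b' = b.
Proof.
case: b => x b [/= Lx Lb]; exists [tuple of x :: b].
  by move=> i; have [j ->|->] := unliftP ord0 i; [rewrite tnthS|].
by rewrite /uncons_tuple; congr pair; exact/val_inj.
Qed.

Let tuple_act_e n : tuple_act [tuple of nseq n e] = id.
Proof.
apply/funext => t; apply: eq_from_tnth => i.
by rewrite tnth_mktuple tnth_nseq act_e.
Qed.

Lemma uniform_tuple L n : L e -> uniform_mod P act L ->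
  uniform_mod (tuple_prob n) (@tuple_act n)
    [set b : n.-tuple B | forall i, L (tnth b i)].
Proof.
move=> Le U; elim: n => [|n IH] /=.
  move=> S mS Sinv b; rewrite (_ : _ @^-1` _ = S)//.
  by apply/seteqP; split => t; rewrite [t]tuple0 /= [tuple_act _ _]tuple0.
apply: (uniform_image (@tuple_act_cons n)); first exact: all_cons.
apply: (uniform_prod act_e (tuple_act_e n)) => //.
- exact: measurable_tuple_act.
- by move=> i; rewrite tnth_nseq.
Qed.

Lemma ergodic_tuple D n : D e -> ergodic_under P act D ->
  ergodic_under (tuple_prob n) (@tuple_act n)
    [set b : n.-tuple B | forall i, D (tnth b i)].
Proof.
move=> De E; elim: n => [|n IH] /=.
  move=> S mS _; rewrite /= diracE; by case: (_ \in S); [right|left].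
apply: (ergodic_image (@tuple_act_cons n)); first exact: all_cons.
apply: (ergodic_prod act_e (tuple_act_e n)) => //.
by move=> i; rewrite tnth_nseq.
Qed.

End tuple_torus.

Section restricted_product.
Context d1 d2 (T1 : measurableType d1) (T2 : measurableType d2) (R : realType).
Variables (m1 m1' : {measure set T1 -> \bar R}) (m2 m2' : set T2 -> \bar R).
Variables (D1 : set T1) (D2 : set T2).
Hypothesis m1E : forall A, measurable A -> A `<=` D1 -> m1 A = m1' A.
Hypothesis m2E : forall A, measurable A -> A `<=` D2 -> m2 A = m2' A.
Hypothesis m20 : m2 set0 = 0%E.

(** With [D1] and [D2] cubes, this identifies the iterated Lebesgue measure with
    the iterated uniform probability inside the cube, one factor at a time. *)
Lemma product_measure_eq_on (X : set (T1 * T2)) :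
  measurable X -> X `<=` D1 `*` D2 -> (m1 \x m2)%E X = (m1' \x m2')%E X.
Proof.
move=> mX XD.
have sec x : xsection X x `<=` D2.
  by move=> y; rewrite /xsection/= inE => /XD[].
have m2X x : m2 (xsection X x) = m2' (xsection X x).
  by apply: m2E => //; exact: measurable_xsection.
have out : (fun x => m2 (xsection X x)) = (fun x => m2 (xsection X x)) \_ D1.
  apply/funext => x; rewrite patchE; case: ifPn => // xD.
  rewrite (_ : xsection X x = set0)//; apply/seteqP; split => // y.
  by rewrite /xsection/= inE => /XD[/= D1x _]; rewrite mem_set in xD.
rewrite /product_measure1 /=.
transitivity (\int[m1]_(x in D1) m2 (xsection X x))%E.
  by rewrite [RHS]integral_mkcond -out.
transitivity (\int[m1']_(x in D1) m2 (xsection X x))%E.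
  by apply: eq_measure_integral => A mA AD; exact: m1E.
by rewrite integral_mkcond -out; apply: eq_integral => x _.
Qed.

End restricted_product.

(** * Lebesgue measure on complex numbers and complex matrices *)

Section complex_measurable.
Variable R : realType.
Notation rT := (measurableTypeR R).

(** Aliases of [R[i]], and below of the complex matrices, on which the
    measurable sets are the Borel sets of the real coordinates. *)
Definition cplx : Type := R[i].
HB.instance Definition _ := GRing.Field.on cplx.
HB.instance Definition _ := isPointed.Build cplx 0.

Definition cplx_of_pair (p : rT * rT) : cplx := Complex (p.1 : R) (p.2 : R).
Definition pair_of_cplx (z : cplx) : rT * rT := (complex.Re z, complex.Im z).

Lemma cplx_of_pairK : cancel cplx_of_pair pair_of_cplx.
Proof. by case. Qed.
Lemma pair_of_cplxK : cancel pair_of_cplx cplx_of_pair.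
Proof. by case. Qed.

Definition cplx_measurable : set (set cplx) :=
  [set S | measurable (cplx_of_pair @^-1` S)].

Let cplx_measurable0 : cplx_measurable set0.
Proof. by rewrite /cplx_measurable/= preimage_set0. Qed.

Let cplx_measurableC S : cplx_measurable S -> cplx_measurable (~` S).
Proof. by rewrite /cplx_measurable/= preimage_setC; exact: measurableC. Qed.

Let cplx_measurable_bigcup (F : (set cplx)^nat) :
  (forall i, cplx_measurable (F i)) -> cplx_measurable (\bigcup_i F i).
Proof.
by move=> mF; rewrite /cplx_measurable/= preimage_bigcup; exact: bigcupT_measurable.
Qed.

HB.instance Definition _ := isMeasurable.Build default_measure_display
  cplx cplx_measurable0 cplx_measurableC cplx_measurable_bigcup.

Lemma measurable_cplx_of_pair : measurable_fun setT cplx_of_pair.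
Proof. by move=> _ S; rewrite setTI. Qed.

HB.instance Definition _ :=
  isMeasurableFun.Build _ _ _ _ cplx_of_pair measurable_cplx_of_pair.

Lemma measurable_pair_of_cplx : measurable_fun setT pair_of_cplx.
Proof.
move=> _ S mS; rewrite setTI /measurable/= /cplx_measurable/= -comp_preimage.
by rewrite (_ : _ \o _ = id) ?preimage_id//; exact/funext/cplx_of_pairK.
Qed.

Lemma measurable_cplxP d (T : measurableType d) (f : T -> cplx) :
  measurable_fun setT f <->
  measurable_fun setT (fun x => complex.Re (f x) : rT) /\
  measurable_fun setT (fun x => complex.Im (f x) : rT).
Proof.
split=> [mf|[mRe mIm]].
  by have /measurable_fun_pairP := measurableT_comp measurable_pair_of_cplx mf.
rewrite (_ : f = cplx_of_pair \o (fun x => (complex.Re (f x), complex.Im (f x)))).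
  by apply: measurableT_comp; [exact: measurable_cplx_of_pair|exact/measurable_fun_pairP].
by apply/funext => x /=; rewrite -[LHS]pair_of_cplxK.
Qed.

Lemma measurable_cplxD d (T : measurableType d) (f g : T -> cplx) :
  measurable_fun setT f -> measurable_fun setT g ->
  measurable_fun setT (fun x => f x + g x : cplx).
Proof.
move=> /measurable_cplxP[fr fi] /measurable_cplxP[gr gi].
by apply/measurable_cplxP; split; under eq_fun do rewrite raddfD;
  exact: measurable_funD.
Qed.

Lemma measurable_cplxM d (T : measurableType d) (f g : T -> cplx) :
  measurable_fun setT f -> measurable_fun setT g ->
  measurable_fun setT (fun x => f x * g x : cplx).
Proof.
move=> /measurable_cplxP[fr fi] /measurable_cplxP[gr gi].
apply/measurable_cplxP; split.
  rewrite (_ : (fun x => _) = (fun x => complex.Re (f x) * complex.Re (g x) -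
      complex.Im (f x) * complex.Im (g x))).
    by apply: measurable_funB; exact: measurable_funM.
  by apply/funext => x; case: (f x) => ? ?; case: (g x).
rewrite (_ : (fun x => _) = (fun x => complex.Re (f x) * complex.Im (g x) +
    complex.Im (f x) * complex.Re (g x))).
  by apply: measurable_funD; exact: measurable_funM.
by apply/funext => x; case: (f x) => ? ?; case: (g x).
Qed.

Definition unifC : probability (rT * rT)%type R :=
  [the probability _ _ of (@unif R \x @unif R)%E].

Definition cplx_prob : probability cplx R :=
  [the probability _ _ of distribution unifC cplx_of_pair].

End complex_measurable.

Section matrix_measurable.
Variables (R : realType) (m n : nat).
Notation rT := (measurableTypeR R).
Notation tup := ((m * n).-tuple (rT * rT)).

Definition cmx : Type := 'M[R[i]]_(m, n).
HB.instance Definition _ := GRing.Zmodule.on cmx.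
HB.instance Definition _ := isPointed.Build cmx 0.

Definition cmx_measurable : set (set cmx) :=
  [set S | measurable (@mx_of_tuple R m n @^-1` S)].

Let cmx_measurable0 : cmx_measurable set0.
Proof. by rewrite /cmx_measurable/= preimage_set0. Qed.

Let cmx_measurableC S : cmx_measurable S -> cmx_measurable (~` S).
Proof. by rewrite /cmx_measurable/= preimage_setC; exact: measurableC. Qed.

Let cmx_measurable_bigcup (F : (set cmx)^nat) :
  (forall i, cmx_measurable (F i)) -> cmx_measurable (\bigcup_i F i).
Proof.
by move=> mF; rewrite /cmx_measurable/= preimage_bigcup; exact: bigcupT_measurable.
Qed.

HB.instance Definition _ := isMeasurable.Build default_measure_display
  cmx cmx_measurable0 cmx_measurableC cmx_measurable_bigcup.

Definition cmx_of_tuple (t : tup) : cmx := mx_of_tuple t.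

Lemma measurable_cmx_of_tuple : measurable_fun setT cmx_of_tuple.
Proof. by move=> _ S; rewrite setTI. Qed.

HB.instance Definition _ :=
  isMeasurableFun.Build _ _ _ _ cmx_of_tuple measurable_cmx_of_tuple.

Definition tuple_of_cmx (A : cmx) : tup :=
  [tuple pair_of_cplx (mxvec A 0 i) | i < m * n].

Lemma cmx_of_tupleK : cancel cmx_of_tuple tuple_of_cmx.
Proof.
move=> t; apply: eq_from_tnth => i; rewrite tnth_mktuple.
by case/mxvec_indexP: i => k j; rewrite mxvecE mxE; case: (tnth _ _).
Qed.

Lemma tuple_of_cmxK : cancel tuple_of_cmx cmx_of_tuple.
Proof.
move=> A; apply/matrixP => k j; rewrite mxE tnth_mktuple mxvecE.
by case: (A k j).
Qed.

Lemma measurable_cmx_entry k j : measurable_fun setT (fun A : cmx => A k j : cplx R).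
Proof.
move=> _ S mS; rewrite setTI /measurable/= /cmx_measurable/=.
rewrite (_ : _ @^-1` _ = (fun t : tup => tnth t (mxvec_index k j)) @^-1`
    (@cplx_of_pair R @^-1` S)); last first.
  by apply/seteqP; split => t /=; rewrite mxE.
by apply: measurable_preimage => //; exact: measurable_tnth.
Qed.

Lemma measurable_cmxP d (T : measurableType d) (f : T -> cmx) :
  measurable_fun setT f <->
  forall k j, measurable_fun setT (fun x => f x k j : cplx R).
Proof.
split=> [mf k j|mf]; first exact: measurableT_comp (measurable_cmx_entry k j) mf.
rewrite (_ : f = cmx_of_tuple \o (tuple_of_cmx \o f)); last first.
  by apply/funext => x /=; rewrite tuple_of_cmxK.
apply: measurableT_comp; first exact: measurable_cmx_of_tuple.
apply/measurable_fun_tnthP; case/mxvec_indexP => k j.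
rewrite (_ : _ \o _ = @pair_of_cplx R \o (fun x => f x k j)); last first.
  by apply/funext => x /=; rewrite tnth_mktuple mxvecE.
by apply: measurableT_comp; [exact: measurable_pair_of_cplx|exact: mf].
Qed.

Definition cmx_prob : probability cmx R :=
  [the probability _ _ of distribution (tuple_prob (unifC R) (m * n)) cmx_of_tuple].

End matrix_measurable.
Arguments cmx : clear implicits.

Section lebesgue_cmx_prob.
Variable R : realType.
Notation rT := (measurableTypeR R).

Let cube : set rT := `[- 2^-1, 2^-1].

Let unif_cube (A : set rT) : measurable A -> A `<=` cube ->
  @lebesgue_measure R A = @unif R A.
Proof. by move=> mA AC; rewrite unif_closed setIidl. Qed.

Let unifC_cube (A : set (rT * rT)) : measurable A -> A `<=` cube `*` cube ->
  @lebesgue_C R A = unifC R A.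
Proof.
move=> mA AC.
exact: (@product_measure_eq_on _ _ _ _ _ (@lebesgue_measure R) (@unif R)
  _ _ _ _ unif_cube unif_cube (measure0 _) A mA AC).
Qed.

Let tuple_cube n (A : set (n.-tuple (rT * rT))) : measurable A ->
  A `<=` [set t | forall i, (cube `*` cube) (tnth t i)] ->
  power_measure (@lebesgue_C R) n A = tuple_prob (unifC R) n A.
Proof.
elim: n A => [//|n IH] A mA AC /=.
rewrite /pushforward /distribution /=.
have [L LE] : exists L : {sigma_finite_measure set (rT * rT)%type -> \bar R},
  @lebesgue_C R = L by exact: product_sigma_finite.
have unifL X : measurable X -> X `<=` cube `*` cube -> L X = unifC R X.
  by rewrite -LE; exact: unifC_cube.
rewrite LE; rewrite LE in IH.
apply: (product_measure_eq_on unifL IH).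
- by have [N ->] := power_measure_sigma_finite L n; rewrite measure0.
- exact: (measurable_preimage (measurable_cons measurable_fst measurable_snd)).
- move=> [x t] /AC /= At; split; first exact: (At ord0).
  by move=> i; have := At (lift ord0 i); rewrite tnthS.
Qed.

Lemma lebesgue_CmxE m n (A : set (cmx R m n)) : measurable A ->
  A `<=` @I_Cmx R m n -> lebesgue_Cmx A = cmx_prob R m n A.
Proof.
move=> mA AC; apply: tuple_cube => // t /AC At.
by case/mxvec_indexP => k j; have := At k j; rewrite mxE.
Qed.

Lemma cplx_prob_box (X Y : set rT) : measurable X -> measurable Y ->
  cplx_prob R [set z | X (complex.Re z) /\ Y (complex.Im z)] =
  (unif X * unif Y)%E.
Proof. by move=> mX mY; rewrite -product_measure1E. Qed.

Lemma cmx_prob_row n (S : 'I_n -> set (cplx R)) :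
  (forall j, measurable (S j)) ->
  cmx_prob R 1 n [set y | forall j, S j (y 0 j)] =
  (\prod_(j < n) cplx_prob R (S j))%E.
Proof.
move=> mS; rewrite -[LHS]/(tuple_prob (unifC R) (1 * n) _).
pose Z (i : 'I_(1 * n)) : set (rT * rT) :=
  let kj := enum_val (cast_ord (esym (mxvec_cast 1 n)) i) in
  @cplx_of_pair R @^-1` S kj.2.
have ZE j : Z (mxvec_index 0 j) = @cplx_of_pair R @^-1` S j.
  by rewrite /Z /mxvec_index cast_ordK enum_rankK.
rewrite (_ : _ @^-1` _ = [set t | forall i, Z i (tnth t i)]); last first.
  apply/seteqP; split => t /= Zt.
    case/mxvec_indexP => k j; rewrite ord1 ZE; have := Zt j.
    by rewrite /cmx_of_tuple !mxE.
  by move=> j; rewrite /cmx_of_tuple !mxE; have := Zt (mxvec_index 0 j); rewrite ZE.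
rewrite -power_measureE power_measure_box; last first.
  by move=> i; rewrite /Z; exact: mS.
rewrite (reindex _ (curry_mxvec_bij _ _)).
transitivity (\prod_(k < 1) \prod_(j < n) cplx_prob R (S j))%E; last first.
  by rewrite big_ord1.
rewrite pair_bigA/=; apply: eq_bigr => -[k j] _ /=.
by rewrite (ord1 k) ZE.
Qed.

Lemma translate0 : @translate R 0 = id.
Proof. by apply/funext => x; rewrite /translate addr0. Qed.

Definition gaussian : set (cplx R) := @gaussian_int R.

Let unifC_uniform : uniform_mod (unifC R) (prod_act (@translate R) (@translate R))
  (@int_set R `*` @int_set R).
Proof.
apply: (uniform_prod translate0 translate0) => //.
- exact: measurable_translate.
- exact: measurable_translate.
- exact: rpred0.
- exact: rpred0.
- exact: unif_uniform.
- exact: unif_uniform.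
Qed.

Let unifC_ergodic : ergodic_under (unifC R) (prod_act (@translate R) (@translate R))
  (@dyadic_set R `*` @dyadic_set R).
Proof.
apply: (ergodic_prod translate0 translate0) => //.
- by exists 0; rewrite mulr0; exact: rpred0.
- by exists 0; rewrite mulr0; exact: rpred0.
- exact: unif_ergodic.
- exact: unif_ergodic.
Qed.

Lemma expn2_cplx r (x y : R) :
  2 ^+ r * Complex x y = Complex (2 ^+ r * x) (2 ^+ r * y).
Proof.
elim: r => [|r IH]; first by rewrite !expr0 !mul1r.
by rewrite !exprS -!mulrA IH !mulr_natl !mulr2n.
Qed.

Let act0 : prod_act (@translate R) (@translate R) (0, 0) = id.
Proof. by apply/funext => -[x y]; rewrite /prod_act/= translate0. Qed.

Lemma cplx_prob_uniform :
  uniform_mod (cplx_prob R) (fun b z => z + b) gaussian.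
Proof.
apply: (@uniform_image _ _ _ _ _ _ _ _ _ _ _ (@pair_of_cplx R)); last exact: unifC_uniform.
  by case=> u v [x y].
move=> [x y] [xZ yZ]; exists (Complex x y) => //.
Qed.

Lemma cmx_prob_uniform m n :
  uniform_mod (cmx_prob R m n) (fun B A => A + B)
    [set B | forall k j, gaussian (B k j)].
Proof.
apply: (@uniform_image _ _ _ _ _ _ _ _ _
  (@tuple_act _ _ _ (prod_act (@translate R) (@translate R)) (m * n)) _ (@tuple_of_cmx R m n)
  [set b | forall i, (@int_set R `*` @int_set R) (tnth b i)]); last first.
- apply: (uniform_tuple act0); last exact: unifC_uniform.
    by apply: (measurable_prod_act (T1 := rT) (T2 := rT)) => b; exact: measurable_translate.
  by split; exact: rpred0.
- move=> b bZ; exists (cmx_of_tuple b); last exact: cmx_of_tupleK.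
  by move=> k j; rewrite mxE; exact: bZ.
- move=> B t; apply/matrixP => k j; rewrite !mxE !tnth_mktuple mxvecE.
  by case: (B k j); case: (tnth _ _).
Qed.

Lemma cmx_prob_ergodic m n :
  ergodic_under (cmx_prob R m n) (fun B A => A + B)
    [set B | forall k j, exists r : nat, gaussian (2 ^+ r * B k j)].
Proof.
apply: (@ergodic_image _ _ _ _ _ _ _ _ _
  (@tuple_act _ _ _ (prod_act (@translate R) (@translate R)) (m * n)) _ (@tuple_of_cmx R m n)
  [set b | forall i, (@dyadic_set R `*` @dyadic_set R) (tnth b i)]); last first.
- apply: (ergodic_tuple act0); last exact: unifC_ergodic.
  by split; exists 0; rewrite mulr0; exact: rpred0.
- move=> b bZ; exists (cmx_of_tuple b); last exact: cmx_of_tupleK.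
  move=> k j; rewrite mxE; have [] := bZ (mxvec_index k j).
  case: (tnth _ _) => x y /= [r xr] [s ys]; exists (r + s)%N.
  rewrite expn2_cplx; split=> /=.
    by rewrite exprD -mulrA mulrCA rpredM// rpredX// ?rpred_nat.
  by rewrite exprD -mulrA rpredM// rpredX// ?rpred_nat.
- move=> B t; apply/matrixP => k j; rewrite !mxE !tnth_mktuple mxvecE.
  by case: (B k j); case: (tnth _ _).
Qed.

End lebesgue_cmx_prob.

(** * Second moments and averages over translations *)

Section finite_families.
Context d (T : measurableType d) (R : realType) (P : probability T R).

Definition pr (A : set T) : R := fine (P A).

Lemma prE A : measurable A -> P A = (pr A)%:E.
Proof. by move=> mA; rewrite fineK// fin_num_measure. Qed.

Lemma pr_ge0 A : 0 <= pr A.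
Proof. exact: fine_ge0. Qed.

Lemma pr_le A B : measurable A -> measurable B -> A `<=` B -> pr A <= pr B.
Proof. by move=> mA mB AB; rewrite -lee_fin -!prE// le_measure ?inE. Qed.

Lemma pr_le1 A : measurable A -> pr A <= 1.
Proof. by move=> mA; rewrite -lee_fin -prE// probability_le1. Qed.

Lemma pr_setT : pr setT = 1.
Proof. by rewrite /pr probability_setT. Qed.

Let integral_comb (I : Type) (r : seq I) (a : I -> R) (A : I -> set T) :
  (forall i, 0 <= a i) -> (forall i, measurable (A i)) ->
  (\int[P]_x (\sum_(i <- r) (a i * \1_(A i) x))%:E)%E =
  (\sum_(i <- r) a i * pr (A i))%:E.
Proof.
move=> a0 mA; rewrite -sumEFin.
under eq_integral do rewrite -sumEFin.
rewrite ge0_integral_sum//; last 2 first.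
- move=> i; apply/measurable_EFinP; apply: measurable_funM => //.
- by move=> i x _; rewrite lee_fin mulr_ge0.
apply: eq_bigr => i _; under eq_integral do rewrite EFinM.
rewrite ge0_integralZl_EFin//.
  by rewrite integral_indic// setIT EFinM -prE.
by apply/measurable_EFinP; exact: measurable_indic.
Qed.

(** The expectation of a pointwise inequality between step functions; the union
    bound and the second moment method are both of this form. *)
Lemma pr_comb_le (I J : Type) (r : seq I) (s : seq J) (a : I -> R) (b : J -> R)
    (A : I -> set T) (B : J -> set T) :
  (forall i, 0 <= a i) -> (forall j, 0 <= b j) ->
  (forall i, measurable (A i)) -> (forall j, measurable (B j)) ->
  (forall x, \sum_(i <- r) a i * \1_(A i) x <= \sum_(j <- s) b j * \1_(B j) x) ->
  \sum_(i <- r) a i * pr (A i) <= \sum_(j <- s) b j * pr (B j).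
Proof.
move=> a0 b0 mA mB AB; rewrite -lee_fin -!integral_comb//.
have mS (K : Type) (t : seq K) c (C : K -> set T) : (forall k, measurable (C k)) ->
    measurable_fun setT (fun x => (\sum_(k <- t) c k * \1_(C k) x)%:E).
  move=> mC; apply/measurable_EFinP; apply: measurable_sum => k.
  by exact: measurable_funM.
apply: ge0_le_integral => //; try exact: mS.
- by move=> x _; rewrite lee_fin; apply: sumr_ge0 => i _; rewrite mulr_ge0.
- by move=> x _; rewrite lee_fin.
Qed.

Lemma pr_union_le (J : eqType) (s : seq J) (A : set T) (B : J -> set T) :
  measurable A -> (forall j, measurable (B j)) ->
  (forall x, A x -> exists2 j, j \in s & B j x) ->
  pr A <= \sum_(j <- s) pr (B j).
Proof.
move=> mA mB AB.
have : \sum_(i <- [:: tt]) 1 * pr A <= \sum_(j <- s) 1 * pr (B j); last first.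
  rewrite big_seq1 mul1r (eq_bigr (fun j => pr (B j))) // => j _.
  by rewrite mul1r.
apply: (@pr_comb_le _ _ _ _ (fun=> 1) (fun=> 1) (fun=> A)) => // x.
rewrite big_seq1 mul1r (eq_bigr (fun j => \1_(B j) x)); last first.
  by move=> j _; rewrite mul1r.
rewrite [leLHS]indicE; case: (boolP (x \in A)) => [/set_mem/AB[j js Bjx]|_]; last first.
  by apply: sumr_ge0.
elim: s js {AB} => //= k s IH; rewrite inE big_cons => /orP[/eqP<-|/IH{}IH].
  by rewrite indicE mem_set// lerDl sumr_ge0.
by apply: (le_trans IH); rewrite lerDr.
Qed.

(** The number [N] of events that hold satisfies [2 s N <= s ^ 2 1_U + N ^ 2] for
    every [s], as it vanishes off [U]; the choice [s = K E N] gives the bound. *)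
Lemma second_moment (I : eqType) (r : seq I) (A : I -> set T) (U : set T) (K : R) :
  (forall i, measurable (A i)) -> measurable U -> (forall i, i \in r -> A i `<=` U) ->
  0 < K -> 0 < \sum_(i <- r) pr (A i) ->
  \sum_(i <- r) \sum_(j <- r) pr (A i `&` A j) <= K * (\sum_(i <- r) pr (A i)) ^+ 2 ->
  K^-1 <= pr U.
Proof.
move=> mA mU AU K0; set Z := \sum_(i <- r) pr (A i) => Z0 HZ.
set s := K * Z; have s0 : 0 < s by exact: mulr_gt0.
pose J := option (I * I).
pose t : seq J := None :: [seq Some (i, j) | i <- r, j <- r].
pose B (j : J) := if j is Some p then A p.1 `&` A p.2 else U.
pose b (j : J) : R := if j is Some p then 1 else s ^+ 2.
have H : \sum_(i <- r) 2 * s * pr (A i) <= \sum_(j <- t) b j * pr (B j).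
  apply: pr_comb_le => //.
  - by move=> _; rewrite mulr_ge0// ltW.
  - by case => //=; rewrite sqr_ge0.
  - by case=> [p|] //=; exact: measurableI.
  move=> x; rewrite -mulr_sumr big_cons/= big_allpairs_dep/=.
  set N := \sum_(i <- r) \1_(A i) x.
  rewrite (_ : \sum_(i <- r) \sum_(j <- r) _ = N ^+ 2); last first.
    rewrite expr2 /N mulr_suml; apply: eq_bigr => i _; rewrite mulr_sumr.
    by apply: eq_bigr => j _; rewrite mul1r indicI.
  rewrite indicE; case: (boolP (x \in U)) => [_|/negP xU].
    by rewrite mulr1 -subr_ge0; have := sqr_ge0 (s - N); rewrite sqrrB mulr_natl => H; lra.
  rewrite /N big1_seq ?expr0n/= ?mulr0 ?addr0// => i ir; rewrite indicE.
  by case: (boolP (x \in A i)) => // /set_mem/(AU i ir)/mem_set.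
have {}H : 2 * s * Z <= s ^+ 2 * pr U + K * Z ^+ 2.
  move: H; rewrite -mulr_sumr -/Z big_cons/= big_allpairs_dep/= => H.
  apply: le_trans H _; rewrite lerD2l (le_trans _ HZ)//.
  by apply: ler_sum => i _; apply: ler_sum => j _; rewrite mul1r.
rewrite -[K^-1]mul1r ler_pdivrMr// -(ler_pM2l (mulr_gt0 s0 Z0)) mulr1.
by move: H; rewrite /s; nra.
Qed.

End finite_families.

Section averaging.
Context d1 d2 (T1 : measurableType d1) (T2 : measurableType d2) (R : realType).
Variables (P1 : probability T1 R) (P2 : probability T2 R).
Variables (B : Type) (act : B -> T1 -> T1) (L : set B).
Hypothesis unif1 : uniform_mod P1 act L.

(** A periodic set keeps its measure under each translation [act (e w)], hence
    also on average over [w], and the two integrals may be exchanged. This takes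
    the place of changes of variables: it reduces an estimate for [S] to one
    for the random points [act (e w) x] with [x] fixed. *)
Lemma averaging (e : T2 -> B) (S : set T1) : measurable S ->
  (forall b, L b -> invariant_by (act b) S) ->
  measurable_fun setT (fun p : T2 * T1 => act (e p.1) p.2) ->
  P1 S = (\int[P1]_x P2 [set w | S (act (e w) x)])%E /\
  (forall x, measurable [set w | S (act (e w) x)]) /\
  measurable_fun setT (fun x => P2 [set w | S (act (e w) x)]).
Proof.
move=> mS Sper me; pose Z := (fun p : T2 * T1 => act (e p.1) p.2) @^-1` S.
have mZ : measurable Z by exact: measurable_preimage.
have secE : (fun x => [set w | S (act (e w) x)]) = ysection Z.
  by apply/funext => x; apply/seteqP; split => w; rewrite /ysection/= inE.
have -> : (fun x => P2 [set w | S (act (e w) x)]) = P2 \o ysection Z.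
  by rewrite -secE.
split; last split.
- transitivity ((P2 \x P1)%E Z).
    rewrite /product_measure1 (eq_integral (fun=> P1 S)) ?integral_cst//.
      by rewrite [X in (_ * X)%E](_ : _ = 1%E) ?mule1//; exact: probability_setT.
    move=> w _ /=; rewrite -(unif1 mS Sper (e w)); congr (P1 _).
    by apply/seteqP; split => x; rewrite /xsection/= inE.
  exact: product_measure_swap.
- move=> x; have -> : [set w | S (act (e w) x)] = ysection Z x by rewrite -secE.
  exact: measurable_ysection.
- exact: measurable_fun_ysection.
Qed.

Lemma averaging_le (e : T2 -> B) (S H : set T1) (c : R) :
  measurable S -> measurable H -> 0 <= c ->
  (forall b, L b -> invariant_by (act b) S) ->
  measurable_fun setT (fun p : T2 * T1 => act (e p.1) p.2) ->
  (forall x, H x -> pr P2 [set w | S (act (e w) x)] <= c) ->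
  (forall x, ~ H x -> pr P2 [set w | S (act (e w) x)] <= 0) ->
  pr P1 S <= c * pr P1 H.
Proof.
move=> mS mH c0 Sper me Hc SH.
have [PS [mSx mPS]] := averaging mS Sper me.
rewrite -lee_fin EFinM -!prE// PS.
rewrite -[H]setIT -integral_indic// -ge0_integralZl_EFin//; last first.
  by apply/measurable_EFinP; exact: measurable_indic.
apply: ge0_le_integral => //.
- by apply: measurable_funeM; apply/measurable_EFinP; exact: measurable_indic.
- move=> x _; rewrite prE// -EFinM lee_fin indicE.
  case: (boolP (x \in H)) => [/set_mem Hx|xH]; first by rewrite mulr1 Hc.
  by rewrite mulr0; apply: SH => /mem_set; exact/negP.
Qed.

Lemma averaging_ge (e : T2 -> B) (S H : set T1) (c : R) :
  measurable S -> measurable H -> 0 <= c ->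
  (forall b, L b -> invariant_by (act b) S) ->
  measurable_fun setT (fun p : T2 * T1 => act (e p.1) p.2) ->
  (forall x, H x -> c <= pr P2 [set w | S (act (e w) x)]) ->
  c * pr P1 H <= pr P1 S.
Proof.
move=> mS mH c0 Sper me Hc.
have [PS [mSx mPS]] := averaging mS Sper me.
rewrite -lee_fin EFinM -!prE// PS.
rewrite -[H]setIT -integral_indic// -ge0_integralZl_EFin//; last first.
  by apply/measurable_EFinP; exact: measurable_indic.
apply: ge0_le_integral => //.
- by move=> x _; rewrite -EFinM lee_fin mulr_ge0.
- by apply: measurable_funeM; apply/measurable_EFinP; exact: measurable_indic.
- move=> x _; rewrite prE// -EFinM lee_fin indicE.
  case: (boolP (x \in H)) => [/set_mem Hx|xH]; first by rewrite mulr1 Hc.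
  by rewrite mulr0 pr_ge0.
Qed.

End averaging.

Section equidistribution.
Context d1 d2 (T1 : measurableType d1) (T2 : measurableType d2) (R : realType).
Variables (P1 : probability T1 R) (P2 : probability T2 R).
Variables (act1 : T1 -> T1 -> T1) (act2 : T2 -> T2 -> T2).
Variables (L1 : set T1) (L2 : set T2).
Hypothesis unif1 : uniform_mod P1 act1 L1.
Hypothesis unif2 : uniform_mod P2 act2 L2.
Hypothesis act2C : forall y z, act2 y z = act2 z y.
Variables (l : T1 -> T2) (e : T2 -> T1).
Hypothesis l_shift : forall w x, l (act1 (e w) x) = act2 w (l x).
Hypothesis l_lattice : forall b, L1 b ->
  exists2 b', L2 b' & forall x, l (act1 b x) = act2 b' (l x).
Hypothesis ml : measurable_fun setT l.
Hypothesis me : measurable_fun setT (fun p : T2 * T1 => act1 (e p.1) p.2).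

(** The translation by [e w] moves [l x] by [w] and does not affect [H]; on
    average over [w] the point [l x] is therefore uniform, whatever [x] in [H]. *)
Lemma equidistribution (S : set T2) (H : set T1) :
  measurable S -> measurable H ->
  (forall b, L2 b -> invariant_by (act2 b) S) ->
  (forall b, L1 b -> invariant_by (act1 b) H) ->
  (forall w x, H (act1 (e w) x) <-> H x) ->
  pr P1 [set x | S (l x) /\ H x] = pr P2 S * pr P1 H.
Proof.
move=> mS mH Sper Hper He; set G := [set x | _].
have mG : measurable G by apply: measurableI => //; exact: measurable_preimage.
have Gper b : L1 b -> invariant_by (act1 b) G.
  move=> Lb; have [b' Lb' lb] := l_lattice Lb.
  apply/seteqP; split => x /=; rewrite /G /= lb => -[Sx Hx]; split.
  - exact/(invariant_byP _ (Sper b' Lb')).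
  - exact/(invariant_byP _ (Hper b Lb)).
  - exact/(invariant_byP _ (Sper b' Lb')).
  - exact/(invariant_byP _ (Hper b Lb)).
have avg x : H x -> pr P2 [set w | G (act1 (e w) x)] = pr P2 S.
  move=> Hx; rewrite /pr -(unif2 mS Sper (l x)); congr (fine (P2 _)).
  apply/seteqP; split => w /=; rewrite /G/= l_shift act2C => //.
    by case.
  by split => //; exact/He.
apply/eqP; rewrite eq_le; apply/andP; split.
  apply: (averaging_le (P2 := P2) unif1 _ _ _ Gper me) => //; first exact: pr_ge0.
    by move=> x /avg ->.
  move=> x Hx; rewrite (_ : [set w | _] = set0) ?/pr ?measure0//.
  by apply/seteqP; split => // w [_ /He].
apply: (averaging_ge (P2 := P2) unif1 _ _ _ Gper me) => //; first exact: pr_ge0.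
by move=> x /avg ->.
Qed.

End equidistribution.

(** * Gaussian integers *)

Section gaussian_integers.
Variable R : realType.
Notation C := (R[i]).
Notation normc := (@Normc.normc R).

Definition gint_pred : {pred C} :=
  fun z => (complex.Re z \is a Num.int) && (complex.Im z \is a Num.int).
Definition gint := [qualify a z : C | gint_pred z].

Lemma gintP z : reflect (gaussian_int z) (z \is a gint).
Proof. exact: andP. Qed.

Fact gint_subring : subring_closed gint.
Proof.
split=> [|[x y] [u v]|[x y] [u v]].
- by rewrite qualifE /gint_pred/= rpred1 rpred0.
- by rewrite !qualifE /gint_pred/= => /andP[? ?] /andP[? ?]; rewrite !rpredB.
- rewrite !qualifE /gint_pred/= => /andP[? ?] /andP[? ?].
  by rewrite rpredB ?rpredD ?rpredM.
Qed.
HB.instance Definition _ := GRing.isSubringClosed.Build _ gint_pred gint_subring.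

Definition sqnorm (z : C) : R := complex.Re z ^+ 2 + complex.Im z ^+ 2.

Lemma normc_sqrt z : normc z = Num.sqrt (sqnorm z).
Proof. by case: z. Qed.

Lemma normc_ge0 z : 0 <= normc z.
Proof. by rewrite normc_sqrt sqrtr_ge0. Qed.

Lemma sqr_normc z : normc z ^+ 2 = sqnorm z.
Proof. by rewrite normc_sqrt sqr_sqrtr// addr_ge0// sqr_ge0. Qed.

Lemma normc_gt0 z : (0 < normc z) = (z != 0).
Proof.
rewrite lt_def normc_ge0 andbT; congr (~~ _); apply/eqP/eqP => [/Normc.eq0_normc//|->].
exact: Normc.normc0.
Qed.

Lemma ler_normcD (x y : C) : normc (x + y) <= normc x + normc y.
Proof. exact: le_normcD. Qed.

Lemma ler_normcB (x y : C) : normc (x - y) <= normc x + normc y.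
Proof. by rewrite -(normcN y); exact: ler_normcD. Qed.

Lemma normcC (x y : C) : normc (x - y) = normc (y - x).
Proof. by rewrite -normcN opprB. Qed.

Lemma normc_lt (z : C) (r : R) : 0 < r -> (normc z < r) = (sqnorm z < r ^+ 2).
Proof.
by move=> r0; rewrite -sqr_normc ltr_pXn2r// ?nnegrE ?normc_ge0// ltW.
Qed.

Lemma normc_le (z : C) (r : R) : 0 <= r -> (normc z <= r) = (sqnorm z <= r ^+ 2).
Proof.
by move=> r0; rewrite -sqr_normc ler_pXn2r// ?nnegrE ?normc_ge0.
Qed.

Lemma ler_Re_normc (z : C) : `|complex.Re z| <= normc z.
Proof.
rewrite -(@ler_pXn2r _ 2)// ?nnegrE ?normc_ge0// sqr_normc real_normK ?num_real//.
by rewrite lerDl sqr_ge0.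
Qed.

Lemma ler_Im_normc (z : C) : `|complex.Im z| <= normc z.
Proof.
rewrite -(@ler_pXn2r _ 2)// ?nnegrE ?normc_ge0// sqr_normc real_normK ?num_real//.
by rewrite lerDr sqr_ge0.
Qed.

Lemma normc_le_coord (z : C) (r : R) :
  `|complex.Re z| <= r -> `|complex.Im z| <= r -> normc z <= 2 * r.
Proof.
move=> zr zi; have r0 : 0 <= r by exact: le_trans zr.
rewrite normc_le ?mulr_ge0// /sqnorm -real_normK ?num_real//.
rewrite -[X in _ + X]real_normK ?num_real//.
have := normr_ge0 (complex.Re z); have := normr_ge0 (complex.Im z); nra.
Qed.

Lemma sqnorm_int z : z \is a gint -> sqnorm z \is a Num.int.
Proof. by move=> /andP[zr zi]; rewrite rpredD ?rpredX. Qed.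

Lemma int_lt_le1 (x y : R) : x \is a Num.int -> y \is a Num.int -> x < y -> x + 1 <= y.
Proof.
move=> /intrP[k ->] /intrP[l ->]; rewrite ltr_int -[1]/(1%:~R) -intrD ler_int.
by rewrite lezD1.
Qed.

Lemma sqnorm_eq0 z : (sqnorm z == 0) = (z == 0).
Proof.
by rewrite -sqr_normc sqrf_eq0 -[RHS]negbK -normc_gt0 lt_def normc_ge0 andbT negbK.
Qed.

Lemma gint_normc_ge1 z : z \is a gint -> z != 0 -> 1 <= normc z.
Proof.
move=> zZ z0; rewrite -(@ler_pXn2r _ 2)// ?nnegrE ?normc_ge0// expr1n sqr_normc.
rewrite -[1]add0r; apply: int_lt_le1; [exact: rpred0|exact: sqnorm_int|].
by rewrite lt_def sqnorm_eq0 z0 addr_ge0// sqr_ge0.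
Qed.

Lemma gint_normc_lt1 z : z \is a gint -> normc z < 1 -> z = 0.
Proof.
by move=> zZ z1; apply/eqP/negPn/negP => /(gint_normc_ge1 zZ); rewrite leNgt z1.
Qed.

Lemma gint_euclid (a b : C) : b != 0 ->
  exists2 q, q \is a gint & sqnorm (a - q * b) < sqnorm b.
Proof.
move=> b0; have [x xZ xmin] := @nearest_int R (complex.Re (a / b)).
have [y yZ ymin] := @nearest_int R (complex.Im (a / b)).
have half (u v : R) : v \is a Num.int ->
    (forall k, k \is a Num.int -> `|u - v| <= `|u - k|) -> (u - v) ^+ 2 <= 4^-1.
  move=> vZ vmin; have := vmin (v + 1) (rpredD vZ (rpred1 _)).
  have := vmin (v - 1) (rpredB vZ (rpred1 _)).
  rewrite -!(@ler_pXn2r _ 2 _ (`|u - v|))// ?nnegrE// !real_normK ?num_real//.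
  by rewrite !expr2; nra.
exists (Complex x y); first by rewrite qualifE/= /gint_pred/= xZ yZ.
have -> : a - Complex x y * b = (a / b - Complex x y) * b.
  by rewrite mulrBl divfK.
rewrite -!sqr_normc Normc.normcM exprMn -[ltRHS]mul1r ltr_pM2r; last first.
  by rewrite exprn_gt0// normc_gt0.
have := half _ _ xZ xmin; have := half _ _ yZ ymin.
by rewrite sqr_normc /sqnorm; case: (a / b) => u v /=; lra.
Qed.

Lemma gint_bezout (a b : C) : a \is a gint -> b \is a gint ->
  exists d s t a' b', [/\ s \is a gint, t \is a gint, a' \is a gint,
    b' \is a gint & [/\ d = s * a + t * b, a = d * a' & b = d * b']].
Proof.
suff H n : forall a b : C, a \is a gint -> b \is a gint -> sqnorm b < n%:R ->
    exists d s t a' b', [/\ s \is a gint, t \is a gint, a' \is a gint,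
    b' \is a gint & [/\ d = s * a + t * b, a = d * a' & b = d * b']].
  by move=> aZ bZ; apply: (H (Num.truncn (sqnorm b)).+1) => //; exact: truncnS_gt.
elim: n => [a0 b0 _ _|n IH {a b} a b aZ bZ bn].
  by rewrite ltNge addr_ge0// sqr_ge0.
have [->|b0] := eqVneq b 0.
  exists a, 1, 0, 1, 0; split; rewrite ?rpred0 ?rpred1//.
  by split; rewrite ?mul1r ?mul0r ?addr0 ?mulr1 ?mulr0.
have [q qZ qb] := gint_euclid a b0.
have rZ : a - q * b \is a gint by rewrite rpredB// rpredM.
have [|d [s [t [b' [r' [sZ tZ b'Z r'Z [dE bE rE]]]]]]] := IH b (a - q * b) bZ rZ.
  have := int_lt_le1 (sqnorm_int rZ) (sqnorm_int bZ) qb.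
  by move: bn; rewrite -natr1; lra.
exists d, t, (s - t * q), (q * b' + r'), b'; split => //.
- by rewrite rpredB// rpredM.
- by rewrite rpredD// rpredM.
split => //; first by rewrite dE; ring.
by rewrite mulrDr -rE mulrCA -bE; ring.
Qed.

Lemma gint_coprime_pair (a b : C) : a \is a gint -> b \is a gint -> a != 0 ->
  exists d s t a' b', [/\ d \is a gint, a' \is a gint, b' \is a gint, s \is a gint &
   [/\ t \is a gint, d != 0, s * a' + t * b' = 1, a = d * a' & b = d * b']].
Proof.
move=> aZ bZ a0; have [d [s [t [a' [b' [sZ tZ a'Z b'Z [dE aE bE]]]]]]] :=
  gint_bezout aZ bZ.
have d0 : d != 0 by apply: contraNneq a0; rewrite aE => ->; rewrite mul0r.
exists d, s, t, a', b'; split => //; first by rewrite dE rpredD// rpredM.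
by split => //; apply: (mulfI d0); rewrite mulr1 [RHS]dE [in RHS]aE [in RHS]bE; ring.
Qed.

Lemma gint_unit (a b : C) : a \is a gint -> b \is a gint -> a * b = 1 ->
  normc a = 1.
Proof.
move=> aZ bZ ab1; have a0 : a != 0 by apply: contraTneq (oner_neq0 C) => a0; rewrite -ab1 a0 mul0r eqxx.
have b0 : b != 0 by apply: contraTneq (oner_neq0 C) => b0; rewrite -ab1 b0 mulr0 eqxx.
have := congr1 normc ab1; rewrite Normc.normcM Normc.normc1.
have := gint_normc_ge1 aZ a0; have := gint_normc_ge1 bZ b0; nra.
Qed.

End gaussian_integers.

Section gaussian_enumeration.
Variable R : realType.
Notation C := (R[i]).
Notation normc := (@Normc.normc R).

(** A square of Gaussian integers around 0: it contains those of norm at most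
    [N], and its size has the right order of magnitude. *)
Definition gbox (N : nat) : seq C :=
  [seq Complex (i%:R - N%:R) (j%:R - N%:R) | i <- iota 0 (N.*2.+1), j <- iota 0 (N.*2.+1)].

Lemma size_gbox N : size (gbox N) = (N.*2.+1 ^ 2)%N.
Proof. by rewrite size_allpairs size_iota mulnn. Qed.

Lemma gbox_uniq N : uniq (gbox N).
Proof.
apply: allpairs_uniq; rewrite ?iota_uniq// => -[i j] [k l] _ _ /= [] /addIr/eqP.
by rewrite eqr_nat => /eqP -> /addIr/eqP; rewrite eqr_nat => /eqP ->.
Qed.

Lemma gbox_gint N z : z \in gbox N -> z \is a gint R.
Proof.
case/allpairsP => -[i j] [_ _ ->]; rewrite qualifE/= /gint_pred/=.
by rewrite !rpredB ?rpred_nat.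
Qed.

Lemma mem_gbox (N : nat) (z : C) : z \is a gint R ->
  normc z <= N%:R -> z \in gbox N.
Proof.
move=> zZ zN; have coord (x : R) : x \is a Num.int -> `|x| <= N%:R ->
    exists2 i : nat, i \in iota 0 N.*2.+1 & x = i%:R - N%:R.
  move=> xZ; rewrite ler_norml => /andP[Nx xN].
  have : x + N%:R \is a Num.nat.
    by rewrite Num.Theory.natrEint rpredD ?rpred_nat//= -lerBlDr sub0r.
  move=> /natrP[i iE]; exists i; last by rewrite -iE addrK.
  rewrite mem_iota leq0n add0n ltnS -(ler_nat R) -iE -addnn natrD; lra.
case: z zZ zN => x y /andP[/= xZ yZ] zN.
have [i iN xE] := coord x xZ (le_trans (ler_Re_normc (Complex x y)) zN).
have [j jN yE] := coord y yZ (le_trans (ler_Im_normc (Complex x y)) zN).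
by apply/allpairsP; exists (i, j); split => //=; rewrite xE yE.
Qed.

(** Dirichlet's theorem: pigeonhole on the fractional parts of [(a + bi) z],
    for [0 <= a, b <= L], sorted into [L ^ 2] squares of side [1 / L]. *)
Lemma gaussian_dirichlet (z : C) (L : nat) : (0 < L)%N ->
  exists q p, [/\ q \is a gint R, p \is a gint R, q != 0,
    normc q <= 2 * L%:R & normc (q * z - p) < 2 / L%:R].
Proof.
move=> L0; have L0' : 0 < L%:R :> R by rewrite ltr0n.
pose fr (x : R) := x - (Num.floor x)%:~R.
have fr_ge0 x : 0 <= fr x by rewrite subr_ge0 floor_le.
have fr_lt1 x : fr x < 1 by rewrite ltrBlDr addrC -[1]/(1%:~R) -intrD floorD1_gt.
have cell_lt x : (Num.truncn (L%:R * fr x) < L)%N.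
  rewrite truncn_lt_nat ?mulr_ge0//.
  by rewrite -[ltRHS]mulr1 ltr_pM2l.
pose cell x := Ordinal (cell_lt x).
have cell_close x y : cell x = cell y -> `|fr x - fr y| < L%:R^-1.
  move=> /(congr1 val) /= xy.
  have cl u : (Num.truncn (L%:R * fr u))%:R <= L%:R * fr u <
      (Num.truncn (L%:R * fr u))%:R + 1.
    by rewrite natr1; apply: truncn_itv; rewrite mulr_ge0// ltW.
  rewrite -(ltr_pM2l L0') divff ?gt_eqF// -[X in X * _]gtr0_norm// -normrM mulrBr.
  have := cl x; have := cl y; rewrite xy => /andP[y1 y2] /andP[x1 x2].
  by rewrite ltr_norml; lra.
pose g (p : 'I_L.+1 * 'I_L.+1) : C := Complex p.1%:R p.2%:R.
pose f p := (cell (complex.Re (g p * z)), cell (complex.Im (g p * z))).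
have /injectivePn [p [p' pp' fpp']] : ~~ injectiveb f.
  apply/negP => /injectiveP /leq_card; rewrite !card_prod !card_ord leqNgt.
  by rewrite ltn_mul.
have frE x : x - fr x = (Num.floor x)%:~R by rewrite /fr; ring.
pose r u : C := Complex (Num.floor (complex.Re (u * z)))%:~R (Num.floor (complex.Im (u * z)))%:~R.
have rZ u : r u \is a gint R by rewrite qualifE /gint_pred/= !intr_int.
have gZ u : g u \is a gint R by rewrite qualifE /gint_pred/= !rpred_nat.
exists (g p - g p'), (r (g p) - r (g p')); split.
- exact: rpredB.
- exact: rpredB.
- rewrite subr_eq0; apply: contraNneq pp'; case: p p' {fpp'} => [a b] [a' b'] [].
  by move=> /eqP + /eqP; rewrite !eqr_nat => /eqP/val_inj -> /eqP/val_inj ->.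
- apply: normc_le_coord; case: p p' {pp' fpp'} => [[a aL] [b bL]] [[a' aL'] [b' bL']] /=;
  rewrite ler_norml; [move: aL aL'|move: bL bL']; rewrite !ltnS -!(ler_nat R);
  [have := ler0n R a; have := ler0n R a'|have := ler0n R b; have := ler0n R b']; lra.
set u := g p * z; set v := g p' * z.
have uRe : `|fr (complex.Re u) - fr (complex.Re v)| < L%:R^-1.
  by apply: cell_close; exact: (congr1 fst fpp').
have uIm : `|fr (complex.Im u) - fr (complex.Im v)| < L%:R^-1.
  by apply: cell_close; exact: (congr1 snd fpp').
have -> : (g p - g p') * z - (r (g p) - r (g p')) =
    Complex (fr (complex.Re u) - fr (complex.Re v)) (fr (complex.Im u) - fr (complex.Im v)).
  rewrite mulrBl -/u -/v /r -/u -/v /fr; case: u {uRe uIm} => ? ?; case: v => ? ? /=.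
  by congr Complex => /=; ring.
set x := fr _ - _ in uRe *; set y := fr _ - _ in uIm *.
apply: (@le_lt_trans _ _ (2 * Num.max `|x| `|y|)).
  by apply: normc_le_coord; rewrite le_max lexx ?orbT.
by rewrite ltr_pM2l// gt_max uRe.
Qed.

End gaussian_enumeration.

(** * Neighbourhoods of Gaussian integers and of reduced fractions *)

Section near_gaussian.
Variable R : realType.
Notation C := (cplx R).
Notation normc := (@Normc.normc R).
Notation PC := (cplx_prob R).

Lemma cplx_prob_gaussian_uniform : uniform_mod PC (fun b z => z + b) [set b : C | b \is a gint R].
Proof.
have := @cplx_prob_uniform R; congr uniform_mod.
by apply/seteqP; split => b /gintP.
Qed.

Definition ball_cplx (c : C) (r : R) : set C := [set z | normc (z - c) < r].

Lemma measurable_ball_cplx c r : measurable (ball_cplx c r).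
Proof.
have [r0|r0] := ltP 0 r; last first.
  rewrite (_ : ball_cplx c r = set0)//; apply/seteqP; split => // z /=.
  by rewrite /ball_cplx/= ltNge (le_trans r0)// normc_ge0.
have /measurable_cplxP[mr mi] : measurable_fun setT (fun z : C => z - c : C).
  exact: measurable_cplxD.
rewrite (_ : ball_cplx c r = (fun z : C => sqnorm (z - c)) @^-1` `]-oo, r ^+ 2[).
  apply: measurable_preimage; last exact: measurable_itv.
  by apply: measurable_funD; exact: measurable_funX.
by apply/seteqP; split => z; rewrite /ball_cplx/= in_itv/= normc_lt.
Qed.

(** The centres are restricted to a set [A], which will consist of all Gaussian
    integers or of those satisfying a coprimality condition. *)
Definition near_gint (A : set C) (r : R) : set C :=
  [set z | exists p, [/\ p \is a gint R, A p & normc (z - p) < r]].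

Lemma measurable_near_gint A r : measurable (near_gint A r).
Proof.
pose g (k : int * int) : C := Complex k.1%:~R k.2%:~R.
rewrite (_ : near_gint A r =
    \bigcup_(k : int * int) if `[<A (g k)>] then ball_cplx (g k) r else set0).
  apply: countable_bigcupT_measurable => // k.
  by case: ifP => // _; exact: measurable_ball_cplx.
apply/seteqP; split => z.
  move=> [[x y] [/andP[/= /intrP[k kx] /intrP[l ly]] Ap zp]].
  exists (k, l) => //; have -> : g (k, l) = Complex x y by rewrite kx ly.
  by rewrite asboolT.
move=> [k _]; case: ifP => // /asboolP Ak zk; exists (g k); split => //.
by rewrite qualifE /gint_pred/= !intr_int.
Qed.

Lemma near_gint_periodic (A : set C) r b : b \is a gint R ->
  (forall p, A p <-> A (p + b)) -> invariant_by (fun z => z + b) (near_gint A r).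
Proof.
move=> bZ Ab; apply/seteqP; split => z /= [p [pZ Ap zp]].
  exists (p - b); split; first exact: rpredB.
    by apply/Ab; rewrite subrK.
  by rewrite opprB addrA.
exists (p + b); split; [exact: rpredD|exact: (Ab p).1|].
by rewrite opprD addrACA subrr addr0.
Qed.

Lemma unif_itv_le (a b : R) : a <= b -> (unif `]a, b[ <= (b - a)%:E)%E.
Proof.
move=> ab; rewrite unif_closed.
apply: (@le_trans _ _ (@lebesgue_measure R `]a, b[)).
  by apply: le_measure; rewrite ?inE//; try exact: measurableI; exact: subIsetl.
by rewrite lebesgue_measure_itv/= lte_fin; case: ifP; rewrite // lee_fin subr_ge0.
Qed.

Lemma unif_itv (a b : R) : - 2^-1 <= a -> a <= b -> b <= 2^-1 ->
  unif `]a, b[ = (b - a)%:E.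
Proof.
move=> a1 ab b1; rewrite unif_closed setIidl; last first.
  by move=> x /=; rewrite !in_itv/=; lra.
rewrite lebesgue_measure_itv/= lte_fin; case: ltP => // ba.
by congr EFin; lra.
Qed.

Let square (c : C) (r : R) : set C := [set z |
  `]complex.Re c - r, complex.Re c + r[%classic (complex.Re z) /\
  `]complex.Im c - r, complex.Im c + r[%classic (complex.Im z)].

Let prob_square c r : PC (square c r) =
  (unif `](complex.Re c - r)%R, (complex.Re c + r)%R[ *
   unif `](complex.Im c - r)%R, (complex.Im c + r)%R[)%E.
Proof. exact: cplx_prob_box. Qed.

Let measurable_square c r : measurable (square c r).
Proof.
rewrite (_ : square c r = (fun z : C => complex.Re z) @^-1` `]complex.Re c - r, complex.Re c + r[ `&`
  (fun z : C => complex.Im z) @^-1` `]complex.Im c - r, complex.Im c + r[)//.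
have /measurable_cplxP[mr mi] := @measurable_id _ C setT.
by apply: measurableI; apply: measurable_preimage.
Qed.

(** The disc lies in a square of side [2 r]. *)
Lemma pr_ball_le c r : 0 <= r -> pr PC (ball_cplx c r) <= 4 * r ^+ 2.
Proof.
move=> r0; apply: (@le_trans _ _ (pr PC (square c r))).
  apply: pr_le; [exact: measurable_ball_cplx|exact: measurable_square|].
  move=> z; rewrite /ball_cplx/= => zr; rewrite /square/= !in_itv/=.
  have := le_lt_trans (ler_Re_normc _) zr; have := le_lt_trans (ler_Im_normc _) zr.
  by rewrite !raddfB/= !ltr_norml; lra.
rewrite -lee_fin -prE// prob_square.
have -> : 4 * r ^+ 2 = (2 * r) * (2 * r) by ring.
rewrite EFinM; apply: lee_pmul => //.
  by apply: le_trans (unif_itv_le _) _; [|rewrite lee_fin]; lra.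
by apply: le_trans (unif_itv_le _) _; [|rewrite lee_fin]; lra.
Qed.

(** The disc contains a square of side [r], which the bounds on [c] and [r] keep
    inside the unit square. *)
Lemma pr_ball_ge c r : normc c <= 4^-1 -> 0 <= r <= 4^-1 ->
  r ^+ 2 <= pr PC (ball_cplx c r).
Proof.
move=> c4 /andP[r0 r4]; apply: (@le_trans _ _ (pr PC (square c (r / 2)))).
  rewrite -lee_fin -prE// prob_square.
  have := le_trans (ler_Re_normc _) c4; have := le_trans (ler_Im_normc _) c4.
  rewrite !ler_norml => /andP[i1 i2] /andP[r1 r2].
  do 2! (rewrite unif_itv; [|lra|lra|lra]).
  by rewrite -EFinM lee_fin expr2; nra.
apply: pr_le; [exact: measurable_square|exact: measurable_ball_cplx|].
move=> z; rewrite /square/= !in_itv/= => -[/andP[z1 z2] /andP[z3 z4]].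
have r'0 : 0 < r by lra.
by rewrite /ball_cplx/= normc_lt// /sqnorm !raddfB/=; nra.
Qed.

Definition cube : set C := [set z | `|complex.Re z| <= 2^-1 /\ `|complex.Im z| <= 2^-1].

Lemma pr_cube : pr PC cube = 1.
Proof.
rewrite /pr (_ : cube = [set z | `[(- 2^-1), 2^-1]%classic (complex.Re z) /\
   `[(- 2^-1), 2^-1]%classic (complex.Im z)]); last first.
  by apply/seteqP; split => z; rewrite /cube/= !in_itv/= !ler_norml.
rewrite cplx_prob_box// -[X in (X * X)%E](_ : 1%E = _) ?mule1//.
rewrite unif_closed setIid lebesgue_measure_itv/= lte_fin ifT; last by lra.
by rewrite -EFinD; congr EFin; lra.
Qed.

Lemma pr_le_cube (A B : set C) : measurable A -> measurable B ->
  A `&` cube `<=` B -> pr PC A <= pr PC B.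
Proof.
move=> mA mB AB.
have mI : measurable cube.
  have /measurable_cplxP[mr mi] := @measurable_id _ C setT.
  rewrite (_ : cube = (fun z : C => complex.Re z) @^-1` `[(- 2^-1), 2^-1] `&`
    (fun z : C => complex.Im z) @^-1` `[(- 2^-1), 2^-1]).
    by apply: measurableI; apply: measurable_preimage.
  by apply/seteqP; split => z; rewrite /cube/= !in_itv/= !ler_norml.
have PI : PC (~` cube) = 0%E.
  by rewrite probability_setC// prE// pr_cube subee.
have mIC : measurable (A `&` ~` cube) by apply: measurableI => //; exact: measurableC.
have mAI : measurable (A `&` cube) by exact: measurableI.
have AE : A = (A `&` cube) `|` (A `&` ~` cube) by rewrite -setIUr setUv setIT.
rewrite -lee_fin -!prE// [in leLHS]AE; apply: (le_trans (measureU2 PC mAI mIC)).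
rewrite -[leRHS]adde0; apply: leeD; first by apply: le_measure; rewrite ?inE.
rewrite -PI; apply: le_measure; rewrite ?inE//.
exact: measurableC.
Qed.

(** Within the unit square only the disc around 0 matters. *)
Lemma pr_near_gint_le r : 0 <= r <= 2^-1 -> pr PC (near_gint setT r) <= 4 * r ^+ 2.
Proof.
move=> /andP[r0 r2]; apply: le_trans (pr_ball_le 0 r0); apply: pr_le_cube.
- exact: measurable_near_gint.
- exact: measurable_ball_cplx.
move=> z [[p [pZ _ zp]] [zr zi]]; suff p0 : p = 0 by rewrite /ball_cplx/= -p0.
have coord (x y : R) : y \is a Num.int -> `|x| <= 2^-1 -> `|x - y| < r -> y = 0.
  move=> yZ xI xy; apply/eqP/negPn/negP => /(norm_intr_ge1 yZ).
  have := ler_normB x (x - y); rewrite opprB addrC subrK; lra.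
have := le_lt_trans (ler_Re_normc _) zp; have := le_lt_trans (ler_Im_normc _) zp.
case: p pZ {zp} => u v /andP[/= uZ vZ]; rewrite !raddfB/= => zv zu.
by rewrite (coord _ _ uZ zr zu) (coord _ _ vZ zi zv).
Qed.

End near_gaussian.

Section reduced_fractions.
Variable R : realType.
Notation C := (cplx R).
Notation normc := (@Normc.normc R).
Notation PC := (cplx_prob R).
Implicit Types (a b p z : C) (r : R).

Definition coprime_to (a : C) : set C := [set p | exists s t,
  [/\ s \is a gint R, t \is a gint R & s * p + t * a = 1]].

Lemma coprime_toD a b p : b \is a gint R -> coprime_to a p -> coprime_to a (p + b * a).
Proof.
move=> bZ [s [t [sZ tZ st]]]; exists s, (t - s * b); split => //.
  by rewrite rpredB// rpredM.
by rewrite -st; ring.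
Qed.

(** The points [z] close to a fraction [p / a] in lowest terms. The radius is
    that of [a * z], so the neighbourhood of [p / a] has radius [r / |a|]. *)
Definition near_reduced (a : C) (r : R) : set C :=
  [set z | near_gint (coprime_to a) r (a * z)].

Lemma measurable_mulcl a : measurable_fun setT (fun z : C => a * z : C).
Proof. exact: measurable_cplxM. Qed.

Lemma measurable_near_reduced a r : measurable (near_reduced a r).
Proof.
exact: (measurable_preimage (measurable_mulcl a) (measurable_near_gint _ _)).
Qed.

Lemma near_gint_coprime_periodic a b r : a \is a gint R -> b \is a gint R ->
  invariant_by (fun z => z + a * b) (near_gint (coprime_to a) r).
Proof.
move=> aZ bZ; apply: near_gint_periodic; first exact: rpredM.
move=> p; rewrite mulrC; split; first exact: coprime_toD.
move=> /(coprime_toD (b := - b)); rewrite rpredN => /(_ bZ).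
by rewrite mulNr addrK.
Qed.

Lemma near_reduced_periodic a r : a \is a gint R ->
  forall b, b \is a gint R -> invariant_by (fun z => z + b) (near_reduced a r).
Proof.
move=> aZ b bZ; have := @near_gint_coprime_periodic a b r aZ bZ => H.
by apply/seteqP; split => z; rewrite /near_reduced /= mulrDr (invariant_byP _ H).
Qed.

(** Up to a constant factor, the proportion of the residues modulo [a] that are
    prime to [a]. The radius 1/4 keeps the discs around them disjoint. *)
Definition unit_density (a : C) : R := pr PC (near_reduced a 4^-1).

Lemma measurable_shift (c : C) :
  measurable_fun setT (fun p : C * C => p.2 + c * p.1 : C).
Proof.
apply: measurable_cplxD; first exact: measurable_snd.
by apply: measurable_cplxM => //; exact: measurable_fst.
Qed.

(** Translate [z] by [w / a]: if [a z] is within 1/4 of [p], then [a z + w] is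
    within [r] of [p] with probability at least [r ^ 2]. *)
Lemma pr_near_reduced_ge a r : a \is a gint R -> a != 0 -> 0 <= r <= 4^-1 ->
  r ^+ 2 * unit_density a <= pr PC (near_reduced a r).
Proof.
move=> aZ a0 r4.
apply: (averaging_ge (P2 := PC) (@cplx_prob_gaussian_uniform R)
  (e := fun w => a^-1 * w)).
- exact: measurable_near_reduced.
- exact: measurable_near_reduced.
- exact: sqr_ge0.
- exact: near_reduced_periodic.
- exact: measurable_shift.
move=> z [p [pZ ap zp]].
apply: le_trans (pr_ball_ge (c := p - a * z) _ r4) _.
  by rewrite normcC ltW.
apply: pr_le; first exact: measurable_ball_cplx.
  rewrite (_ : [set w | _] = (fun w => a * z + w) @^-1` near_gint (coprime_to a) r).
    apply: measurable_preimage; last exact: measurable_near_gint.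
    exact: measurable_cplxD.
  by apply/seteqP; split => w; rewrite /near_reduced/= mulrDr mulVKf.
move=> w zw; exists p; split => //; rewrite mulrDr mulVKf//.
by move: zw; rewrite /ball_cplx/= opprB addrA [w + _]addrC.
Qed.

(** Translate [z] by [w / (8 a)]. This moves [a z] by at most 1/8, so a centre
    [p] within [r <= 1/10] of the new point was within 1/4 of [a z]; there is at
    most one such [p], and it exists only when [z] is near a reduced fraction
    with radius 1/4. *)
Lemma pr_near_reduced_le a r : a \is a gint R -> a != 0 -> 0 <= r <= 10^-1 ->
  pr PC (near_reduced a r) <= 256 * r ^+ 2 * unit_density a.
Proof.
move=> aZ a0 /andP[r0 r10].
pose S z := [set w : C | near_reduced a r (z + (8 * a)^-1 * w)].
have SE z w : a * (z + (8 * a)^-1 * w) = a * z + 8^-1 * w.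
  by rewrite mulrDr invfM mulrA mulrCA divff// mulr1.
have mS z : measurable (S z).
  rewrite (_ : S z = (fun w : C => a * z + 8^-1 * w) @^-1` near_gint (coprime_to a) r).
    apply: measurable_preimage; last exact: measurable_near_gint.
    by apply: measurable_cplxD => //; exact: measurable_mulcl.
  by apply/seteqP; split => w; rewrite /S /near_reduced/= SE.
have norm8 (w : C) : normc (8^-1 * w) = normc w / 8.
  have -> : 8^-1 = Complex 8^-1 0 :> C.
    by rewrite -[RHS]/(real_complex R 8^-1) fmorphV rmorph_nat.
  rewrite Normc.normcM mulrC; congr (_ * _).
  by rewrite normc_sqrt /sqnorm/= expr0n addr0 sqrtr_sqr ger0_norm// invr_ge0.
have S_cube z w : S z w -> cube w -> exists p, [/\ p \is a gint R, coprime_to a p,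
    normc (a * z + 8^-1 * w - p) < r & normc (a * z - p) < 4^-1].
  rewrite /S/near_reduced/= SE => -[p [pZ ap zp]] [wr wi].
  exists p; split => //.
  have : normc (a * z - p) <= normc (a * z + 8^-1 * w - p) + normc (8^-1 * w).
    apply: le_trans (ler_normcB _ _); rewrite le_eqVlt; apply/orP; left; apply/eqP.
    by congr normc; ring.
  rewrite norm8; have := normc_le_coord wr wi; lra.
apply: (averaging_le (P2 := PC) (@cplx_prob_gaussian_uniform R)
  (e := fun w => (8 * a)^-1 * w)).
- exact: measurable_near_reduced.
- exact: measurable_near_reduced.
- exact: (mulr_ge0 (ler0n _ _) (sqr_ge0 _)).
- exact: near_reduced_periodic.
- exact: measurable_shift.
- move=> z [p [pZ ap zp]].
  apply: (@le_trans _ _ (pr PC (ball_cplx (8 * (p - a * z)) (8 * r)))); last first.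
    by apply: le_trans (pr_ball_le _ _) _; rewrite ?mulr_ge0// exprMn; lra.
  apply: pr_le_cube => //; first exact: mS.
    exact: measurable_ball_cplx.
  move=> w [zw wI]; have [p' [p'Z _ zwp zp']] := S_cube _ _ zw wI.
  have pp' : p' = p.
    apply/eqP; rewrite -subr_eq0; apply/eqP/gint_normc_lt1; first exact: rpredB.
    have := ler_normcB (a * z - p) (a * z - p').
    rewrite (_ : a * z - p - _ = p' - p); last by ring.
    lra.
  rewrite /ball_cplx/= -[normc _](@mulfVK _ 8)// -norm8 mulrC ltr_pM2l//.
  rewrite (_ : 8^-1 * _ = a * z + 8^-1 * w - p') //.
  by rewrite pp'; field.
- move=> z zH; rewrite -[leRHS](_ : pr PC set0 = 0); last by rewrite /pr measure0.
  apply: pr_le_cube => //; first exact: mS.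
  by move=> w [zw wI]; have [p [pZ ap _ zp]] := S_cube _ _ zw wI; apply: zH; exists p.
Qed.

End reduced_fractions.

Section reduced_fractions_counting.
Variable R : realType.
Notation C := (cplx R).
Notation normc := (@Normc.normc R).
Notation PC := (cplx_prob R).
Implicit Types (a b p z : C) (r : R).

Lemma natr_doubleS n : n.*2.+1%:R = 2 * n%:R + 1 :> R.
Proof. by rewrite -natr1 -mul2n natrM. Qed.

(** Let [z] be near [p / a] and near [p' / a'], and put [h = p' a - p a']. Since
    [a] and [a'] are coprime and not both units, the two reduced fractions
    differ and [h] is nonzero; since both are near [z], [h] has norm less than
    [2 X] with [X = r |a'|]. Moreover [a' z] is near [p' = s h + k a'] for some
    Gaussian integer [k], so [h] confines [z] to a disc of radius [r' / |a'|]
    around [s h / a'], modulo the Gaussian integers. There is no such [h] if [X]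
    is small, and otherwise a multiple of [X ^ 2] many. *)
Lemma pr_near_reduced_meet a a' s t r r' :
  a \is a gint R -> a' \is a gint R -> s \is a gint R -> t \is a gint R ->
  a != 0 -> a' != 0 -> s * a + t * a' = 1 -> ~ (normc a = 1 /\ normc a' = 1) ->
  0 <= r -> 0 <= r' <= 2^-1 -> r' * normc a <= r * normc a' ->
  pr PC (near_reduced a r `&` near_reduced a' r') <= 400 * r ^+ 2 * r' ^+ 2.
Proof.
move=> aZ a'Z sZ tZ a0 a'0 st units r0 /andP[r'0 r'2] rr'.
have na0 : 0 < normc a by rewrite normc_gt0.
have na'0 : 0 < normc a' by rewrite normc_gt0.
have na'1 := gint_normc_ge1 a'Z a'0.
set X := normc a' * r.
have X0 : 0 <= X by rewrite /X mulr_ge0// ltW.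
set rho := r' / normc a'.
have rho0 : 0 <= rho by rewrite divr_ge0// ltW.
have rho2 : rho <= 2^-1.
  by rewrite ler_pdivrMr//; apply: le_trans r'2 _; rewrite ler_peMr.
pose N := (Num.truncn (2 * X)).+1.
pose T (h : C) : set C := (fun z => z + (- (s * h / a'))) @^-1` near_gint setT rho.
have mT h : measurable (T h).
  apply: measurable_preimage; last exact: measurable_near_gint.
  exact: measurable_cplxD.
have near_h z : near_reduced a r z -> near_reduced a' r' z ->
    exists h, [/\ h \is a gint R, h != 0, normc h < 2 * X & T h z].
  move=> [p [pZ [u [v [uZ vZ uv]]] zp]] [p' [p'Z [u' [v' [u'Z v'Z uv']]] zp']].
  set h := p' * a - p * a'; have hZ : h \is a gint R by rewrite rpredB// rpredM.
  exists h; split => //.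
  - apply/eqP => h0; apply: units.
    have pa : p * a' = p' * a by apply/eqP; rewrite eq_sym -subr_eq0 -/h h0.
    split.
    + apply: (@gint_unit R a (u * (s * p + t * p') + v)) => //.
        by rewrite rpredD// rpredM// rpredD// rpredM.
      rewrite -uv; transitivity (u * (s * a * p + t * (p' * a)) + v * a); first by ring.
      rewrite -pa; transitivity (u * (s * a + t * a') * p + v * a); first by ring.
      by rewrite st; ring.
    + apply: (@gint_unit R a' (u' * (s * p + t * p') + v')) => //.
        by rewrite rpredD// rpredM// rpredD// rpredM.
      rewrite -uv'; transitivity (u' * (s * (p * a') + t * a' * p') + v' * a'); first by ring.
      rewrite pa; transitivity (u' * (s * a + t * a') * p' + v' * a'); first by ring.
      by rewrite st; ring.
  - have -> : h = a' * (a * z - p) - a * (a' * z - p') by rewrite /h; ring.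
    apply: le_lt_trans (ler_normcB _ _) _; rewrite !Normc.normcM.
    have : normc a' * normc (a * z - p) < X by rewrite ltr_pM2l.
    have : normc a * normc (a' * z - p') < normc a * r' by rewrite ltr_pM2l.
    by move: rr'; rewrite /X; lra.
  - pose k := s * (p + t * h) + t * (p' - s * h).
    have kZ : k \is a gint R by rewrite rpredD// rpredM// ?rpredB ?rpredD ?rpredM.
    exists k; split => //.
    have ka : k * a' = p' - s * h.
      transitivity (s * (p * a' + t * a' * h) + t * a' * (p' - s * h)).
        by rewrite /k; ring.
      have -> : p * a' = p' * a - h by rewrite /h; ring.
      transitivity ((s * a + t * a') * p' - s * h); first by ring.
      by rewrite st; ring.
    have -> : z + - (s * h / a') - k = (a' * z - p') / a'.
      by rewrite [p'](_ : _ = k * a' + s * h); [field|rewrite ka; ring].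
    by rewrite Normc.normcM Normc.normcV ltr_pM2r ?invr_gt0.
have [X2|X2] := leP (2 * X) 1.
  rewrite (_ : _ `&` _ = set0); last first.
    apply/seteqP; split => // z [/near_h H /H [h [hZ h0 hX _]]].
    by have := gint_normc_ge1 hZ h0; lra.
  rewrite {1}/pr measure0 /=; exact: (mulr_ge0 (mulr_ge0 (ler0n _ _) (sqr_ge0 _)) (sqr_ge0 _)).
apply: (@le_trans _ _ (\sum_(h <- gbox R N) pr PC (T h))).
  apply: pr_union_le => //.
    by apply: measurableI; exact: measurable_near_reduced.
  move=> z [/near_h H /H [h [hZ h0 hX hz]]]; exists h => //.
  apply: mem_gbox => //; apply: ltW; apply: lt_trans hX _.
  by rewrite /N truncnS_gt.
have prT h : pr PC (T h) <= 4 * rho ^+ 2.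
  rewrite (_ : pr PC (T h) = pr PC (near_gint setT rho)).
    by apply: pr_near_gint_le; rewrite rho0.
  have per b : b \is a gint R -> invariant_by (fun z => z + b) (near_gint setT rho).
    by move=> bZ; exact: near_gint_periodic.
  have := cplx_prob_gaussian_uniform (measurable_near_gint _ _) per (- (s * h / a')).
  by move=> /(congr1 fine).
apply: (@le_trans _ _ (\sum_(h <- gbox R N) 4 * rho ^+ 2)).
  exact: ler_sum.
rewrite big_const_seq count_predT iter_addr_0 size_gbox -[leLHS]mulr_natl natrX.
have N2 : (N.*2.+1)%:R <= 10 * X :> R.
  have : N%:R <= 2 * X + 1.
    by rewrite /N -natr1 lerD2r truncn_le// mulr_ge0.
  by rewrite natr_doubleS; lra.
have -> : 400 * r ^+ 2 * r' ^+ 2 = (10 * X) ^+ 2 * (4 * rho ^+ 2).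
  by rewrite /X /rho; field; rewrite gt_eqF.
apply: ler_wpM2r; first exact: (mulr_ge0 (ler0n _ _) (sqr_ge0 _)).
by apply: lerXn2r; rewrite ?nnegrE//; exact: (mulr_ge0 (ler0n _ _) X0).
Qed.

Definition disc (L : nat) : seq C :=
  [seq q <- gbox R L.*2 | (q != 0) && (normc q <= 2 * L%:R)].

(** By Dirichlet's theorem, after reduction of the fractions, every point is in
    [near_reduced q (2 / L)] for some [q] in [disc L]. These events have
    probability at most a multiple of [unit_density q / L ^ 2]. *)
Lemma unit_density_sum (L : nat) : (20 <= L)%N ->
  L%:R ^+ 2 / (32 * 32) <= \sum_(q <- disc L) unit_density q.
Proof.
move=> L20; have L0 : 0 < L%:R :> R by rewrite ltr0n (leq_trans _ L20).
have H : 1 <= \sum_(q <- disc L) pr PC (near_reduced q (2 / L%:R)).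
  rewrite -[leLHS](pr_setT PC); apply: pr_union_le => //.
    by move=> q; exact: measurable_near_reduced.
  move=> z _.
  have [//|q [p [qZ pZ q0 qL zL]]] := gaussian_dirichlet z (L := L).
    by rewrite (leq_trans _ L20).
  have [d [s [t [q' [p' [dZ q'Z p'Z sZ [tZ d0 st qE pE]]]]]]] :=
    gint_coprime_pair qZ pZ q0.
  have d1 := gint_normc_ge1 dZ d0.
  have q'q : normc q' <= normc q.
    by rewrite qE Normc.normcM ler_peMl// normc_ge0.
  exists q'.
    rewrite mem_filter (le_trans q'q)// andbT; apply/andP; split.
      by apply: contraNneq q0 => q'0; rewrite qE q'0 mulr0.
    by apply: mem_gbox => //; rewrite (le_trans q'q)// -mul2n natrM.
  exists p'; split => //.
    by exists t, s; split => //; rewrite addrC.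
  apply: le_lt_trans zL.
  have -> : q * z - p = d * (q' * z - p') by rewrite qE pE; ring.
  by rewrite Normc.normcM ler_peMl// normc_ge0.
have {H} : 1 <= \sum_(q <- disc L) (256 * (2 / L%:R) ^+ 2) * unit_density q.
  apply: (le_trans H); rewrite big_seq [leRHS]big_seq; apply: ler_sum => q.
  rewrite mem_filter => /andP[/andP[q0 _] /gbox_gint qZ].
  apply: pr_near_reduced_le => //; rewrite divr_ge0//= ler_pdivrMr//.
  have : 20 <= L%:R :> R by rewrite (ler_nat R 20).
  by lra.
rewrite -mulr_sumr; set Z := \sum_(q <- disc L) _ => H.
have -> : Z = 256 * (2 / L%:R) ^+ 2 * Z * (L%:R ^+ 2 / (32 * 32)).
  by field; rewrite gt_eqF.
have p0 : 0 <= L%:R ^+ 2 / (32 * 32) :> R by rewrite divr_ge0 ?sqr_ge0 ?mulr_ge0.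
by rewrite -[leLHS]mul1r ler_wpM2r.
Qed.

Lemma unit_density_le1 (q : C) : unit_density q <= 1.
Proof. by apply: pr_le1; exact: measurable_near_reduced. Qed.

(** The sum of [unit_density] over the disc is at least [c L ^ 2]. Since
    [unit_density] is at most 1 and there are at most [25 L ^ 2] denominators,
    those of density less than [c / 100] contribute at most [c L ^ 2 / 4], and so
    do those of norm less than [c X / 18]; many of the others must remain. *)
Lemma unit_density_annulus : exists delta c K X0 : R,
  [/\ 0 < delta, 0 < c, 1 < K, 1 <= X0 & forall X, X0 <= X ->
   exists s : seq C, [/\ uniq s, c * X ^+ 2 <= (size s)%:R & forall q, q \in s ->
    [/\ q \is a gint R, X / K < normc q, normc q <= X & delta <= unit_density q]]].
Proof.
pose c : R := (32 * 32)^-1.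
have c0 : 0 < c by rewrite invr_gt0 mulr_gt0.
have c1 : c <= 1 by rewrite invf_le1 ?mulr_gt0//; lra.
have csum L : (20 <= L)%N -> c * L%:R ^+ 2 <= \sum_(q <- disc L) unit_density q.
  by rewrite mulrC; exact: unit_density_sum.
clearbody c.
have ci : 1 <= c^-1 by rewrite invf_ge1.
exists (c / 100), (c / 18), (18 / c), (60 / c); split; try by rewrite divr_gt0.
- by lra.
- by lra.
move=> X X0; have X60 : 60 <= X by lra.
have cX : 60 <= c * X by rewrite mulrC -ler_pdivrMr.
pose y := X / (18 / c); have yE : y = c * X / 18 by rewrite /y; field; rewrite gt_eqF.
pose L := Num.truncn (X / 2).
have X2 : 0 <= X / 2 by lra.
have /andP[L1 L2] := truncn_itv X2; rewrite -/L in L1 L2.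
have {}L2 : X / 2 < L%:R + 1 by rewrite natr1.
have LX : X <= 3 * L%:R by lra.
have L20 : (20 <= L)%N by rewrite -(ler_nat R); lra.
have L20' : 20 <= L%:R :> R by rewrite (ler_nat R 20).
have H := csum _ L20.
pose g q := c / 100 <= unit_density (q : C).
pose s := [seq q <- disc L | g q && (y < normc q)].
have us : uniq s by rewrite !filter_uniq// gbox_uniq.
have sizeD : (size (disc L))%:R <= 25 * L%:R ^+ 2 :> R.
  apply: (@le_trans _ _ ((size (gbox R L.*2))%:R)).
    by rewrite ler_nat size_filter count_size.
  rewrite size_gbox natrX natr_doubleS -mul2n natrM !expr2.
  by nra.
pose small := [seq q <- disc L | ~~ (y < normc q)].
have sizeS : (size small)%:R <= c / 4 * L%:R ^+ 2.
  pose N := (Num.truncn y).+1.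
  have y0 : 0 <= y by lra.
  have /andP[N1 N2] := truncn_itv y0; rewrite -/N in N1 N2.
  apply: (@le_trans _ _ ((size (gbox R N))%:R)).
    rewrite ler_nat; apply: uniq_leq_size; first by rewrite !filter_uniq// gbox_uniq.
    move=> q; rewrite !mem_filter -leNgt => /andP[yq /andP[_ /gbox_gint qZ]].
    by apply: mem_gbox => //; apply: (le_trans yq); exact: ltW.
  rewrite size_gbox natrX natr_doubleS.
  have N1' : N%:R <= y + 1 by rewrite /N -natr1 lerD2r.
  have cLX : c * X <= c * (3 * L%:R) by rewrite ler_wpM2l// ltW.
  have nL : 2 * N%:R + 1 <= c * L%:R / 2 by lra.
  apply: (@le_trans _ _ ((c * L%:R / 2) ^+ 2)).
    by rewrite lerXn2r// nnegrE; [have := ler0n R N|]; lra.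
  have -> : (c * L%:R / 2) ^+ 2 = c * (c / 4 * L%:R ^+ 2) by field.
  by rewrite ler_piMl// mulr_ge0 ?sqr_ge0// divr_ge0// ltW.
have split_sum : \sum_(q <- disc L) unit_density q <=
    (size s)%:R + (size small)%:R + c / 100 * (size (disc L))%:R.
  have -> : c / 100 * (size (disc L))%:R = \sum_(q <- disc L) (c / 100 : R).
    by rewrite big_const_seq count_predT iter_addr_0 mulr_natr.
  rewrite !size_filter -!sum1_count !natr_sum.
  rewrite [X in _ <= X + _ + _]big_mkcond [X in _ <= _ + X + _]big_mkcond/= -!big_split/=.
  apply: ler_sum => q _.
  have := unit_density_le1 q; have := pr_ge0 PC (near_reduced q 4^-1).
  rewrite -/(unit_density q) /g => d0 d1.
  by case: (leP (c / 100) (unit_density q)) => gq /=; case: (ltP y (normc q)) => _ /=; lra.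
exists s; split => //.
  have XL : X ^+ 2 <= 9 * L%:R ^+ 2.
    by rewrite !expr2; nra.
  have : c * X ^+ 2 <= c * (9 * L%:R ^+ 2) by rewrite ler_wpM2l// ltW.
  have : c / 100 * (size (disc L))%:R <= c / 100 * (25 * L%:R ^+ 2).
    by rewrite ler_wpM2l// divr_ge0// ltW.
  by lra.
move=> q; rewrite !mem_filter => /andP[/andP[gq Xq] /andP[/andP[q0 qL] /gbox_gint qZ]].
by split => //; apply: (le_trans qL); lra.
Qed.

End reduced_fractions_counting.

(** * Systems of linear forms *)

Section linear_forms.
Variables (R : realType) (m n : nat).
Notation C := (cplx R).
Notation normc := (@Normc.normc R).
Notation PC := (cplx_prob R).
Notation P := (cmx_prob R m n).
Notation Q := (cmx_prob R 1 n).
Implicit Types (q : 'rV[R[i]]_m) (psi : 'I_n -> R).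

Lemma measurable_cplx_sum d (T : measurableType d) (I : Type) (r : seq I)
    (f : I -> T -> C) : (forall i, measurable_fun setT (f i)) ->
  measurable_fun setT (fun x => \sum_(i <- r) f i x : C).
Proof.
move=> mf; elim: r => [|i r IH].
  by under eq_fun do rewrite big_nil; exact: measurable_cst.
by under eq_fun do rewrite big_cons; exact: measurable_cplxD.
Qed.

Definition gmx m n : set (cmx R m n) := [set B | forall k j, B k j \is a gint R].

Lemma cmx_prob_gmx_uniform a b :
  uniform_mod (cmx_prob R a b) (fun B A => A + B) (@gmx a b).
Proof.
have := @cmx_prob_uniform R a b; congr uniform_mod.
by apply/seteqP; split => B BZ k j; apply/gintP; exact: BZ.
Qed.

Lemma measurable_row_mul q : measurable_fun setT (fun A : cmx R m n => q *m A : cmx R 1 n).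
Proof.
apply/measurable_cmxP => i j; under eq_fun do rewrite mxE.
apply: measurable_cplx_sum => k; apply: measurable_cplxM => //.
exact: measurable_cmx_entry.
Qed.

Definition near_row (S : 'I_n -> set C) : set (cmx R 1 n) :=
  [set y | forall j, S j (y 0 j)].

Lemma measurable_near_row S : (forall j, measurable (S j)) -> measurable (near_row S).
Proof.
move=> mS; rewrite (_ : near_row S = \bigcap_(j in [set: 'I_n])
    ((fun y : cmx R 1 n => y 0 j : C) @^-1` S j)).
  apply: fin_bigcap_measurable; first exact: finite_finset.
  by move=> j _; exact: (measurable_preimage (@measurable_cmx_entry _ _ _ _ _)).
by apply/seteqP; split => y /= yS j; [move=> _|]; exact: yS.
Qed.

Lemma pr_near_row S : (forall j, measurable (S j)) ->
  pr Q (near_row S) = \prod_(j < n) pr PC (S j).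
Proof.
move=> mS; rewrite /pr cmx_prob_row//.
have -> : (\prod_(j < n) PC (S j) = (\prod_(j < n) pr PC (S j))%:E)%E.
  by rewrite -prodEFin; apply: eq_bigr => j _; rewrite prE.
by [].
Qed.

Lemma near_row_periodic S :
  (forall j b, b \is a gint R -> invariant_by (fun z => z + b) (S j)) ->
  forall B, gmx B -> invariant_by (fun y : cmx R 1 n => y + B) (near_row S).
Proof.
move=> Sper B BZ; apply/seteqP; split => y /= yS j; have := yS j;
by rewrite mxE (invariant_byP _ (Sper j _ (BZ 0 j))).
Qed.

(** Shifting the matrix by [v *m w] moves [q *m A] by [w], so [q *m A] is
    uniform modulo the lattice, even on an event [H] that does not see the shift. *)
Lemma row_equidistribution q (v : 'cV[R[i]]_m) (S : set (cmx R 1 n)) (H : set (cmx R m n)) :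
  (forall k, q 0 k \is a gint R) -> q *m v = 1%:M ->
  measurable S -> measurable H ->
  (forall B, gmx B -> invariant_by (fun y => y + B) S) ->
  (forall B, gmx B -> invariant_by (fun A => A + B) H) ->
  (forall (w : cmx R 1 n) (A : cmx R m n), H (A + v *m w) <-> H A) ->
  pr P [set A | S (q *m A) /\ H A] = pr Q S * pr P H.
Proof.
move=> qZ qv mS mH Sper Hper Hv.
apply: (@equidistribution _ _ _ _ _ _ _ _ _ _ _ (@cmx_prob_gmx_uniform m n)
  (@cmx_prob_gmx_uniform 1 n) _ (fun A : cmx R m n => q *m A)
  (fun w : cmx R 1 n => v *m w)) => //.
- by move=> y z; rewrite addrC.
- by move=> w A; rewrite mulmxDr mulmxA qv mul1mx.
- move=> B BZ; exists (q *m B).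
    by move=> k j; rewrite mxE rpred_sum// => l _; rewrite rpredM// ?ord1.
  by move=> A; rewrite mulmxDr.
- exact: measurable_row_mul.
- apply/measurable_cmxP => k j; under eq_fun do rewrite !mxE big_ord1.
  apply: measurable_cplxD; first exact: measurableT_comp (measurable_cmx_entry _ _) measurable_snd.
  apply: measurable_cplxM => //.
  exact: measurableT_comp (measurable_cmx_entry _ _) measurable_fst.
Qed.

Definition form_event q (S : 'I_n -> set C) : set (cmx R m n) :=
  [set A | forall j, S j ((q *m A) 0 j)].

Lemma measurable_form_event q S : (forall j, measurable (S j)) ->
  measurable (form_event q S).
Proof.
move=> mS; exact: (measurable_preimage (measurable_row_mul q) (measurable_near_row mS)).
Qed.

Lemma form_event_periodic q S : (forall k, q 0 k \is a gint R) ->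
  (forall j b, b \is a gint R -> invariant_by (fun z => z + b) (S j)) ->
  forall B, gmx B -> invariant_by (fun A : cmx R m n => A + B) (form_event q S).
Proof.
move=> qZ Sper B BZ.
have qB j : (q *m B) 0 j \is a gint R.
  by rewrite mxE rpred_sum// => k _; rewrite rpredM.
have SqB A j : S j ((q *m (A + B)) 0 j) <-> S j ((q *m A) 0 j).
  by rewrite mulmxDr mxE; exact: (invariant_byP _ (Sper j _ (qB j))).
by apply/seteqP; split => A /= yS j; [apply/SqB|apply/SqB]; exact: yS.
Qed.

Lemma right_inverse_col q k : q 0 k != 0 -> q *m ((q 0 k)^-1 *: (delta_mx k 0 : 'cV_m)) = 1%:M.
Proof.
move=> qk; apply/matrixP => i j; rewrite !ord1 -scalemxAr !mxE (bigD1 k)//= !mxE !eqxx.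
rewrite big1 ?addr0 ?mulr1 ?mulVf// => l lk.
by rewrite mxE (negbTE lk) mulr0.
Qed.

Lemma pr_form_event q (S : 'I_n -> set C) k : (forall k, q 0 k \is a gint R) -> q 0 k != 0 ->
  (forall j, measurable (S j)) ->
  (forall j b, b \is a gint R -> invariant_by (fun z => z + b) (S j)) ->
  pr P (form_event q S) = \prod_(j < n) pr PC (S j).
Proof.
move=> qZ qk mS Sper; rewrite -pr_near_row// -[RHS]mulr1 -(pr_setT P).
rewrite -(row_equidistribution qZ (right_inverse_col qk) (measurable_near_row mS)
  measurableT (near_row_periodic Sper)) //.
by congr (pr _ _); apply/seteqP; split => // A [].
Qed.

Definition near_form q psi := form_event q (fun j => near_gint setT (psi j)).

Lemma near_gintT_periodic r (b : R[i]) : b \is a gint R ->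
  invariant_by (fun z => z + b) (near_gint (R := R) setT r).
Proof. by move=> bZ; exact: near_gint_periodic. Qed.

Lemma prod_pr_near_gint_le psi : (forall j, 0 <= psi j <= 2^-1) ->
  \prod_(j < n) pr PC (near_gint setT (psi j)) <= 4 ^+ n * \prod_(j < n) psi j ^+ 2.
Proof.
move=> psi2; rewrite (_ : 4 ^+ n = \prod_(j < n) 4); last by rewrite prodr_const card_ord.
rewrite -big_split/=; apply: ler_prod => j _; rewrite pr_ge0/=.
exact: pr_near_gint_le.
Qed.

Lemma pr_near_form_le q psi k : (forall k, q 0 k \is a gint R) -> q 0 k != 0 ->
  (forall j, 0 <= psi j <= 2^-1) ->
  pr P (near_form q psi) <= 4 ^+ n * \prod_(j < n) psi j ^+ 2.
Proof.
move=> qZ qk psi2; rewrite (pr_form_event qZ qk).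
- exact: prod_pr_near_gint_le.
- by move=> j; exact: measurable_near_gint.
- by move=> j b; exact: near_gintT_periodic.
Qed.

(** A nonzero minor of [(q, q')] yields a column [v] with [q *m v = 1] and
    [q' *m v = 0]; shifts along [v] make [q *m A] uniform and fix [q' *m A]. *)
Lemma pr_near_form_independent q q' psi psi' k l :
  (forall k, q 0 k \is a gint R) -> (forall k, q' 0 k \is a gint R) ->
  q 0 k * q' 0 l != q 0 l * q' 0 k ->
  (forall j, 0 <= psi j <= 2^-1) -> (forall j, 0 <= psi' j <= 2^-1) ->
  pr P (near_form q psi `&` near_form q' psi') <=
  16 ^+ n * (\prod_(j < n) psi j ^+ 2) * (\prod_(j < n) psi' j ^+ 2).
Proof.
move=> qZ q'Z D0 psi2 psi2'.
have m1 r : measurable (near_gint (R := R) setT r) by exact: measurable_near_gint.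
have p1 (f : 'I_n -> R) (j : 'I_n) (b : R[i]) : b \is a gint R ->
    invariant_by (fun z => z + b) (near_gint (R := R) setT (f j)).
  by exact: near_gintT_periodic.
set D := q 0 k * q' 0 l - q 0 l * q' 0 k.
have {D0} D0 : D != 0 by rewrite subr_eq0.
pose v : 'cV[R[i]]_m := D^-1 *: (q' 0 l *: delta_mx k 0 - q' 0 k *: delta_mx l 0).
have mul_delta (u : 'rV[R[i]]_m) i : (u *m (delta_mx i 0 : 'cV_m)) = (u 0 i)%:M.
  apply/matrixP => a b; rewrite !ord1 !mxE (bigD1 i)//= !mxE !eqxx big1 ?addr0 ?mulr1//.
  by move=> j ji; rewrite mxE (negbTE ji) mulr0.
have qv : q *m v = 1%:M.
  rewrite /v -scalemxAr mulmxBr -!scalemxAr !mul_delta !scale_scalar_mx -raddfB/= scale_scalar_mx.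
  by congr (_%:M); rewrite -[RHS](mulVf D0) /D; ring.
have q'v : q' *m v = 0.
  rewrite /v -scalemxAr mulmxBr -!scalemxAr !mul_delta !scale_scalar_mx -raddfB/= scale_scalar_mx.
  by rewrite (_ : _ * _ = 0) ?raddf0//; ring.
have q'0 : exists i, q' 0 i != 0.
  have [q'l|] := eqVneq (q' 0 l) 0; last by exists l.
  exists k; apply: contra_neq D0 => q'k; by rewrite /D q'l q'k !mulr0 subrr.
have [i q'i] := q'0.
have -> : near_form q psi `&` near_form q' psi' =
  [set A | near_row (fun j => near_gint setT (psi j)) (q *m A) /\ near_form q' psi' A] by [].
rewrite (row_equidistribution qZ qv).
- rewrite pr_near_row//.
  have -> : 16 ^+ n * (\prod_(j < n) psi j ^+ 2) * (\prod_(j < n) psi' j ^+ 2) =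
      (4 ^+ n * \prod_(j < n) psi j ^+ 2) * (4 ^+ n * \prod_(j < n) psi' j ^+ 2).
    have -> : 16 = 4 * 4 :> R by rewrite -natrM.
    by rewrite exprMn; ring.
  apply: ler_pM; first by apply: prodr_ge0 => j _; exact: pr_ge0.
  + exact: pr_ge0.
  + exact: prod_pr_near_gint_le.
  + exact: pr_near_form_le q'i psi2'.
- exact: measurable_near_row.
- exact: measurable_form_event.
- by apply: near_row_periodic => j; exact: p1.
- by apply: form_event_periodic => // j; exact: p1.
- by move=> w A; rewrite /near_form/form_event/= mulmxDr mulmxA q'v mul0mx addr0.
Qed.

End linear_forms.

Section primitive_solutions.
Variables (R : realType) (m n : nat).
Notation C := (cplx R).
Notation normc := (@Normc.normc R).
Notation PC := (cplx_prob R).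
Notation P := (cmx_prob R m n).
Notation Q := (cmx_prob R 1 n).
Implicit Types (q : 'rV[R[i]]_m) (psi : 'I_n -> R).

Definition coprime_to_row q : set C := [set p | exists (s : C) (t : 'I_m -> C),
  [/\ s \is a gint R, forall k, t k \is a gint R & s * p + \sum_k t k * q 0 k = 1]].

(** Solutions [q A_j ~ p_j] with each [(p_j, q)] unimodular: without this
    restriction a solution would be counted again for the multiples of [q]. *)
Definition primitive_form q psi :=
  form_event q (fun j => near_gint (coprime_to_row q) (psi j)).

Lemma primitive_sub_near q psi : primitive_form q psi `<=` near_form q psi.
Proof. by move=> A Aq j; have [p [pZ _ pA]] := Aq j; exists p. Qed.

Lemma measurable_primitive_form q psi : measurable (primitive_form q psi).
Proof. by apply: measurable_form_event => j; exact: measurable_near_gint. Qed.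

Lemma coprime_to_row_shift q (b : 'I_m -> C) p :
  (forall k, b k \is a gint R) -> coprime_to_row q p ->
  coprime_to_row q (p + \sum_k q 0 k * b k).
Proof.
move=> bZ [s [t [sZ tZ st]]]; exists s, (fun k => t k - s * b k); split => //.
  by move=> k; rewrite rpredB// rpredM.
rewrite -st mulrDr -addrA; congr (_ + _); rewrite mulr_sumr -big_split/=.
by apply: eq_bigr => k _; ring.
Qed.

Lemma primitive_form_periodic q psi : (forall k, q 0 k \is a gint R) ->
  forall B, gmx B -> invariant_by (fun A : cmx R m n => A + B) (primitive_form q psi).
Proof.
move=> qZ B BZ.
have per j : invariant_by (fun z => z + (q *m B) 0 j) (near_gint (coprime_to_row q) (psi j)).
  apply: near_gint_periodic.
    by rewrite mxE rpred_sum// => k _; rewrite rpredM.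
  move=> p; rewrite mxE; split; first exact: coprime_to_row_shift.
  move=> /(@coprime_to_row_shift q (fun k => - B k j)) H.
  rewrite -[p](_ : p + \sum_k q 0 k * B k j + \sum_k q 0 k * - B k j = p).
    by apply: H => k; rewrite rpredN.
  by rewrite -addrA -big_split/= big1 ?addr0// => k _; rewrite mulrN subrr.
have SqB A j : near_gint (coprime_to_row q) (psi j) ((q *m (A + B)) 0 j) <->
    near_gint (coprime_to_row q) (psi j) ((q *m A) 0 j).
  by rewrite mulmxDr mxE; exact: (invariant_byP _ (per j)).
by apply/seteqP; split => A /= yS j; apply/SqB; exact: yS.
Qed.

Lemma coprime_to_row_entry q k : (forall k, q 0 k \is a gint R) ->
  coprime_to (q 0 k) `<=` coprime_to_row q.
Proof.
move=> qZ p [s [t [sZ tZ st]]]; exists s, (fun l => if l == k then t else 0); split => //.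
  by move=> l; case: ifP; rewrite // rpred0.
by rewrite (bigD1 k)//= eqxx big1 ?addr0// => l /negbTE ->; rewrite mul0r.
Qed.

(** It is enough to make the entries of [q *m A] close to integers prime to the
    single coordinate [q 0 k]. Shifting row [k] of [A] by [w] adds
    [q 0 k * w 0 j] to them, so each column succeeds with the probability of
    [near_reduced (q 0 k) (psi j)]. *)
Lemma pr_primitive_form_ge q psi k : (forall k, q 0 k \is a gint R) -> q 0 k != 0 ->
  (forall j, 0 <= psi j <= 4^-1) ->
  unit_density (q 0 k : C) ^+ n * \prod_(j < n) psi j ^+ 2 <= pr P (primitive_form q psi).
Proof.
move=> qZ qk psi4; set c0 := leLHS; rewrite -[c0]mulr1 -(pr_setT P).
have qkA (A : cmx R m n) (w : cmx R 1 n) j :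
    (q *m (A + (delta_mx k 0 : 'cV_m) *m w)) 0 j = (q *m A) 0 j + q 0 k * w 0 j.
  rewrite mulmxDr mulmxA mxE; congr (_ + _).
  rewrite mxE big_ord1; congr (_ * _); rewrite mxE (bigD1 k)//= mxE !eqxx mulr1.
  by rewrite big1 ?addr0// => l lk; rewrite mxE (negbTE lk) mulr0.
apply: (@averaging_ge _ _ _ _ _ _ Q _ _ _ (@cmx_prob_gmx_uniform R m n)
  (fun w : cmx R 1 n => (delta_mx k 0 : 'cV_m) *m w)).
- exact: measurable_primitive_form.
- exact: measurableT.
- apply: mulr_ge0; last by apply: prodr_ge0 => j _; exact: sqr_ge0.
  by apply: exprn_ge0; exact: pr_ge0.
- exact: primitive_form_periodic.
- apply/measurable_cmxP => i j; under eq_fun do rewrite !mxE big_ord1.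
  apply: measurable_cplxD; first exact: measurableT_comp (measurable_cmx_entry _ _) measurable_snd.
  apply: measurable_cplxM => //.
  exact: measurableT_comp (measurable_cmx_entry _ _) measurable_fst.
move=> A _.
pose c j : C := (q *m A) 0 j / q 0 k.
pose S j := (fun z : C => z + c j) @^-1` near_reduced (q 0 k) (psi j).
have mS j : measurable (S j).
  by apply: measurable_preimage; [exact: measurable_cplxD|exact: measurable_near_reduced].
apply: (@le_trans _ _ (pr Q (near_row S))).
  rewrite pr_near_row// /c0.
  have -> : unit_density (q 0 k : C) ^+ n = \prod_(j < n) unit_density (q 0 k : C).
    by rewrite prodr_const card_ord.
  rewrite -big_split/=; apply: ler_prod => j _; apply/andP; split.
    by apply: mulr_ge0; [exact: pr_ge0|exact: sqr_ge0].
  have := cplx_prob_gaussian_uniform (measurable_near_reduced (q 0 k) (psi j))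
    (near_reduced_periodic (psi j) (qZ k)) (c j).
  move=> shift; have -> : pr PC (S j) = pr PC (near_reduced (q 0 k) (psi j)).
    exact: (congr1 fine shift).
  by rewrite mulrC; apply: pr_near_reduced_ge.
apply: pr_le.
- exact: measurable_near_row.
- rewrite (_ : [set w | _] = (fun w : cmx R 1 n =>
      A + (delta_mx k 0 : 'cV_m) *m w) @^-1` primitive_form q psi)//.
  apply: (measurable_preimage _ (measurable_primitive_form _ _)).
  apply/measurable_cmxP => i j; under eq_fun do rewrite !mxE big_ord1.
  apply: measurable_cplxD => //; apply: measurable_cplxM => //.
  exact: measurable_cmx_entry.
move=> w Sw j; have [p [pZ kp zp]] := Sw j; exists p; split => //.
  exact: (coprime_to_row_entry qZ kp).
by move: zp; rewrite qkA mulrDr /c mulrCA divff// mulr1 [q 0 k * _ + _]addrC.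
Qed.

(** Associate rows have the same solutions up to a unit, so for them the trivial
    bound cannot be improved. *)
Definition associate q q' := exists2 u : C, u \is a gint R /\ normc u = 1 & q' = u *: q.

(** Write [q = a v] and [q' = a' v] with [a], [a'] coprime and [v] Gaussian. Both
    events force [v *m A] to be close, in each column, to a reduced fraction of
    denominator [a] and to one of denominator [a'], and [pr_near_reduced_meet]
    applies in each column because [q], [q'] are not associate. *)
Lemma pr_primitive_form_parallel q q' psi psi' k :
  (forall k, q 0 k \is a gint R) -> (forall k, q' 0 k \is a gint R) ->
  q 0 k != 0 -> q' 0 k != 0 ->
  (forall l, q 0 k * q' 0 l = q 0 l * q' 0 k) -> ~ associate q q' ->
  (forall j, 0 <= psi j <= 2^-1) -> (forall j, 0 <= psi' j <= 2^-1) ->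
  pr P (primitive_form q psi `&` primitive_form q' psi') <=
  400 ^+ n * (\prod_(j < n) psi j ^+ 2) * (\prod_(j < n) psi' j ^+ 2).
Proof.
move=> qZ q'Z qk q'k qq' nassoc psi2 psi2'.
have [d [s [t [a [a' [dZ aZ a'Z sZ [tZ d0 st qkE q'kE]]]]]]] :=
  gint_coprime_pair (qZ k) (q'Z k) qk.
have a0 : a != 0 by apply: contraNneq qk => a0; rewrite qkE a0 mulr0.
have a'0 : a' != 0 by apply: contraNneq q'k => a'0; rewrite q'kE a'0 mulr0.
have cross l : a * q' 0 l = a' * q 0 l.
  by apply: (mulfI d0); rewrite !mulrA -qkE -q'kE qq' mulrC.
pose v : 'rV[R[i]]_m := s *: q + t *: q'.
have vZ l : v 0 l \is a gint R by rewrite !mxE rpredD// rpredM.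
have qv : q = a *: v.
  apply/rowP => l; rewrite !mxE mulrDr [a * (t * _)]mulrCA cross.
  by rewrite -[LHS]mul1r -st; ring.
have q'v : q' = a' *: v.
  apply/rowP => l; rewrite !mxE mulrDr [a' * (s * _)]mulrCA -cross.
  by rewrite -[LHS]mul1r -st; ring.
have vk : v 0 k != 0.
  by apply: contraNneq qk => vk; rewrite qv mxE vk mulr0.
have units : ~ (normc a = 1 /\ normc a' = 1).
  move=> [na na']; apply: nassoc.
  have aJ : a * conjc a = 1.
    have := sqr_normc a; rewrite na expr1n.
    case: (a) => x y /= xy; apply/eqP; rewrite eq_complex /=; apply/andP; split; apply/eqP.
      by rewrite /sqnorm/= in xy; rewrite xy !expr2; ring.
    by ring.
  have aJZ : conjc a \is a gint R.
    by move: aZ; rewrite !qualifE /gint_pred; case: (a) => x y /=; rewrite rpredN.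
  exists (a' * conjc a); last by rewrite qv q'v scalerA -mulrA [_ * a]mulrC aJ mulr1.
  split; first exact: rpredM.
  have := congr1 normc aJ; rewrite !Normc.normcM Normc.normc1 na na' !mul1r.
  by [].
pose S j := near_reduced a (psi j) `&` near_reduced a' (psi' j).
have mS j : measurable (S j) by apply: measurableI; exact: measurable_near_reduced.
have Sper j b : b \is a gint R -> invariant_by (fun z => z + b) (S j).
  move=> bZ; rewrite /S /invariant_by preimage_setI.
  by rewrite (near_reduced_periodic (psi j) aZ bZ) (near_reduced_periodic (psi' j) a'Z bZ).
have sub : primitive_form q psi `&` primitive_form q' psi' `<=` form_event v S.
  have red (b : C) (u : 'rV[R[i]]_m) z r : u = b *: v ->
      near_gint (coprime_to_row u) r (b * z) -> near_reduced b r z.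
    move=> uE [p [pZ [s' [t' [s'Z t'Z st']]] zp]]; exists p; split => //.
    exists s', (\sum_l t' l * v 0 l); split => //.
      by rewrite rpred_sum// => l _; rewrite rpredM.
    rewrite -st' mulr_suml; congr (_ + _); apply: eq_bigr => l _.
    have -> : u 0 l = b * v 0 l by rewrite uE mxE.
    by ring.
  clearbody v.
  move=> A [Aq Aq'] j.
  have E : (q *m A) 0 j = a * (v *m A) 0 j by rewrite [in LHS]qv -scalemxAl mxE.
  have E' : (q' *m A) 0 j = a' * (v *m A) 0 j by rewrite [in LHS]q'v -scalemxAl mxE.
  split; first by apply: (red a q) => //; rewrite -E; exact: Aq.
  by apply: (red a' q') => //; rewrite -E'; exact: Aq'.
apply: (@le_trans _ _ (pr P (form_event v S))).
  apply: pr_le => //; last exact: measurable_form_event.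
  by apply: measurableI; exact: measurable_primitive_form.
rewrite (pr_form_event vZ vk mS Sper).
have -> : 400 ^+ n = \prod_(j < n) (400 : R) by rewrite prodr_const card_ord.
rewrite -!big_split/=; apply: ler_prod => j _; rewrite pr_ge0/=.
have [/andP[x0 x2] /andP[y0 y2]] := (psi2 j, psi2' j).
have [le|/ltW le] := leP (psi' j * normc a) (psi j * normc a').
  by apply: (@pr_near_reduced_meet _ a a' s t); rewrite ?y0.
rewrite /S setIC mulrAC.
apply: (@pr_near_reduced_meet _ a' a t s); rewrite ?x0//; first by rewrite addrC.
by move=> [na' na]; apply: units.
Qed.

End primitive_solutions.

(** * Lower bounds for upper limits *)

Section row_enumeration.
Variables (T : choiceType) (m : nat).

Lemma row_product (x0 : T) (L : 'I_m -> seq T) : (forall k, uniq (L k)) ->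
  exists s : seq 'rV[T]_m, [/\ uniq s, size s = (\prod_k size (L k))%N &
    forall q, (q \in s) <-> (forall k, q 0 k \in L k)].
Proof.
move=> uL; pose N := (\max_k size (L k)).+1.
have LN k : (size (L k) <= N)%N by rewrite /N ltnW// ltnS leq_bigmax.
pose F : pred {ffun 'I_m -> 'I_N} := family (fun k => [pred i : 'I_N | (i < size (L k))%N]).
pose row (f : {ffun 'I_m -> 'I_N}) : 'rV[T]_m := \row_k nth x0 (L k) (f k).
exists [seq row f | f <- enum F]; split.
- rewrite map_inj_in_uniq ?enum_uniq// => f g.
  rewrite !mem_enum => /familyP fF /familyP gF /rowP fg; apply/ffunP => k.
  apply/val_inj/eqP; rewrite -(nth_uniq x0 (fF k) (gF k) (uL k)).
  by have := fg k; rewrite !mxE => ->.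
- rewrite size_map -cardE card_family foldrE big_map big_enum/=.
  apply: eq_bigr => k _; rewrite -sum1_card.
  rewrite (eq_bigl (fun i : 'I_N => (i < size (L k))%N))//.
  by rewrite -(big_ord_widen N (fun=> 1%N) (LN k)) sum1_card card_ord.
- move=> q; split=> [/mapP[f + ->] k|qL].
    by rewrite mem_enum => /familyP fF; rewrite mxE mem_nth//; exact: fF.
  pose f : {ffun 'I_m -> 'I_N} := [ffun k => inord (index (q 0 k) (L k))].
  have fE k : f k = index (q 0 k) (L k) :> nat.
    by rewrite ffunE inordK// (leq_trans _ (LN k))// index_mem.
  apply/mapP; exists f; last by apply/rowP => k; rewrite mxE fE nth_index.
  by rewrite mem_enum; apply/familyP => k; rewrite inE fE index_mem.
Qed.

End row_enumeration.

Section limsup_lower_bound.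
Variables (R : realType) (m n : nat).
Notation C := (cplx R).
Notation normc := (@Normc.normc R).
Notation P := (cmx_prob R m n).

Definition solvable (psi : 'I_n -> R) (Phi : 'I_m -> R) : set (cmx R m n) :=
  [set A | exists q : 'rV[R[i]]_m, [/\ q != 0, forall k, q 0 k \is a gint R,
    near_form q psi A & forall k, normc (q 0 k) <= Phi k]].

Lemma measurable_solvable psi Phi : measurable (solvable psi Phi).
Proof.
pose g (z : 'rV[int * int]_m) : 'rV[R[i]]_m :=
  \row_k Complex (z 0 k).1%:~R (z 0 k).2%:~R.
have gZ z k : g z 0 k \is a gint R by rewrite mxE qualifE /gint_pred/= !intr_int.
rewrite (_ : solvable psi Phi = \bigcup_(z : 'rV[int * int]_m)
    if [&& g z != 0 & [forall k, normc (g z 0 k) <= Phi k]] then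
      near_form (g z) psi else set0).
  apply: countable_bigcupT_measurable => // z; case: ifP => // _.
  by apply: measurable_form_event => j; exact: measurable_near_gint.
apply/seteqP; split => A.
  move=> [q [q0 qZ Aq qPhi]].
  have /choice[f fE] : forall k, exists z : int * int,
      q 0 k = Complex z.1%:~R z.2%:~R.
    move=> k; have := qZ k; case: (q 0 k) => x y /andP[/= /intrP[a ->] /intrP[b ->]].
    by exists (a, b).
  have gq : g (\row_k f k) = q by apply/rowP => k; rewrite !mxE fE.
  exists (\row_k f k) => //; rewrite gq q0/=.
  by case: ifP => // /negP[]; apply/forallP.
move=> [z _]; case: ifP => // /andP[z0 /forallP zPhi] Az.
by exists (g z); split.
Qed.

Variables (k0 : 'I_m) (delta c K X0 : R).
Hypotheses (delta0 : 0 < delta) (c0 : 0 < c) (K1 : 1 < K) (X01 : 1 <= X0).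
(** The data of [unit_density_annulus] are fixed once and for all: the constant
    of the lower bounds must not change when [Phi] is divided by [2 ^ r]. *)
Hypothesis annulus : forall X, X0 <= X ->
  exists s : seq C, [/\ uniq s, c * X ^+ 2 <= (size s)%:R & forall q, q \in s ->
   [/\ q \is a gint R, X / K < normc q, normc q <= X & delta <= unit_density q]].

(** The coordinate [k0] runs over an annulus of denominators of large
    [unit_density], the other ones over full boxes. *)
Let row_list (Phi : 'I_m -> R) : (forall k, X0 <= Phi k) ->
  exists s : seq 'rV[R[i]]_m, [/\ uniq s,
    c * 4^-1 ^+ m * \prod_k Phi k ^+ 2 <= (size s)%:R &
    forall q, q \in s -> [/\ forall k, q 0 k \is a gint R,
      forall k, normc (q 0 k) <= Phi k, Phi k0 / K < normc (q 0 k0) &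
      delta <= unit_density (q 0 k0 : C)]].
Proof.
move=> PhiX; have [s0 [us0 size0 s0P]] := annulus (PhiX k0).
pose L k : seq C := if k == k0 then s0 else gbox R (Num.truncn (Phi k / 2)).
have [|s [us sizes sP]] := @row_product C m 0 L.
  by move=> k; rewrite /L; case: ifP => // _; exact: gbox_uniq.
have gboxP (X : R) z : 1 <= X -> z \in gbox R (Num.truncn (X / 2)) -> normc z <= X.
  move=> X1 zX; have X2 : 0 <= X / 2 by lra.
  have /andP[N1 _] := truncn_itv X2; move: zX N1.
  set N := Num.truncn _ => zN N1.
  rewrite -[leRHS](_ : 2 * (X / 2) = X); last by field.
  case/allpairsP: zN => -[i j] [iN jN ->]; move: iN jN.
  rewrite !mem_iota !leq0n !add0n !ltnS -!(ler_nat R) -!mul2n !natrM => iN jN.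
  have i0 := ler0n R i; have j0 := ler0n R j.
  by apply: normc_le_coord; rewrite /= ler_norml; lra.
exists s; split => //.
- rewrite sizes natr_prod.
  have -> : c * 4^-1 ^+ m * \prod_k Phi k ^+ 2 = c * \prod_(k < m) (4^-1 * Phi k ^+ 2).
    by rewrite [in RHS]big_split/= prodr_const card_ord mulrA.
  rewrite (bigD1 k0)//= [leRHS](bigD1 k0)//= /L eqxx mulrA.
  apply: ler_pM.
  + by rewrite mulr_ge0 ?(ltW c0)// mulr_ge0 ?sqr_ge0.
  + by apply: prodr_ge0 => k _; rewrite mulr_ge0 ?sqr_ge0.
  + apply: le_trans size0; rewrite ler_wpM2l ?(ltW c0)//.
    by rewrite ler_piMl ?sqr_ge0//; lra.
  apply: ler_prod => k /negbTE kk0; rewrite mulr_ge0 ?sqr_ge0//= kk0.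
  have X1 : 1 <= Phi k by exact: le_trans X01 _.
  have X2 : 0 <= Phi k / 2 by lra.
  have /andP[_ N2] := truncn_itv X2.
  rewrite size_gbox natrX natr_doubleS.
  move: (Num.truncn (Phi k / 2)) N2 => N N2; have N0 := ler0n R N.
  have {}N2 : Phi k / 2 < N%:R + 1 by rewrite natr1.
  have : Phi k / 2 <= 2 * N%:R + 1 by lra.
  by rewrite !expr2; nra.
- move=> q /sP qL; have qk0 := qL k0; rewrite /L eqxx in qk0.
  have [qk0Z qk1 qk2 qk3] := s0P _ qk0; split => //.
    move=> k; have := qL k; rewrite /L; case: ifP => [/eqP -> //|_].
    exact: gbox_gint.
  move=> k; have := qL k; rewrite /L; case: ifP => [/eqP -> //|_].
  by apply: gboxP; exact: le_trans X01 _.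
Qed.

Variables (psi : 'I_n -> nat -> R) (Phi : 'I_m -> nat -> R) (T0 : nat).
Hypothesis psi4 : forall j t, (T0 <= t)%N -> 0 <= psi j t <= 4^-1.
Hypothesis PhiX : forall k t, (T0 <= t)%N -> X0 <= Phi k t.
Hypothesis PhiK : forall t, (T0 <= t)%N -> K * Phi k0 t <= Phi k0 t.+1.

(** The annuli of different indices are disjoint, so associate rows can only
    occur at the same index. *)
Let PhiK_lt t t' : (T0 <= t)%N -> (t < t')%N -> Phi k0 t <= Phi k0 t' / K.
Proof.
have K0 : 0 < K by exact: lt_trans K1.
move=> T0t; elim: t' => // t' IH; rewrite ltnS leq_eqVlt => /orP[/eqP <-|tt'].
  by rewrite ler_pdivlMr// mulrC PhiK.
apply: (le_trans (IH tt')); rewrite ler_pM2r ?invr_gt0//.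
have T0t' : (T0 <= t')%N by rewrite (leq_trans T0t)// ltnW.
apply: le_trans (PhiK T0t'); rewrite ler_peMl ?(ltW K1)//.
exact: le_trans (le_trans ler01 X01) (PhiX k0 T0t').
Qed.

Let w t := \prod_(j < n) psi j t ^+ 2.

Let w_ge0 t : 0 <= w t.
Proof. by apply: prodr_ge0 => j _; exact: sqr_ge0. Qed.

(** The ratio between the second moment and the square of the first: [400 ^ n]
    from [pr_primitive_form_parallel], [9 * 4 ^ n] from the associate pairs, of
    which there are at most [9 = size (gbox 1)] for each row, and [delta ^ n]
    from [pr_primitive_form_ge]. *)
Definition moment_constant : R := (400 ^+ n + 9 * 4 ^+ n) / (delta ^+ n) ^+ 2.

Lemma moment_constant_gt0 : 0 < moment_constant.
Proof.
apply: divr_gt0; last by do 2! apply: exprn_gt0.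
apply: addr_gt0; first exact: (exprn_gt0 _ (ltr0Sn _ _)).
exact: (mulr_gt0 (ltr0Sn _ _) (exprn_gt0 _ (ltr0Sn _ _))).
Qed.

(** The second moment method for the family of all [primitive_form q] with [q] in
    the lists of [row_list] for the indices [T0 <= t < T1]. *)
Lemma solvable_union_ge (T1 : nat) :
  1 <= \sum_(T0 <= t < T1) (c * 4^-1 ^+ m * \prod_k Phi k t ^+ 2) * w t ->
  moment_constant^-1 <= pr P (\bigcup_(t >= T0) solvable (psi^~ t) (Phi^~ t)).
Proof.
move=> Z1.
have /choice[s sP] : forall t, exists s : seq 'rV[R[i]]_m, (T0 <= t)%N -> [/\ uniq s,
    c * 4^-1 ^+ m * \prod_k Phi k t ^+ 2 <= (size s)%:R &
    forall q, q \in s -> [/\ forall k, q 0 k \is a gint R,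
      forall k, normc (q 0 k) <= Phi k t, Phi k0 t / K < normc (q 0 k0) &
      delta <= unit_density (q 0 k0 : C)]].
  move=> t; have [T0t|tT0] := leqP T0 t; last by exists [::].
  by have [s sP] := row_list (fun k => PhiX k T0t); exists s.
pose I : eqType := (nat * 'rV[R[i]]_m)%type.
pose r : seq I := [seq (t, q) | t <- index_iota T0 T1, q <- s t].
have rP i : i \in r -> (T0 <= i.1)%N /\ i.2 \in s i.1.
  case/allpairsPdep => t [q [+ qs ->]]; rewrite mem_index_iota => /andP[T0t _] //.
pose A (i : I) := primitive_form i.2 (psi^~ i.1).
have K0 : 0 < K by exact: lt_trans K1.
have rZ i : i \in r -> [/\ forall k, i.2 0 k \is a gint R,
   forall k, normc (i.2 0 k) <= Phi k i.1, Phi k0 i.1 / K < normc (i.2 0 k0),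
   delta <= unit_density (i.2 0 k0 : C) & i.2 0 k0 != 0].
  move=> /rP[T0i is_]; have [_ _ /(_ _ is_)[h1 h2 h3 h4]] := sP _ T0i; split => //.
  rewrite -normc_gt0; apply: le_lt_trans h3; rewrite divr_ge0 ?(ltW K0)//.
  exact: le_trans (le_trans ler01 X01) (PhiX k0 T0i).
set U := \bigcup_(t >= T0) _.
have [c400 [c400E c400_ge0 c16]] : exists c400 : R,
    [/\ c400 = 400 ^+ n, 0 <= c400 & 16 ^+ n <= c400].
  exists (400 ^+ n); split; [by []|exact: exprn_ge0 (ler0n _ _)|].
  by apply: lerXn2r; rewrite ?nnegrE ?ler0n// ler_nat.
pose Z := \sum_(i <- r) w i.1.
have Z_ge1 : 1 <= Z.
  apply: (le_trans Z1); rewrite /Z big_allpairs_dep/= big_nat_cond [leRHS]big_nat_cond.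
  apply: ler_sum => t /andP[/andP[T0t _] _].
  rewrite big_const_seq count_predT iter_addr_0 -[leRHS]mulr_natl.
  by rewrite ler_wpM2r//; have [] := sP _ T0t.
have Z_gt0 : 0 < Z by lra.
have dn0 : 0 < delta ^+ n by exact: exprn_gt0.
have EX : delta ^+ n * Z <= \sum_(i <- r) pr P (A i).
  rewrite /Z mulr_sumr big_seq [leRHS]big_seq; apply: ler_sum => i ir.
  have [iZ _ _ di i0] := rZ i ir; have [T0i _] := rP i ir.
  apply: le_trans (pr_primitive_form_ge iZ i0 (fun j => psi4 j T0i)).
  by rewrite ler_wpM2r// lerXn2r// ?nnegrE ?(ltW delta0)// pr_ge0.
have half (x : R) : 0 <= x <= 4^-1 -> 0 <= x <= 2^-1 by lra.
pose assoc (i j : I) := `[< associate i.2 j.2 >].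
have pair i j : i \in r -> j \in r ->
    pr P (A i `&` A j) <= c400 * w i.1 * w j.1 + (assoc i j)%:R * (4 ^+ n * w i.1).
  move=> ir jr; have [iZ _ _ _ i0] := rZ i ir; have [jZ _ _ _ j0] := rZ j jr.
  have [T0i _] := rP i ir; have [T0j _] := rP j jr.
  have psi_i l : 0 <= psi l i.1 <= 2^-1 by exact: half (psi4 l T0i).
  have psi_j l : 0 <= psi l j.1 <= 2^-1 by exact: half (psi4 l T0j).
  have mAA : measurable (A i `&` A j) by apply: measurableI; exact: measurable_primitive_form.
  have rhs0 : 0 <= c400 * w i.1 * w j.1 by exact: mulr_ge0 (mulr_ge0 c400_ge0 (w_ge0 _)) (w_ge0 _).
  have mnear q f : measurable (@near_form R m n q f).
    by apply: measurable_form_event => l; exact: measurable_near_gint.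
  rewrite /assoc; case: asboolP => ij /=.
    rewrite mul1r; apply: (@le_trans _ _ (4 ^+ n * w i.1)); last by rewrite lerDr.
    apply: le_trans (pr_near_form_le iZ i0 psi_i); apply: pr_le => // B [Bi _].
    exact: primitive_sub_near.
  rewrite mul0r addr0.
  have [par|/existsNP[l nl]] := pselect (forall l, i.2 0 k0 * j.2 0 l = i.2 0 l * j.2 0 k0).
    by rewrite c400E; exact: (pr_primitive_form_parallel iZ jZ i0 j0 par).
  apply: (@le_trans _ _ (16 ^+ n * w i.1 * w j.1)); last first.
    by do 2! (apply: ler_wpM2r; first exact: w_ge0).
  apply: le_trans (pr_near_form_independent iZ jZ _ psi_i psi_j); last exact/eqP/nl.
  apply: pr_le => //; first exact: measurableI.
  by move=> B [Bi Bj]; split; exact: primitive_sub_near.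
have ur : uniq r.
  apply: allpairs_uniq_dep; first exact: iota_uniq.
    by move=> t; rewrite mem_index_iota => /andP[T0t _]; have [] := sP _ T0t.
  by move=> [t q] [t' q'] _ _ /= [-> ->].
have assoc9 i : i \in r -> \sum_(j <- r) (assoc i j)%:R <= 9 :> R.
  move=> ir; rewrite -natr_sum ler_nat.
  rewrite (eq_bigr (fun j => if assoc i j then 1 else 0)%N); last by move=> j _; case: (assoc i j).
  rewrite -big_mkcond sum1_count -[X in (_ <= X)%N]/(3 ^ 2)%N.
  rewrite -[X in (_ <= X)%N](size_gbox R 1) -(size_map (fun u => (i.1, u *: i.2) : I)).
  rewrite -size_filter; apply: uniq_leq_size; first exact: filter_uniq.
  move=> j; rewrite mem_filter => /andP[/asboolP[u [uZ u1] ju] jr].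
  apply/mapP; exists u; first by apply: mem_gbox; rewrite ?u1.
  have [iZ iPhi iK _ i0] := rZ i ir; have [jZ jPhi jK _ j0] := rZ j jr.
  have [T0i _] := rP i ir; have [T0j _] := rP j jr.
  have nij : normc (j.2 0 k0) = normc (i.2 0 k0) by rewrite ju mxE Normc.normcM u1 mul1r.
  rewrite -ju; suff <- : j.1 = i.1 by exact: surjective_pairing.
  have := iPhi k0; have := jPhi k0.
  have [tt'|tt'|//] := ltngtP i.1 j.1.
    by have := PhiK_lt T0i tt' => *; exfalso; lra.
  by have := PhiK_lt T0j tt' => *; exfalso; lra.
have EXX : \sum_(i <- r) \sum_(j <- r) pr P (A i `&` A j) <=
    (c400 + 9 * 4 ^+ n) * Z ^+ 2.
  apply: (@le_trans _ _ (\sum_(i <- r) (c400 * Z + 9 * 4 ^+ n) * w i.1)).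
    rewrite big_seq [leRHS]big_seq; apply: ler_sum => i ir.
    apply: (@le_trans _ _ (\sum_(j <- r) (c400 * w i.1 * w j.1 +
        (assoc i j)%:R * (4 ^+ n * w i.1)))).
      by rewrite big_seq [leRHS]big_seq; apply: ler_sum => j jr; exact: pair.
    rewrite big_split/= -mulr_sumr -mulr_suml -/Z.
    have -> : (c400 * Z + 9 * 4 ^+ n) * w i.1 =
      c400 * w i.1 * Z + 9 * (4 ^+ n * w i.1) by ring.
    by rewrite lerD2l ler_wpM2r ?assoc9// mulr_ge0// exprn_ge0.
  rewrite -mulr_sumr -/Z expr2 mulrA ler_wpM2r ?(ltW Z_gt0)//.
  by rewrite [leRHS]mulrDl lerD2l ler_peMr.
apply: (second_moment (r := r) (A := A)).
- by move=> i; exact: measurable_primitive_form.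
- by apply: bigcup_measurable => t _; exact: measurable_solvable.
- move=> i ir B Bi; have [T0i _] := rP i ir; exists i.1 => //.
  have [iZ iPhi _ _ i0] := rZ i ir; exists i.2; split => //.
    by apply: contraNneq i0 => ->; rewrite mxE.
  exact: primitive_sub_near.
- exact: moment_constant_gt0.
- by apply: lt_le_trans EX; exact: mulr_gt0.
apply: (le_trans EXX); rewrite /moment_constant -c400E mulrAC ler_pdivlMr ?exprn_gt0//.
rewrite -mulrA; apply: ler_wpM2l.
  by apply: addr_ge0 => //; exact: (mulr_ge0 (ler0n _ _) (exprn_ge0 _ (ler0n _ _))).
have dZ0 : 0 <= delta ^+ n * Z by rewrite mulr_ge0 ?(ltW dn0) ?(ltW Z_gt0).
rewrite -exprMn mulrC; apply: lerXn2r => //; rewrite nnegrE//.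
exact: le_trans EX.
Qed.

End limsup_lower_bound.

Section full_measure.
Variables (R : realType) (m n : nat).
Notation C := (cplx R).
Notation normc := (@Normc.normc R).
Notation P := (cmx_prob R m n).
Variables (k0 : 'I_m) (delta c K X0 : R).
Hypotheses (delta0 : 0 < delta) (c0 : 0 < c) (K1 : 1 < K) (X01 : 1 <= X0).
Hypothesis annulus : forall X, X0 <= X ->
  exists s : seq C, [/\ uniq s, c * X ^+ 2 <= (size s)%:R & forall q, q \in s ->
   [/\ q \is a gint R, X / K < normc q, normc q <= X & delta <= unit_density q]].

Let mc := moment_constant n delta.

Lemma measurable_lim_sup_set d (T : measurableType d) (F : (set T)^nat) :
  (forall i, measurable (F i)) -> measurable (lim_sup_set F).
Proof.
move=> mF; apply: bigcap_measurable => // i _.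
by apply: bigcup_measurable => j _; exact: mF.
Qed.

(** Every tail of the sequence has probability at least [mc^-1], hence so does
    the limit of the decreasing tails. *)
Lemma solvable_limsup_ge (psi : 'I_n -> nat -> R) (Phi : 'I_m -> nat -> R) (T0 : nat) :
  (forall j t, (T0 <= t)%N -> 0 <= psi j t <= 4^-1) ->
  (forall k t, (T0 <= t)%N -> X0 <= Phi k t) ->
  (forall t, (T0 <= t)%N -> K * Phi k0 t <= Phi k0 t.+1) ->
  (forall T B, exists T1, B <= \sum_(T <= t < T1)
     (\prod_k Phi k t ^+ 2) * \prod_(j < n) psi j t ^+ 2) ->
  mc^-1 <= pr P (lim_sup_set (fun t => solvable (psi^~ t) (Phi^~ t))).
Proof.
move=> psi4 PhiX PhiK div; set F := fun t => _.
have mF t : measurable (F t) by exact: measurable_solvable.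
have mU i : measurable (\bigcup_(k >= i) F k).
  by apply: bigcup_measurable => k _; exact: mF.
have low i : mc^-1 <= pr P (\bigcup_(k >= i) F k).
  pose T := maxn T0 i.
  have T0T t : (T <= t)%N -> (T0 <= t)%N by apply: leq_trans; exact: leq_maxl.
  apply: (@le_trans _ _ (pr P (\bigcup_(k >= T) F k))).
    have [T1 T1P] := div T (c * 4^-1 ^+ m)^-1.
    apply: (@solvable_union_ge R m n k0 delta c K X0 delta0 c0 K1 X01 annulus
      psi Phi T _ _ _ T1).
    - by move=> j t /T0T; exact: psi4.
    - by move=> k t /T0T; exact: PhiX.
    - by move=> t /T0T; exact: PhiK.
    have c4 : 0 < c * 4^-1 ^+ m by rewrite mulr_gt0// exprn_gt0// invr_gt0.
    rewrite (eq_bigr (fun t => c * 4^-1 ^+ m *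
      ((\prod_k Phi k t ^+ 2) * \prod_(j < n) psi j t ^+ 2))); last first.
      by move=> t _; rewrite mulrA.
    by rewrite -mulr_sumr mulrC -ler_pdivrMr// mul1r.
  by apply: pr_le => //; apply: bigcup_subset => t /=; apply: leq_trans; exact: leq_maxr.
have mL : measurable (lim_sup_set F) by exact: measurable_lim_sup_set.
have cvgL : (P (\bigcup_(k >= i) F k) @[i --> \oo] --> P (lim_sup_set F))%E.
  apply: lim_sup_set_cvg => //; apply: (@le_lt_trans _ _ 1%E); last exact: ltry.
  by apply: probability_le1; exact: mU.
rewrite -lee_fin -prE// -(cvg_lim _ cvgL)//.
apply: lime_ge; first by apply/cvg_ex; exists (P (lim_sup_set F)).
by apply: nearW => i; rewrite prE// lee_fin.
Qed.

Let two_gint (r : nat) : (2 ^+ r : R[i]) \is a gint R.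
Proof. by rewrite rpredX// rpred_nat. Qed.

Let two_neq0 (r : nat) : (2 ^+ r : R[i]) != 0.
Proof. by rewrite expf_neq0// pnatr_eq0. Qed.

Let normc2 (r : nat) (z : R[i]) : normc (2 ^+ r * z) = 2 ^+ r * normc z.
Proof.
have -> : 2 ^+ r = Complex (2 ^+ r) 0 :> R[i].
  by rewrite -[RHS]/(real_complex R (2 ^+ r)) rmorphXn/= rmorph_nat.
rewrite Normc.normcM; congr (_ * _).
by rewrite normc_sqrt /sqnorm/= expr0n addr0 sqrtr_sqr ger0_norm// exprn_ge0.
Qed.

Lemma solvable_periodic psi Phi (B : cmx R m n) : gmx B ->
  invariant_by (fun A => A + B) (solvable psi Phi).
Proof.
move=> BZ; have imp B' A : gmx B' -> solvable psi Phi A -> solvable psi Phi (A + B').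
  move=> B'Z [q [q0 qZ Aq qPhi]]; exists q; split => //.
  have per := @form_event_periodic R m n q (fun j => near_gint setT (psi j)) qZ.
  apply/(invariant_byP _ (per _ B' B'Z)) => //.
  by move=> j b; exact: near_gintT_periodic.
apply/seteqP; split => A /=; last exact: imp.
move=> /(@imp (- B)); rewrite addrK; apply => k j.
by rewrite mxE rpredN.
Qed.

Lemma lim_sup_set_invariant T (F : (set T)^nat) (f : T -> T) :
  (forall t, invariant_by f (F t)) -> invariant_by f (lim_sup_set F).
Proof.
move=> Ff; apply/seteqP; split => x /= Lx i _; have [t it Ft] := Lx i Logic.I;
exists t => //; by apply/(invariant_byP _ (Ff t)).
Qed.

(** Let [W r] be the set of matrices approximated infinitely often by rows that
    are multiples of [2 ^ r]. It is the preimage, under the measure preserving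
    map [A |-> 2 ^ r A], of an upper limit to which [solvable_limsup_ge] applies
    with the same constant, and it is invariant under translations by
    [2 ^ - r] times Gaussian matrices. As the [W r] decrease, their
    intersection is invariant under all dyadic translations; it is not null
    because the lower bound does not depend on [r]. *)
Lemma solvable_limsup_full (psi : 'I_n -> nat -> R) (Phi : 'I_m -> nat -> R) (T0 : nat) :
  (forall j t, (T0 <= t)%N -> 0 <= psi j t <= 4^-1) ->
  (forall X, exists T, forall k t, (T <= t)%N -> X <= Phi k t) ->
  (forall t, (T0 <= t)%N -> K * Phi k0 t <= Phi k0 t.+1) ->
  (forall T B, exists T1, B <= \sum_(T <= t < T1)
     (\prod_k Phi k t ^+ 2) * \prod_(j < n) psi j t ^+ 2) ->
  P (lim_sup_set (fun t => solvable (psi^~ t) (Phi^~ t))) = 1%E.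
Proof.
move=> psi4 Phiy PhiK div.
pose Phir (r : nat) k t := Phi k t / 2 ^+ r.
pose F r t : set (cmx R m n) := solvable (psi^~ t) ((Phir r)^~ t).
have mF r t : measurable (F r t) by exact: measurable_solvable.
have mL r : measurable (lim_sup_set (F r)) by exact: measurable_lim_sup_set.
have p2 r : 0 < 2 ^+ r :> R by exact: exprn_gt0.
have lowL r : mc^-1 <= pr P (lim_sup_set (F r)).
  have [T1 T1P] := Phiy (X0 * 2 ^+ r).
  apply: (@solvable_limsup_ge psi (Phir r) (maxn T0 T1)).
  - by move=> j t Tt; apply: psi4; apply: leq_trans Tt; exact: leq_maxl.
  - move=> k t Tt; rewrite /Phir ler_pdivlMr//; apply: T1P.
    by apply: leq_trans Tt; exact: leq_maxr.
  - move=> t Tt; rewrite /Phir mulrA ler_pM2r ?invr_gt0//; apply: PhiK.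
    by apply: leq_trans Tt; exact: leq_maxl.
  move=> T B; have [T2 T2P] := div T (B * (2 ^+ r) ^+ 2 ^+ m).
  exists T2; rewrite -(ler_pM2r (x := (2 ^+ r) ^+ 2 ^+ m)) ?exprn_gt0//.
  apply: (le_trans T2P); rewrite mulr_suml le_eqVlt; apply/orP; left; apply/eqP.
  apply: eq_bigr => t _; rewrite mulrAC; congr (_ * _).
  rewrite -[X in _ * X](_ : \prod_(k < m) (2 ^+ r) ^+ 2 = _); last first.
    by rewrite prodr_const card_ord.
  rewrite -[RHS]big_split/=; apply: eq_bigr => k _.
  by rewrite /Phir -exprMn divfK// gt_eqF.
pose W r : set (cmx R m n) := (fun A => 2 ^+ r *: A) @^-1` lim_sup_set (F r).
have mscale r : measurable_fun setT (fun A : cmx R m n => (2 ^+ r *: A : cmx R m n)).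
  apply/measurable_cmxP => k j; under eq_fun do rewrite mxE.
  by apply: measurable_cplxM => //; exact: measurable_cmx_entry.
have mW r : measurable (W r) by exact: measurable_preimage (mscale r) (mL r).
have Lper r B : gmx B -> invariant_by (fun A => A + B) (lim_sup_set (F r)).
  by move=> BZ; apply: lim_sup_set_invariant => t; exact: solvable_periodic.
have PW r : pr P (W r) = pr P (lim_sup_set (F r)).
  rewrite -[RHS]mulr1 -(pr_setT P).
  rewrite -(@equidistribution _ _ _ _ _ _ _ _ _ _ _ (@cmx_prob_gmx_uniform R m n)
    (@cmx_prob_gmx_uniform R m n) _ (fun A : cmx R m n => 2 ^+ r *: A)
    (fun w : cmx R m n => (2 ^+ r)^-1 *: w)) //.
  - by congr (pr _ _); apply/seteqP; split => // A [].
  - by move=> y z; rewrite addrC.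
  - by move=> w A; rewrite scalerDr scalerA divff ?scale1r.
  - move=> B BZ; exists (2 ^+ r *: B); last by move=> A; rewrite scalerDr.
    by move=> k j; rewrite mxE rpredM.
  - apply/measurable_cmxP => k j; under eq_fun do rewrite !mxE.
    apply: measurable_cplxD; first exact: measurableT_comp (measurable_cmx_entry _ _) measurable_snd.
    apply: measurable_cplxM => //.
    exact: measurableT_comp (measurable_cmx_entry _ _) measurable_fst.
  - exact: Lper.
have scaleF r s t A : solvable (psi^~ t) ((Phir (r + s)%N)^~ t) (2 ^+ (r + s) *: A) ->
    solvable (psi^~ t) ((Phir r)^~ t) (2 ^+ r *: A).
  move=> [q [q0 qZ Aq qPhi]]; exists (2 ^+ s *: q); split.
  - by rewrite scaler_eq0 negb_or two_neq0.
  - by move=> k; rewrite mxE rpredM.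
  - by move=> j; have := Aq j; rewrite exprD mulrC -scalerA -scalemxAr scalemxAl.
  - move=> k; rewrite mxE normc2; have := qPhi k; rewrite /Phir exprD !ler_pdivlMr ?mulr_gt0//.
    by move=> H; rewrite -mulrA [normc _ * _]mulrC mulrA mulrC [_ ^+ s * _]mulrC.
have Wmono r s : W (r + s)%N `<=` W r.
  by move=> A LA i _; have [t it Ft] := LA i Logic.I; exists t => //; exact: scaleF Ft.
pose H := \bigcap_r W r.
have mH : measurable H by apply: bigcap_measurable => // r _; exact: mW.
have lowH : mc^-1 <= pr P H.
  have cvgH : (P (W r) @[r --> \oo] --> P H)%E.
    apply: nonincreasing_cvg_mu => //.
      by apply: (@le_lt_trans _ _ 1%E); [exact: probability_le1|exact: ltry].
    by move=> r s rs; apply/subsetPset; rewrite -(subnKC rs); exact: Wmono.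
  rewrite -lee_fin -prE// -(cvg_lim _ cvgH)//.
  apply: lime_ge; first by apply/cvg_ex; exists (P H).
  by apply: nearW => r; rewrite prE// lee_fin PW.
have mc_gt0 : 0 < mc by exact: moment_constant_gt0.
have Winv r (B A : cmx R m n) : (forall k j, 2 ^+ r * B k j \is a gint R) -> W r A -> W r (A + B).
  move=> BZ; rewrite /W/= scalerDr => WA; apply/(invariant_byP _ (Lper r (2 ^+ r *: B) _)) => //.
  by move=> k j; rewrite mxE.
have Hadd (B A : cmx R m n) : (forall k j, exists r : nat, gaussian (2 ^+ r * B k j)) -> H A -> H (A + B).
  move=> BD HA r _.
  have /choice[f fP] : forall kj : 'I_m * 'I_n, exists s : nat,
      2 ^+ s * B kj.1 kj.2 \is a gint R.
    by move=> [k j]; have [s sP] := BD k j; exists s; exact/gintP.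
  pose s := \max_kj f kj.
  apply: (Wmono r s); apply: Winv; last exact: HA.
  move=> k j; have fs : (f (k, j) <= r + s)%N.
    by rewrite (leq_trans _ (leq_addl r s))// (leq_bigmax (k, j)).
  by rewrite -(subnK fs) exprD -mulrA rpredM// ; exact: fP.
have Hinv (B : cmx R m n) : (forall k j, exists r : nat, gaussian (2 ^+ r * B k j)) ->
    invariant_by (fun A => A + B) H.
  move=> BD; apply/seteqP; split => A /=; last exact: Hadd.
  move=> /(@Hadd (- B)); rewrite addrK; apply => k j; have [r rP] := BD k j.
  by exists r; rewrite mxE mulrN; apply/gintP; rewrite rpredN; exact/gintP.
have PH1 : P H = 1%E.
  have [PH0|//] := @cmx_prob_ergodic R m n H mH Hinv.
  by move: lowH; rewrite /pr PH0 /= leNgt invr_gt0 mc_gt0.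
have mL' : measurable (lim_sup_set (fun t => solvable (psi^~ t) (Phi^~ t))).
  by apply: measurable_lim_sup_set => t; exact: measurable_solvable.
apply/eqP; rewrite eq_le probability_le1//= -PH1; apply: le_measure; rewrite ?inE//.
move=> A /(_ 0 Logic.I); rewrite /W/= expr0 scale1r => LA i _.
have [t it Ft] := LA i Logic.I; exists t => //.
by move: Ft; congr (solvable _ _ A); apply/funext => k; rewrite /Phir expr0 divr1.
Qed.

End full_measure.

Section approximation_sets.
Variables (R : realType) (m n : nat).
Notation C := (cplx R).
Notation normc := (@Normc.normc R).
Notation P := (cmx_prob R m n).

(** The union bound over the box of all admissible rows [q]. *)
Lemma pr_solvable_le (psi : 'I_n -> R) (Phi : 'I_m -> R) :
  (forall j, 0 <= psi j <= 2^-1) -> (forall k, 1 <= Phi k) ->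
  pr P (solvable psi Phi) <=
  25 ^+ m * 4 ^+ n * ((\prod_k Phi k ^+ 2) * \prod_(j < n) psi j ^+ 2).
Proof.
move=> psi2 Phi1; pose N k := (Num.truncn (Phi k)).+1.
have [|s [us sizes sP]] := @row_product C m 0 (fun k => gbox R (N k)).
  by move=> k; exact: gbox_uniq.
set w := \prod_(j < n) _; have w0 : 0 <= w by apply: prodr_ge0 => j _; exact: sqr_ge0.
have p4 : 0 <= 4 ^+ n :> R by exact: exprn_ge0 (ler0n _ _).
pose B (q : 'rV[R[i]]_m) : set (cmx R m n) :=
  if (q != 0) && [forall k, q 0 k \is a gint R] then near_form q psi else set0.
have mB q : measurable (B q).
  rewrite /B; case: ifP => // _; apply: measurable_form_event => j.
  exact: measurable_near_gint.
apply: (@le_trans _ _ (\sum_(q <- s) pr P (B q))).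
  apply: pr_union_le => //; first exact: measurable_solvable.
  move=> A [q [q0 qZ Aq qPhi]]; exists q; last first.
    by rewrite /B q0/=; case: ifP => // /negP[]; apply/forallP.
  apply/sP => k; apply: mem_gbox => //; apply: (le_trans (qPhi k)).
  by apply: ltW; exact: truncnS_gt.
apply: (@le_trans _ _ (\sum_(q <- s) 4 ^+ n * w)).
  apply: ler_sum => q _; rewrite /B; case: ifP => [/andP[q0 /forallP qZ]|_].
    have [k qk] : exists k, q 0 k != 0.
      apply/not_existsP => q00; move/eqP: q0; apply; apply/rowP => k; rewrite mxE.
      by have := q00 k; case: eqVneq => // _ /(_ isT).
    exact: (pr_near_form_le qZ qk psi2).
  by rewrite /pr measure0/=; exact: mulr_ge0.
rewrite big_const_seq count_predT iter_addr_0 -[leLHS]mulr_natl.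
have E (x y z u : R) : x * y * (z * u) = x * z * (y * u) by ring.
rewrite E.
apply: ler_wpM2r; first exact: mulr_ge0.
rewrite sizes natr_prod.
have -> : 25 ^+ m = \prod_(k < m) (25 : R) by rewrite prodr_const card_ord.
rewrite -[leRHS](big_split _ _ _ (fun=> 25) (fun k => Phi k ^+ 2)).
apply: ler_prod => k _; apply/andP; split; first exact: ler0n.
rewrite size_gbox natrX natr_doubleS.
have Phi0 : 0 <= Phi k by exact: le_trans ler01 (Phi1 k).
have N2 : (N k)%:R <= Phi k + 1.
  by rewrite /N -[leLHS]natr1 lerD2r; have /andP[] := truncn_itv Phi0.
have N0 := ler0n R (N k); have P1 := Phi1 k.
by rewrite -[leRHS]/(25 * Phi k ^+ 2) !expr2; nra.
Qed.

Lemma infinite_nat_frequently (A : set nat) :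
  infinite_set A <-> forall N, exists2 u, (N <= u)%N & A u.
Proof.
split=> [infA N|freq /finite_seqP[X AX]].
  apply: contrapT => noA; apply: infA; apply: (sub_finite_set _ (finite_II N)) => u Au.
  by rewrite /= ltnNge; apply/negP => Nu; apply: noA; exists u.
have [u Xu] := freq (\sum_(x <- X) x).+1; rewrite AX => /= uX.
by move: Xu; rewrite (big_rem u)//= ltnNge leq_addr.
Qed.

Lemma gaussian_dist_near (q : 'rV[R[i]]_m) (A : 'M[R[i]]_(m, n)) j r :
  gaussian_dist ((q *m col j A) 0 0) < r <-> near_gint setT r ((q *m A) 0 j).
Proof.
have -> : (q *m col j A) 0 0 = (q *m A) 0 j.
  by rewrite !mxE; apply: eq_bigr => k _; rewrite mxE.
have [[p pZ pE] dmin] := gaussian_dist_min ((q *m A) 0 j).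
split=> [|[p' [/gintP p'Z _]]]; last by apply: le_lt_trans; exact: dmin.
by rewrite pE => pr; exists p; split => //; exact/gintP.
Qed.

Lemma W_CE (phi : 'I_n -> nat -> R) (Phi : 'I_m -> nat -> R) :
  W_C phi Phi = @I_Cmx R m n `&` lim_sup_set (fun u => solvable (phi^~ u) (Phi^~ u)).
Proof.
have solvE A u : (exists q : 'rV[R[i]]_m, [/\ q != 0, forall k, gaussian_int (q 0 k),
    forall j, gaussian_dist ((q *m col j A) 0 0) < phi j u &
    forall k, normc (q 0 k) <= Phi k u]) <-> solvable (phi^~ u) (Phi^~ u) A.
  split=> -[q [q0 qZ qA qPhi]]; exists q; split => //.
  - by move=> k; exact/gintP.
  - by move=> j; apply/gaussian_dist_near; exact: qA.
  - by move=> k; exact/gintP.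
  - by move=> j; apply/gaussian_dist_near; exact: qA.
apply/seteqP; split => A [IA].
  move=> /infinite_nat_frequently WA; split => // i _.
  by have [u iu [_ /solvE Au]] := WA i; exists u.
move=> LA; split => //; apply/infinite_nat_frequently => N.
have [u /= Nu Au] := LA (maxn 1 N) Logic.I.
by exists u; [exact: leq_trans (leq_maxr _ _) Nu|split; [exact: leq_trans (leq_maxl _ _) Nu|exact/solvE]].
Qed.

Lemma measurable_I_Cmx : measurable (@I_Cmx R m n : set (cmx R m n)).
Proof.
pose D : set C := (fun z : C => complex.Re z) @^-1` `[- 2^-1, 2^-1] `&`
    (fun z : C => complex.Im z) @^-1` `[- 2^-1, 2^-1].
have mD : measurable D.
  have /measurable_cplxP[mr mi] := @measurable_id _ C setT.
  by apply: measurableI; apply: measurable_preimage.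
rewrite (_ : @I_Cmx R m n = \bigcap_(kj in [set: 'I_m * 'I_n])
   ((fun A : cmx R m n => A kj.1 kj.2 : C) @^-1` D)).
  apply: fin_bigcap_measurable; first exact: finite_finset.
  by move=> kj _; apply: (measurable_preimage (@measurable_cmx_entry _ _ _ _ _)).
apply/seteqP; split => A AI; first by move=> [k j] _; have := AI k j; rewrite /D/= !in_itv/=.
by move=> k j; have := AI (k, j) Logic.I; rewrite /D/= !in_itv/=.
Qed.

Lemma cmx_prob_I_Cmx : P (@I_Cmx R m n) = 1%E.
Proof.
rewrite -lebesgue_CmxE//; last exact: measurable_I_Cmx.
pose X (k : 'I_m) (j : 'I_n) : set (measurableTypeR R) := `[- 2^-1, 2^-1]%classic.
have := @lebesgue_Cmx_box R m n X X (fun _ _ => measurable_itv _) (fun _ _ => measurable_itv _).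
rewrite (_ : [set A | _] = @I_Cmx R m n); last first.
  by apply/seteqP; split => A AI k j; have := AI k j; rewrite /X/= !in_itv/=.
move=> ->; apply: big1 => k _; apply: big1 => j _.
rewrite [X in (X * X)%E](_ : _ = 1%E) ?mule1// lebesgue_measure_itv/= lte_fin ifT; last by lra.
by rewrite -EFinD; congr EFin; lra.
Qed.

(** The restriction to [I_Cmx] costs nothing, as [P] is carried by it. *)
Lemma lebesgue_Cmx_W_C (phi : 'I_n -> nat -> R) (Phi : 'I_m -> nat -> R) :
  lebesgue_Cmx (W_C phi Phi) =
  P (lim_sup_set (fun u => solvable (phi^~ u) (Phi^~ u))).
Proof.
set L := lim_sup_set _.
have mL : measurable L by apply: measurable_lim_sup_set => u; exact: measurable_solvable.
have mI := measurable_I_Cmx.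
rewrite W_CE lebesgue_CmxE; [|exact: measurableI|exact: subIsetl].
have PI : P (~` @I_Cmx R m n) = 0%E by rewrite probability_setC// cmx_prob_I_Cmx subee.
apply/eqP; rewrite eq_le; apply/andP; split.
  by apply: le_measure; rewrite ?inE//; exact: measurableI.
have mIC : measurable (L `&` ~` @I_Cmx R m n) by apply: measurableI => //; exact: measurableC.
pose I : set (cmx R m n) := @I_Cmx R m n.
have mIL : measurable (I `&` L) by exact: measurableI.
have LE : L = (I `&` L) `|` (L `&` ~` I).
  by rewrite [I `&` L]setIC -setIUr setUv setIT.
rewrite [in leLHS]LE; apply: (le_trans (measureU2 P mIL mIC)).
rewrite -[leRHS]adde0 leeD2l// -PI; apply: le_measure; rewrite ?inE//.
exact: measurableC.
Qed.

End approximation_sets.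

(** * Geometric blocks of the series *)

Section series_blocks.
Variables (R : realType) (m n : nat).
Variables (phi : 'I_n -> nat -> R) (Phi : 'I_m -> nat -> R).
Hypotheses (phi_gt0 : forall j u, (1 <= u)%N -> 0 < phi j u)
  (phi_noninc : forall j u v, (1 <= u)%N -> (u <= v)%N -> phi j v <= phi j u)
  (Phi_gt0 : forall k u, (1 <= u)%N -> 0 < Phi k u)
  (Phi_nondec : forall k u v, (1 <= u)%N -> (u <= v)%N -> Phi k u <= Phi k v).

Lemma solvable_sub (psi psi' : 'I_n -> R) (Q Q' : 'I_m -> R) :
  (forall j, psi j <= psi' j) -> (forall k, Q k <= Q' k) ->
  solvable psi Q `<=` solvable psi' Q'.
Proof.
move=> psile Qle A [q [q0 qZ Aq qQ]]; exists q; split => //.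
  move=> j; have [p [pZ pT pA]] := Aq j; exists p; split => //.
  exact: lt_le_trans pA _.
by move=> k; exact: le_trans (qQ k) _.
Qed.

Lemma big_nat_blocks (f : nat -> R) (g : nat -> nat) s t : {homo g : i j / (i <= j)%N} ->
  (s <= t)%N -> \sum_(s <= i < t) \sum_(g i <= q < g i.+1) f q = \sum_(g s <= q < g t) f q.
Proof.
move=> gmono; elim: t => [|t IH] st.
  by move: st; rewrite leqn0 => /eqP ->; rewrite !big_geq.
move: st; rewrite leq_eqVlt => /orP[/eqP ->|]; first by rewrite !big_geq.
rewrite ltnS => st; rewrite big_nat_recr//= IH//.
by rewrite -big_cat_nat//; exact: gmono.
Qed.

Definition term q : R := q%:R^-1 * ((\prod_(j < n) phi j q) * (\prod_(k < m) Phi k q)) ^+ 2.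

Lemma term_ge0 q : 0 <= term q.
Proof. by rewrite /term mulr_ge0 ?sqr_ge0// invr_ge0. Qed.

Variables (M : nat) (M_ge2 : (2 <= M)%N).

Definition volume q : R := (\prod_k Phi k q ^+ 2) * \prod_(j < n) phi j q ^+ 2.

Lemma volume_ge0 q : 0 <= volume q.
Proof. by rewrite mulr_ge0//; apply: prodr_ge0 => i _; exact: sqr_ge0. Qed.

Lemma termE q : term q = q%:R^-1 * volume q.
Proof. by rewrite /term /volume !prodrXl -exprMn [_ * \prod_k _]mulrC. Qed.

Let Mt_gt0 t : (0 < M ^ t)%N.
Proof. by rewrite expn_gt0 (leq_trans _ M_ge2). Qed.

Let Mt_gt0R t : 0 < (M ^ t)%:R :> R.
Proof. by rewrite ltr0n. Qed.

Lemma Mexp_mono : {homo (fun t => M ^ t)%N : i j / (i <= j)%N}.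
Proof. by move=> i j ij; rewrite leq_pexp2l// (leq_trans _ M_ge2). Qed.

Variables (c2 : R) (N0 : nat).
Hypothesis c2_gt0 : 0 < c2.
Hypothesis Phi_le : forall i, (N0 <= i)%N -> forall k,
  Phi k (M ^ i.+1)%N <= c2 * Phi k (M ^ i)%N.

Let D := (c2 ^+ 2) ^+ m.

Lemma growth_constant_gt0 : 0 < D.
Proof. by rewrite !exprn_gt0. Qed.

Let volume_le u v : (1 <= u)%N -> (1 <= v)%N -> (forall j, phi j u <= phi j v) ->
  (forall k, Phi k u <= c2 * Phi k v) -> volume u <= D * volume v.
Proof.
move=> u1 v1 phi_le Phi_le'; rewrite /volume mulrA; apply: ler_pM.
- by apply: prodr_ge0 => k _; exact: sqr_ge0.
- by apply: prodr_ge0 => k _; exact: sqr_ge0.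
- have -> : D = \prod_(k < m) c2 ^+ 2 by rewrite prodr_const card_ord.
  rewrite -[leRHS](big_split _ _ _ (fun=> c2 ^+ 2) (fun k => Phi k v ^+ 2)).
  apply: ler_prod => k _; rewrite sqr_ge0/= -[leRHS]/(c2 ^+ 2 * Phi k v ^+ 2) -exprMn.
  by rewrite lerXn2r// nnegrE ?mulr_ge0// ltW// Phi_gt0.
- apply: ler_prod => j _; rewrite sqr_ge0/=.
  by rewrite lerXn2r// nnegrE ltW// phi_gt0.
Qed.

Let in_block t q : (N0 <= t)%N -> (M ^ t <= q < M ^ t.+1)%N ->
  [/\ (1 <= q)%N, volume q <= D * volume (M ^ t)%N & volume (M ^ t.+1)%N <= D * volume q].
Proof.
move=> N0t /andP[tq qt]; have q1 : (1 <= q)%N by exact: leq_trans (Mt_gt0 t) tq.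
split => //; apply: volume_le => //.
- by move=> j; exact: phi_noninc.
- by move=> k; apply: le_trans (Phi_le N0t k); apply: Phi_nondec => //; exact: ltnW.
- by move=> j; apply: phi_noninc => //; exact: ltnW.
- move=> k; apply: le_trans (Phi_le N0t k) _.
  by rewrite ler_wpM2l ?(ltW c2_gt0)// Phi_nondec.
Qed.

(** On the block [M ^ t <= q < M ^ t.+1] the values of [volume], and the one at
    [M ^ t.+1], agree up to the factor [D], as [phi] decreases and [Phi] grows by
    at most [c2]. The weights [1 / q] add up to at least 1/2, since [M >= 2], and
    to at most [M]. *)
Lemma volume_le_block t : (N0 <= t)%N ->
  volume (M ^ t.+1)%N <= 2 * D * \sum_(M ^ t <= q < M ^ t.+1) term q.
Proof.
move=> N0t; have D0 := growth_constant_gt0.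
set V := volume _; have V0 : 0 <= V by exact: volume_ge0.
have H : \sum_(M ^ t <= q < M ^ t.+1) ((M ^ t.+1)%:R^-1 * (V / D)) <=
    \sum_(M ^ t <= q < M ^ t.+1) term q.
  rewrite big_nat_cond [leRHS]big_nat_cond; apply: ler_sum => q /andP[tq _].
  have [q1 _ Vq] := in_block N0t tq.
  rewrite termE; apply: ler_pM.
  - by rewrite invr_ge0.
  - by rewrite divr_ge0 ?(ltW D0).
  - by rewrite lef_pV2 ?posrE ?ltr0n// ler_nat ltnW//; case/andP: tq.
  - by rewrite ler_pdivrMr// mulrC.
apply: (@le_trans _ _ (2 * D * \sum_(M ^ t <= q < M ^ t.+1) ((M ^ t.+1)%:R^-1 * (V / D)))); last first.
  by rewrite ler_wpM2l// mulr_ge0// ltW.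
have constE (c : R) : \sum_(M ^ t <= q < M ^ t.+1) c = ((M ^ t.+1)%:R - (M ^ t)%:R) * c.
  by rewrite big_const_nat iter_addr_0 -[LHS]mulr_natl natrB//; exact: Mexp_mono.
rewrite constE.
have half : 2 * (M ^ t)%:R <= (M ^ t.+1)%:R :> R.
  by rewrite -natrM ler_nat expnS leq_mul2r M_ge2 orbT.
set x := (M ^ t.+1)%:R in half *; set y := (M ^ t)%:R in half *.
have x0 : 0 < x by exact: Mt_gt0R.
have -> : 2 * D * ((x - y) * (x^-1 * (V / D))) = V * ((2 * x - 2 * y) / x).
  by field; rewrite !gt_eqF.
by rewrite ler_peMr// ler_pdivlMr// mul1r; lra.
Qed.

Lemma block_le_volume t : (N0 <= t)%N ->
  \sum_(M ^ t <= q < M ^ t.+1) term q <= M%:R * D * volume (M ^ t)%N.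
Proof.
move=> N0t; have D0 := growth_constant_gt0.
set V := volume _; have V0 : 0 <= V by exact: volume_ge0.
apply: (@le_trans _ _ (\sum_(M ^ t <= q < M ^ t.+1) ((M ^ t)%:R^-1 * (D * V)))).
  rewrite big_nat_cond [leRHS]big_nat_cond; apply: ler_sum => q /andP[tq _].
  have [q1 Vq _] := in_block N0t tq.
  rewrite termE; apply: ler_pM => //; first exact: volume_ge0.
  by rewrite lef_pV2 ?posrE ?ltr0n// ler_nat; case/andP: tq.
rewrite big_const_nat iter_addr_0 -[leLHS]mulr_natl mulrA -[leRHS]mulrA.
apply: ler_wpM2r; first by rewrite mulr_ge0// ltW.
by rewrite ler_pdivrMr// -natrM -expnS ler_nat leq_subr.
Qed.

Lemma terms_blocks s t : (s <= t)%N ->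
  \sum_(s <= i < t) \sum_(M ^ i <= q < M ^ i.+1) term q = \sum_(M ^ s <= q < M ^ t) term q.
Proof. by move=> st; rewrite (big_nat_blocks term Mexp_mono). Qed.

Lemma le_sum_terms a b b' : (1 <= a)%N -> (b <= b')%N ->
  \sum_(a <= q < b) term q <= \sum_(1 <= q < b') term q.
Proof.
move=> a1 bb'; have [ab|ba] := leqP a b; last first.
  by rewrite big_geq ?(ltnW ba)// sumr_ge0// => q _; exact: term_ge0.
rewrite (big_cat_nat (leq_trans a1 ab) bb')/= (big_cat_nat a1 ab)/= addrAC lerDr.
by rewrite addr_ge0//; apply: sumr_ge0 => q _; exact: term_ge0.
Qed.

End series_blocks.

(** * The zero-one law *)

Lemma eventually_all (I : finType) (Q : I -> nat -> Prop) :
  (forall i, exists T, forall t, (T <= t)%N -> Q i t) ->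
  exists T, forall i t, (T <= t)%N -> Q i t.
Proof.
move=> /choice[T TP]; exists (\max_i T i) => i t Tt; apply: TP.
by rewrite (leq_trans _ Tt)// (leq_bigmax i).
Qed.

Section zero_one_law.
Variables (R : realType) (m n : nat).
Notation P := (cmx_prob R m n).
Variables (phi : 'I_n -> nat -> R) (Phi : 'I_m -> nat -> R).
Hypotheses (phi_gt0 : forall j u, (1 <= u)%N -> 0 < phi j u)
  (phi_noninc : forall j u v, (1 <= u)%N -> (u <= v)%N -> phi j v <= phi j u)
  (phi_cvg0 : forall j, phi j u @[u --> \oo] --> 0)
  (Phi_gt0 : forall k u, (1 <= u)%N -> 0 < Phi k u)
  (Phi_nondec : forall k u v, (1 <= u)%N -> (u <= v)%N -> Phi k u <= Phi k v)
  (Phi_cvgy : forall k, Phi k u @[u --> \oo] --> +oo).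
Variables (N0 M : nat) (M_ge2 : (2 <= M)%N) (c1 c2 : R) (c1_gt1 : 1 < c1) (c2_gt1 : 1 < c2).
Hypothesis Phi_growth : forall i, (N0 <= i)%N -> forall k,
  c1 * Phi k (M ^ i)%N <= Phi k (M ^ i.+1)%N <= c2 * Phi k (M ^ i)%N.

Let L := lim_sup_set (fun u => solvable (phi^~ u) (Phi^~ u) : set (cmx R m n)).

Let mL : measurable L.
Proof. by apply: measurable_lim_sup_set => u; exact: measurable_solvable. Qed.

Lemma phi_small (e : R) : 0 < e ->
  exists T, forall j t, (T <= t)%N -> 0 <= phi j t.+1 <= e.
Proof.
move=> e0; apply: eventually_all => j.
have /cvgrPdist_lt/(_ e e0)[T _ TP] := phi_cvg0 j.
exists T => t Tt; rewrite ltW ?phi_gt0//=.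
have := TP t.+1; rewrite /= sub0r normrN => /(_ (leqW Tt)).
by rewrite gtr0_norm ?phi_gt0// => /ltW.
Qed.

Lemma Phi_large (X : R) : exists T, forall k t, (T <= t)%N -> X <= Phi k t.
Proof.
apply: eventually_all => k.
have /cvgryPge/(_ X)[T _ TP] := Phi_cvgy k.
by exists T => t Tt; exact: TP.
Qed.

(** An index [u] of the block [M ^ l <= u < M ^ l.+1] has [phi u <= phi (M ^ l)]
    and [Phi u <= Phi (M ^ l.+1)], so the events with these two bounds, one for
    each [l], cover the upper limit; Borel-Cantelli applies to them. *)
Lemma limsup_null :
  (\sum_(1 <= q <oo) (term phi Phi q)%:E < +oo)%E -> P L = 0%E.
Proof.
set S := (X in (X < _)%E) => Soo.
have S0 : (0 <= S)%E by apply: nneseries_ge0 => q _ _; rewrite lee_fin term_ge0.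
have Sfin : S \is a fin_num by rewrite ge0_fin_numE.
have c2_gt0 : 0 < c2 by exact: lt_trans ltr01 c2_gt1.
have Phi_le i : (N0 <= i)%N -> forall k, Phi k (M ^ i.+1)%N <= c2 * Phi k (M ^ i)%N.
  by move=> N0i k; have /andP[] := Phi_growth N0i k.
have [T1 T1P] := @phi_small 2^-1 ltac:(by rewrite invr_gt0).
have [T2 T2P] := Phi_large 1.
pose T := maxn N0 (maxn T1 T2).+1.
have M1 t : (t < M ^ t)%N by exact: ltn_expl.
pose F t : set (cmx R m n) :=
  solvable (phi^~ (M ^ (t + T).+1)%N) (Phi^~ (M ^ (t + T).+2)%N).
have mF t : measurable (F t) by exact: measurable_solvable.
have M0 a : (0 < M ^ a)%N by rewrite expn_gt0 (ltnW M_ge2).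
have LF : L `<=` lim_sup_set F.
  move=> A LA i _; have [u /= iu Au] := LA (M ^ (i + T).+1)%N Logic.I.
  have u0 : (0 < u)%N by exact: leq_ltn_trans (leq0n _) (leq_trans (M1 _) iu).
  have /andP[lu ul] := trunc_log_bounds M_ge2 u0.
  set l := trunc_log M u in lu ul.
  have il : (i + T < l)%N.
    by rewrite -ltnS -(ltn_exp2l _ _ M_ge2) (leq_ltn_trans iu).
  have Tl : (T.+1 <= l)%N by apply: leq_trans il; rewrite ltnS leq_addl.
  exists (l - T.+1)%N; first by rewrite /= leq_subRL// addnC addnS.
  have -> : F (l - T.+1)%N = solvable (phi^~ (M ^ l)%N) (Phi^~ (M ^ l.+1)%N).
    by rewrite /F -addnS subnK.
  apply: solvable_sub Au; first by move=> j; exact: phi_noninc.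
  by move=> k; apply: Phi_nondec => //; exact: ltnW.
pose D := (c2 ^+ 2) ^+ m.
pose B : R := 25 ^+ m * 4 ^+ n.
have B0 : 0 <= B by exact: mulr_ge0 (exprn_ge0 _ (ler0n _ _)) (exprn_ge0 _ (ler0n _ _)).
have D0 : 0 < D by rewrite !exprn_gt0.
pose C := B * (D * (2 * D)).
have C0 : 0 <= C by rewrite mulr_ge0// !mulr_ge0// ltW.
pose b t := \sum_(M ^ t <= q < M ^ t.+1) term phi Phi q.
have Fb t : pr P (F t) <= C * b (t + T)%N.
  set a := (t + T)%N.
  have Ta : (T <= a)%N by exact: leq_addl.
  have N0a : (N0 <= a)%N by exact: leq_trans (leq_maxl _ _) Ta.
  have T12 : (maxn T1 T2 < M ^ a.+1)%N.
    apply: (leq_ltn_trans _ (M1 _)); apply: leqW; apply: leq_trans Ta.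
    by apply: leq_trans (leq_maxr _ _); exact: leqnSn.
  apply: (le_trans (@pr_solvable_le R m n _ _ _ _)).
  - move=> j; rewrite -(prednK (M0 a.+1)); apply: T1P; rewrite -ltnS prednK//.
    exact: leq_ltn_trans (leq_maxl _ _) T12.
  - move=> k; apply: T2P; apply: leq_trans (leq_maxr T1 T2) _.
    by rewrite (leq_trans (ltnW T12))// leq_exp2l.
  - rewrite -/B -[leRHS]mulrA; apply: ler_wpM2l => //.
    apply: (@le_trans _ _ (D * volume phi Phi (M ^ a.+1)%N)); last first.
      rewrite -[leRHS]mulrA; apply: ler_wpM2l; first exact: ltW.
      exact: (volume_le_block phi_gt0 phi_noninc Phi_gt0 Phi_nondec M_ge2 c2_gt0 Phi_le N0a).
    rewrite /volume mulrA; apply: ler_wpM2r; first by apply: prodr_ge0 => j _; exact: sqr_ge0.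
    have -> : D = \prod_(k < m) c2 ^+ 2 by rewrite prodr_const card_ord.
    rewrite -[leRHS](big_split _ _ _ (fun=> c2 ^+ 2) (fun k => Phi k _ ^+ 2)).
    apply: ler_prod => k _; rewrite sqr_ge0/= -[leRHS]/(c2 ^+ 2 * Phi k _ ^+ 2) -exprMn.
    have Phi0 v : 0 <= Phi k (M ^ v)%N by rewrite ltW ?Phi_gt0.
    rewrite lerXn2r ?nnegrE//; first by apply: mulr_ge0 => //; exact: ltW.
    by apply: Phi_le; exact: leqW.
have sumb l : \sum_(0 <= t < l) b (t + T)%N <= fine S.
  have -> : \sum_(0 <= t < l) b (t + T)%N = \sum_(T <= t < l + T) b t.
    by have := big_addn 0 (l + T) T xpredT b; rewrite addnK add0n => ->.
  rewrite terms_blocks ?leq_addl//.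
  apply: (le_trans (le_sum_terms _ _ (M0 T) (leqnn _))).
  rewrite -lee_fin fineK// -sumEFin; apply: nneseries_lim_ge => q _ _.
  by rewrite lee_fin term_ge0.
have PF : P (lim_sup_set F) = 0%E.
  apply: lim_sup_set_cvg0 => //.
  apply: (@le_lt_trans _ _ (C * fine S)%:E); last exact: ltry.
  apply: lime_le; first by apply: is_cvg_ereal_nneg_natsum => t _; exact: measure_ge0.
  apply: nearW => l; rewrite (eq_bigr (fun t => (pr P (F t))%:E)).
    rewrite sumEFin lee_fin; apply: (le_trans _ (ler_wpM2l C0 (sumb l))).
    by rewrite mulr_sumr; apply: ler_sum => t _; exact: Fb.
  by move=> t _; rewrite -prE.
apply/eqP; rewrite eq_le measure_ge0 andbT -PF; apply: le_measure; rewrite ?inE//.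
by apply: measurable_lim_sup_set.
Qed.

Lemma exprn_unbounded (x K : R) : 1 < x -> exists s, K <= x ^+ s.
Proof.
move=> x1; have x0 : 0 < x - 1 by rewrite subr_gt0.
exists (Num.truncn (K / (x - 1))).+1; set s := _.+1.
apply: (@le_trans _ _ (s%:R * (x - 1))).
  by rewrite -ler_pdivrMr// ltW// truncnS_gt.
elim: s => [|s IH]; first by rewrite mul0r expr0 ler01.
rewrite exprS -addn1 natrD mulrDl mul1r.
have : 1 <= x ^+ s by rewrite exprn_ege1// ltW.
by nra.
Qed.

(** The subsequence [u = M' ^ t] already gives full measure. Here [M'] is a power
    of [M] such that [Phi] grows at least by the factor [K] between consecutive
    terms, which separates the annuli of [unit_density_annulus]. *)
Lemma limsup_full : (0 < m)%N ->
  (\sum_(1 <= q <oo) (term phi Phi q)%:E = +oo)%E -> P L = 1%E.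
Proof.
move=> m_gt0 Soo; pose k0 := Ordinal m_gt0.
have [delta [c [K [X0 [delta0 c0 K1 X01 annulus]]]]] := unit_density_annulus R.
have [s' s'K] := exprn_unbounded K c1_gt1; pose s := s'.+1.
have c1_gt0 : 0 < c1 by exact: lt_trans ltr01 c1_gt1.
have c2_gt0 : 0 < c2 by exact: lt_trans ltr01 c2_gt1.
have sK : K <= c1 ^+ s.
  by apply: le_trans s'K _; rewrite exprS ler_peMl ?exprn_ge0 ?ltW.
pose M' := (M ^ s)%N.
have M'_ge2 : (2 <= M')%N by rewrite (leq_trans M_ge2)// -{1}[M]expn1 leq_exp2l.
have M'0 t : (0 < M' ^ t)%N by rewrite expn_gt0 (ltnW M'_ge2).
have M't t : (t < M' ^ t)%N by exact: ltn_expl.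
have growth a r k : (N0 <= a)%N ->
    c1 ^+ r * Phi k (M ^ a)%N <= Phi k (M ^ (a + r))%N <= c2 ^+ r * Phi k (M ^ a)%N.
  move=> N0a; elim: r => [|r /andP[IH1 IH2]]; first by rewrite addn0 !expr0 !mul1r lexx.
  have /andP[G1 G2] := Phi_growth (leq_trans N0a (leq_addr r a)) k.
  rewrite addnS !exprS -!mulrA (le_trans _ G1) ?ler_wpM2l ?(ltW c1_gt0)//=.
  by rewrite (le_trans G2)// ler_wpM2l ?(ltW c2_gt0).
have growth' i k : (N0 <= i)%N ->
    c1 ^+ s * Phi k (M' ^ i)%N <= Phi k (M' ^ i.+1)%N <= c2 ^+ s * Phi k (M' ^ i)%N.
  move=> N0i; rewrite -!expnM mulnSr; apply: growth.
  by rewrite (leq_trans N0i)// leq_pmull.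
have Phi_le i : (N0 <= i)%N -> forall k,
    Phi k (M' ^ i.+1)%N <= c2 ^+ s * Phi k (M' ^ i)%N.
  by move=> N0i k; have /andP[] := growth' i k N0i.
have [T1 T1P] := @phi_small 4^-1 ltac:(by rewrite invr_gt0).
pose T0 := maxn N0 T1.
have large A : exists N, A <= \sum_(1 <= q < N) term phi Phi q.
  apply: contrapT => noN.
  suff : (+oo <= A%:E :> \bar R)%E by rewrite leNgt ltry.
  rewrite -Soo; apply: lime_le.
    by apply: is_cvg_ereal_nneg_natsum => q _; rewrite lee_fin term_ge0.
  apply: nearW => N; rewrite sumEFin lee_fin leNgt; apply/negP => AN.
  by apply: noN; exists N; exact: ltW.
have full : P (lim_sup_set (fun t => solvable (fun j => phi j (M' ^ t)%N)
    (fun k => Phi k (M' ^ t)%N))) = 1%E.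
  apply: (@solvable_limsup_full R m n k0 delta c K X0 delta0 c0 K1 X01 annulus
    (fun j t => phi j (M' ^ t)%N) (fun k t => Phi k (M' ^ t)%N) T0).
  - move=> j t T0t; rewrite -(prednK (M'0 t)); apply: T1P; rewrite -ltnS prednK//.
    exact: leq_ltn_trans (leq_trans (leq_maxr _ _) T0t) (M't t).
  - move=> X; have [T TP] := Phi_large X; exists T => k t Tt.
    by apply: TP; exact: leq_trans Tt (ltnW (M't t)).
  - move=> t T0t; have /andP[+ _] := growth' t k0 (leq_trans (leq_maxl _ _) T0t).
    by apply: le_trans; rewrite ler_wpM2r// ltW// Phi_gt0.
  - move=> T B; pose T' := maxn T N0.
    pose C := M'%:R * ((c2 ^+ s) ^+ 2) ^+ m.
    have C0 : 0 < C by rewrite mulr_gt0 ?ltr0n ?(ltnW M'_ge2)// !exprn_gt0.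
    have [N NP] := large (C * B + \sum_(1 <= q < M' ^ T') term phi Phi q).
    pose T1' := maxn N T'; exists T1'.
    have T'T : (T' <= T1')%N by exact: leq_maxr.
    have TT : (T <= T')%N by exact: leq_maxl.
    rewrite -(ler_pM2l C0).
    have NT : (N <= M' ^ T1')%N by rewrite (leq_trans (leq_maxl N T'))// ltnW.
    have M'TT : (M' ^ T' <= M' ^ T1')%N by rewrite leq_exp2l.
    have : C * B <= \sum_(M' ^ T' <= q < M' ^ T1') term phi Phi q.
      rewrite -(lerD2r (\sum_(1 <= q < M' ^ T') term phi Phi q)) (le_trans NP)//.
      rewrite addrC -big_cat_nat//; exact: le_sum_terms.
    move=> /le_trans; apply; rewrite -terms_blocks//.
    apply: (@le_trans _ _ (\sum_(T' <= t < T1') C * volume phi Phi (M' ^ t)%N)).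
      rewrite big_nat_cond [leRHS]big_nat_cond; apply: ler_sum => t /andP[/andP[T't _] _].
      apply: (block_le_volume phi_gt0 phi_noninc Phi_gt0 Phi_nondec M'_ge2 _ Phi_le).
        exact: exprn_gt0.
      exact: leq_trans (leq_maxr _ _) T't.
    rewrite -mulr_sumr ler_wpM2l ?(ltW C0)// [leRHS](big_cat_nat TT T'T)/= lerDr.
    by apply: sumr_ge0 => t _; exact: volume_ge0.
apply/eqP; rewrite eq_le probability_le1//= -full; apply: le_measure; rewrite ?inE//.
  by apply: measurable_lim_sup_set => t; exact: measurable_solvable.
move=> A LA i _; have [t /= it At] := LA i Logic.I.
by exists (M' ^ t)%N => //=; rewrite (leq_trans it)// ltnW.
Qed.

End zero_one_law.

Theorem theorem9 (R : realType) (m n : nat) (m_gt0 : (0 < m)%N) (n_gt0 : (0 < n)%N)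
  (phi : 'I_n -> nat -> R) (Phi : 'I_m -> nat -> R)
  (phi_gt0 : forall j u, (1 <= u)%N -> 0 < phi j u)
  (phi_noninc : forall j u v, (1 <= u)%N -> (u <= v)%N -> phi j v <= phi j u)
  (phi_cvg0 : forall j, phi j u @[u --> \oo] --> 0)
  (Phi_gt0 : forall k u, (1 <= u)%N -> 0 < Phi k u)
  (Phi_nondec : forall k u v, (1 <= u)%N -> (u <= v)%N -> Phi k u <= Phi k v)
  (Phi_cvgy : forall k, Phi k u @[u --> \oo] --> +oo)
  (N0 M : nat) (M_ge2 : (2 <= M)%N) (c1 c2 : R) (c1_gt1 : 1 < c1) (c2_gt1 : 1 < c2)
  (Phi_growth : forall i, (N0 <= i)%N -> forall k,
     c1 * Phi k (M ^ i)%N <= Phi k (M ^ i.+1)%N <= c2 * Phi k (M ^ i)%N) :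
  let S : \bar R := (\sum_(1 <= q <oo)
    (q%:R^-1 * ((\prod_(j < n) phi j q) * (\prod_(k < m) Phi k q)) ^+ 2)%:E)%E in
  ((S < +oo)%E -> lebesgue_Cmx (W_C phi Phi) = 0%E) /\
  (S = +oo%E -> lebesgue_Cmx (W_C phi Phi) = 1%E).
Proof.
move=> S; split=> Soo; rewrite lebesgue_Cmx_W_C.
  exact: (limsup_null phi_gt0 phi_noninc phi_cvg0 Phi_gt0 Phi_nondec Phi_cvgy
    M_ge2 c2_gt1 Phi_growth Soo).
exact: (limsup_full phi_gt0 phi_noninc phi_cvg0 Phi_gt0 Phi_nondec Phi_cvgy
  M_ge2 c1_gt1 c2_gt1 Phi_growth m_gt0 Soo).
Qed.
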